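(* Consider the logistic network formation model and the estimators described in the context, and suppose (DGP), (LR), (RSC), (TUNE) and (EIG-split) hold. Then there exist constants $C_1^*$ and $C_{0,v}$, not depending on $n$, such that for $l=0,1$, with probability approaching one as $n\to\infty$, $$\max_{i\in I_2}\big\|(\widehat O_l^{(1)})^\top\widehat u_{i,l}^{(1)}-u_{i,l}\big\|\le C_1^*\,\eta_n\quad\text{and}\quad \max_{j\in[n]}\big\|(\widehat O_l^{(1)})^\top\dot v_{j,l}^{(0,1)}-v_{j,l}\big\|\le C_{0,v}\,\eta_n .$$
   Context: Notation. $[n]=\{1,\dots,n\}$; $\|\cdot\|$ is the Euclidean norm; $\|\cdot\|_{op},\|\cdot\|_F,\|\cdot\|_*$ are the spectral, Frobenius and nuclear norms; $\odot$ is the Hadamard product; $\Lambda(u)=1/(1+e^{-u})$; w.p.a.1 means with probability approaching one as $n\to\infty$. All named constants do not depend on $n$. Model. For $i<j$ in $[n]$, $Y_{ij}=\mathbf 1\{\varepsilon_{ij}\le \tau_n+\Theta^*_{0,ij}+W_{1,ij}\Theta^*_{1,ij}\}$, with $Y_{ij}=Y_{ji}$, $Y_{ii}=0$, $\tau_n=\log\zeta_n$, $\zeta_n>0$ a deterministic sequence (possibly $\to0$), $W_{1,ij}=W_{1,ji}$, $\Theta_l^*$ ($l=0,1$) unknown $n\times n$ parameter matrices. $W_{0,ij}=1$, $W_{ij}=(1,W_{1,ij})^\top$, $\Gamma^*_{0,ij}=\tau_n+\Theta^*_{0,ij}$, $\Gamma_1^*=\Theta_1^*$, $\Gamma^*_{ij}=(\Gamma^*_{0,ij},\Gamma^*_{1,ij})^\top$,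 $\Lambda_{n,ij}=\Lambda(W_{ij}^\top\Gamma^*_{ij})$; $W_1=\{W_{1,ij}\}$ (diagonal set by any convention with $|W_{1,ii}|\le M_W$). The nodes are randomly split into disjoint sets $I_1,I_2$ of roughly equal sizes $n_1,n_2$ ($n/2$ each if $n$ is even); $A(I_1)$ denotes the rows of $A$ with index in $I_1$. The ranks $K_0,K_1$ are fixed and known. $\eta_n=\sqrt{\frac{\log n}{n\zeta_n}}+\frac{\log n}{n\zeta_n}$. (DGP) $W_{1,ij}=g_1(X_i,X_j,e_{ij})$ with $g_1$ symmetric in its first two arguments, $\{X_i\}_{i\le n}$ i.i.d., $\{e_{ij}\}_{i<j}$ i.i.d., $e_{ij}=e_{ji}$; $\{\varepsilon_{ij}\}_{i<j}$ i.i.d. standard logistic, independent of $\{X_i\}\cup\{e_{ij}\}$; $\max_{i\ne j}|W_{1,ij}|\le M_W<\infty$. (LR) $\sum_{i,j}\Theta^*_{0,ij}=0$. Each $\Theta_l^*$ is symmetric of rank $K_l$ with SVD $n^{-1}\Theta_l^*=\mathcal U_l\Sigma_l\mathcal V_l^\top$, $\mathcal U_l^\top\mathcal U_l=\mathcal V_l^\top\mathcal V_l=I_{K_l}$, $\Sigma_l=\mathrm{diag}(\sigma_{1,l}\ge\dots\ge\sigma_{K_l,l})$. Put $U_l=\sqrt n\,\mathcal U_l\Sigma_l$, $V_l=\sqrt n\,\mathcal V_l$ (so $\Theta_l^*=U_lV_l^\top$) with $i$-th rows $u_{i,l}^\top,v_{i,l}^\top$. For a constant $M$: $\max_{i,l}(\|u_{i,l}\|\vee\|v_{i,l}\|)\le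 M$ and $|\Theta^*_{l,ij}|\le M$; and $\infty>C_\sigma\ge\limsup_n\max_l\sigma_{1,l}\ge\liminf_n\min_l\sigma_{K_l,l}\ge c_\sigma>0$. (RSC) Let $\bar U_{l,c},\bar V_{l,c}$ be matrices of left/right singular vectors of $\Gamma_l^*$ for its zero singular values, $\mathcal P_l(\Delta)=\bar U_{l,c}\bar U_{l,c}^\top\Delta\bar V_{l,c}\bar V_{l,c}^\top$, $\mathcal M_l(\Delta)=\Delta-\mathcal P_l(\Delta)$, and $\mathcal C(a)=\{(\Delta_0,\Delta_1):\sum_l\|\mathcal P_l(\Delta_l)\|_*\le a\sum_l\|\mathcal M_l(\Delta_l)\|_*\}$. For every $a>0$ there are $\kappa,c_2,c_3>0$ such that w.p.a.1 every $(\Delta_0,\Delta_1)\in\mathcal C(a)$ satisfies $\sum_l\|\Delta_l\|_F^2\le c_2n\log(n)/\zeta_n$ or $\|\Delta_0+\Delta_1\odot W_1\|_F^2\ge\kappa\sum_l\|\Delta_l\|_F^2-c_3n\log(n)/\zeta_n$. The same holds with $(\Gamma_0^*,\Gamma_1^* )$ (and $W_1$) replaced by their row-submatrices for $I_1$ and for $I_2$. (TUNE) (i) $C_\lambda>C_\Upsilon M_W$, where $C_\Upsilon$ is a fixed, sufficiently large constant such that w.p.a.1 $\max_{l}\|\Upsilon_l\|_{op}\le C_\Upsilon M_W(\sqrt{\zeta_nn}+\sqrt{\log n})$ for $\Upsilon_{l,ij}=(Y_{ij}-\Lambda_{n,ij})W_{l,ij}$ ($i\in I_1$, $j\in[n]$,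 $j\ne i$), $\Upsilon_{l,ii}=0$ (and likewise for all rows $i\in[n]$); (ii) $\underline c\zeta_n\le\Lambda_{n,ij}\le\bar c\zeta_n$ with $0<\underline c\le\bar c<\infty$; (iii) $\sqrt{\log n/(n\zeta_n)}\le c_F\le 1/4$ for a sufficiently small constant $c_F$ (small relative to the other constants); (iv) $\frac1{n_1n}\sum_{i\in I_1,j\in[n]}\Theta^*_{0,ij}=o(\sqrt{\log n/(n\zeta_n)})$. (EIG-split) With $\psi_{ij}=(u_{i,0}^\top,u_{i,1}^\top W_{1,ij})^\top$, $\phi_{ij}=(v_{j,0}^\top,v_{j,1}^\top W_{1,ij})^\top$, $\Psi_j(I_2)=\frac1{n_2}\sum_{i\in I_2,i\ne j}\psi_{ij}\psi_{ij}^\top$, $\Phi_i(I_2)=\frac1{n_2}\sum_{j\in I_2,j\ne i}\phi_{ij}\phi_{ij}^\top$: for constants $0<c_\phi\le C_\phi<\infty$, w.p.a.1 all eigenvalues of $\Psi_j(I_2)$ ($j\in[n]$) and $\Phi_i(I_2)$ ($i\in I_2$) lie in $[c_\phi,C_\phi]$. Estimators. Let $\ell_{ij}(\gamma)=Y_{ij}\log\Lambda(W_{ij}^\top\gamma)+(1-Y_{ij})\log(1-\Lambda(W_{ij}^\top\gamma))$, $f_M(u)=\max(-M,\min(u,M))$, $C_M>0$ a fixed constant. Step 1 (full sample): $Q_n(\Gamma)=\frac{-1}{n(n-1)}\sum_{i\ne j}\ell_{ij}(\Gamma_{ij})$, $\lambda_n=C_\lambda(\sqrt{\zeta_nn}+\sqrt{\log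 n})/(n(n-1))$. $\widetilde\Gamma$ minimizes $Q_n(\Gamma)+\lambda_n\sum_{l}\|\Gamma_l\|_*$ over pairs of $n\times n$ matrices with $|\Gamma_{l,ij}|\le\log n$; $\widetilde\tau_n=\frac1{n(n-1)}\sum_{i\ne j}\widetilde\Gamma_{0,ij}$; $\widehat\Gamma$ minimizes the same objective subject to $|\Gamma_{0,ij}-\widetilde\tau_n|\le C_M\sqrt{\log n}$, $|\Gamma_{1,ij}|\le C_M\sqrt{\log n}$; $\widehat\tau_n=\frac1{n(n-1)}\sum_{i\ne j}\widehat\Gamma_{0,ij}$. Step 2 (split sample): repeat Step 1 using only pairs $(i,j)\in I_1\times[n]$, $i\ne j$, with $n_1\times n$ matrices, the factor $n(n-1)$ replaced by $n_1(n-1)$ in the objective, in $\lambda_n$ and in the averages, giving $\widehat\Gamma^{(1)}$, $\widehat\tau_n^{(1)}$. For $i\in I_1$ put $\widehat\Theta^{(1)}_{l,ij}=f_M(\frac12(\widehat\Gamma^{(1)}_{l,ij}+\widehat\Gamma^{(1)}_{l,ji})-\widehat\tau^{(1)}_n\mathbf 1\{l=0\})$ if $j\in I_1,j\neq i$; $0$ if $j=i$; $f_M(\widehat\Gamma^{(1)}_{l,ij}-\widehat\tau_n^{(1)}\mathbf 1\{l=0\})$ if $j\notin I_1$. $\widehat V_l^{(1)}$ is $\sqrt n$ times the matrix of the first $K_l$ right singular vectors of $n^{-1}\widehat\Theta_l^{(1)}$, with rows $(\widehat v_{j,l}^{(1)})^\top$. Alignment matrix: $\widehat O_l^{(1)}$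 is a $K_l\times K_l$ orthogonal matrix depending on $(V_l,\widehat V_l^{(1)})$ such that w.p.a.1 $\|V_l-\widehat V_l^{(1)}\widehat O_l^{(1)}\|_F\le136C_{F,2}\sqrt n\,\eta_n$ (such a matrix is provided by the paper's Frobenius-norm analysis of Step 2), where $C_{F,2}=\max_l\sqrt{K_l}\,C_{F,1}C_\sigma c_\sigma^{-2}$, $C_{F,1}=\frac{\sqrt{\bar K}(M_W+C_M)(C_\lambda+C_\Upsilon M_W)}{\underline c\kappa}+\sqrt{c_3/\kappa}+\sqrt{c_2}$, $\bar K=\max(K_0+1,K_1)$, and $\kappa,c_2,c_3$ are those of (RSC) for $a=(C_\lambda+C_\Upsilon M_W)/(C_\lambda-C_\Upsilon M_W)$. Step 3: write $\mathcal L_{ij}(\mu;a)$ for the logistic log-likelihood $Y_{ij}\log p+(1-Y_{ij})\log(1-p)$ with $p=\Lambda(\widehat\tau_n+\sum_{l=0}^1\mu_l^\top a_lW_{l,ij})$, $\mu=(\mu_0,\mu_1)\in\mathbb R^{K_0+K_1}$. For $i\in I_2$, $(\widehat u_{i,0}^{(1)},\widehat u_{i,1}^{(1)})$ maximizes $\sum_{j\in I_2,j\ne i}\mathcal L_{ij}(\mu;\widehat v^{(1)}_j)$ over $\mu$; for $j\in[n]$, $(\dot v_{j,0}^{(0,1)},\dot v_{j,1}^{(0,1)})$ maximizes $\sum_{i\in I_2,i\ne j}\mathcal L_{ij}(\mu;\widehat u_i^{(1)})$ over $\mu$. *)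

(* Defs.v *)
From HB Require Import structures.
From mathcomp Require Import all_boot all_order all_algebra.
From mathcomp Require Import all_classical all_reals all_analysis.

Set Implicit Arguments.
Unset Strict Implicit.
Unset Printing Implicit Defensive.

Import Order.TTheory GRing.Theory Num.Theory.
Import numFieldNormedType.Exports.

Local Open Scope classical_set_scope.
Local Open Scope ring_scope.

(** The two layers l = 0, 1 are indexed by ['I_2]. *)
Notation l0 := (ord0 : 'I_2).
Notation l1 := (ord_max : 'I_2).

Section LinearAlgebra.
Context {R : realType}.

Definition enorm k (x : 'cV[R]_k) : R := Num.sqrt (\sum_i x i 0 ^+ 2).

Definition frob m n (A : 'M[R]_(m, n)) : R :=
  Num.sqrt (\sum_i \sum_j A i j ^+ 2).

Definition opnorm m n (A : 'M[R]_(m, n)) : R :=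
  sup [set enorm (A *m x) | x in [set x : 'cV[R]_n | enorm x <= 1]].

Definition hadamard m n (A B : 'M[R]_(m, n)) : 'M[R]_(m, n) :=
  map2_mx *%R A B.

(** Full singular value decomposition A = U D V^T, with U and V square
    orthogonal and D rectangular diagonal; [s k] is the (k+1)-st largest
    singular value, with [s k = 0] for [k >= minn m n]. *)
Definition svd m n (A : 'M[R]_(m, n))
    (U : 'M[R]_m) (s : nat -> R) (V : 'M[R]_n) : Prop :=
  [/\ U^T *m U = 1%:M, V^T *m V = 1%:M,
      A = U *m (\matrix_(i, j) if i == j :> nat then s i else 0) *m V^T,
      (forall k, 0 <= s k.+1 <= s k) &
      (forall k, (minn m n <= k)%N -> s k = 0)].

(** An SVD of A picked by choice.  The singular values, and the product
    [P_perp] below, do not depend on the choice. *)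
Definition svd_of m n (A : 'M[R]_(m, n)) : 'M[R]_m * (nat -> R) * 'M[R]_n :=
  xget (0, (fun=> 0), 0) [set t | svd A t.1.1 t.1.2 t.2].

Definition nuclear m n (A : 'M[R]_(m, n)) : R :=
  \sum_(k < minn m n) (svd_of A).1.2 k.

(** The columns of U attached to a zero singular value; the other columns are
    replaced by 0 instead of being removed, which does not change Uc Uc^T. *)
Definition zero_sv_cols n (s : nat -> R) (U : 'M[R]_n) : 'M[R]_n :=
  \matrix_(i, k) if s k == 0 then U i k else 0.

(** P(D) = Uc Uc^T D Vc Vc^T, where Uc and Vc collect the left and right
    singular vectors of G for its zero singular values. *)
Definition P_perp m n (G D : 'M[R]_(m, n)) : 'M[R]_(m, n) :=
  let Uc := zero_sv_cols (svd_of G).1.2 (svd_of G).1.1 in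
  let Vc := zero_sv_cols (svd_of G).1.2 (svd_of G).2 in
  Uc *m Uc^T *m D *m Vc *m Vc^T.

Definition M_part m n (G D : 'M[R]_(m, n)) : 'M[R]_(m, n) := D - P_perp G D.

(** X consists of the first K right singular vectors of A, in order
    (meaningful for K <= n). *)
Definition top_right_sv m n (A : 'M[R]_(m, n)) K (X : 'M[R]_(n, K)) : Prop :=
  exists U s V, svd A U s V /\
    forall (j : 'I_n) (k : 'I_K) (k' : 'I_n), k' = k :> nat -> X j k = V j k'.

End LinearAlgebra.

Section Optimisation.
Context {R : realType} {A : Type}.

Definition is_argmin (D : set A) (f : A -> R) (x : A) : Prop :=
  D x /\ forall y, D y -> f x <= f y.

Definition is_argmax (f : A -> R) (x : A) : Prop := forall y, f y <= f x.

(** A logistic likelihood has no maximizer on some data sets (for example when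
    all the responses are 0); there the estimator is left unconstrained. *)
Definition maximizes (f : A -> R) (x : A) : Prop :=
  (exists y, is_argmax f y) -> is_argmax f x.

End Optimisation.

Section Probability.
Context {R : realType} {d : measure_display} {T : measurableType d}.
Variable P : probability T R.

(** Mutual independence of the finite family (Z j), j in D; subfamilies are
    covered by taking some of the A j to be the full set. *)
Definition indep_family (J : finType) (D : pred J) d' (E : measurableType d')
    (Z : J -> T -> E) : Prop :=
  forall A : J -> set E, (forall j, measurable (A j)) ->
    P (\bigcap_(j in [set j | D j]) Z j @^-1` A j) =
    (\prod_(j | D j) P (Z j @^-1` A j))%E.

Definition iid (J : finType) (D : pred J) d' (E : measurableType d')
    (Z : J -> T -> E) : Prop :=
  [/\ forall j, D j -> measurable_fun setT (Z j),
      indep_family D Z &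
      forall j k, D j -> D k -> forall A, measurable A ->
        P (Z j @^-1` A) = P (Z k @^-1` A)].

(** The events {Z j in A}, j in D: generators of the sigma-algebra of (Z j). *)
Definition events_of (J : finType) (D : pred J) d' (E : measurableType d')
    (Z : J -> T -> E) : set (set T) :=
  [set B | exists j A, [/\ D j, measurable A & B = Z j @^-1` A]].

Definition indep_sigma (F G : set (set T)) : Prop :=
  forall A B, <<s F >> A -> <<s G >> B -> P (A `&` B) = (P A * P B)%E.

End Probability.

(** E n holds with probability approaching one.  The events E n may involve
    selections of minimizers or singular vectors, so they are not assumed
    measurable: inner probability is used. *)
Definition wpa1 {R : realType} {dT : nat -> measure_display}
    {T : forall n, measurableType (dT n)} (P : forall n, probability (T n) R)
    (E : forall n, T n -> Prop) : Prop :=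
  exists A : forall n, set (T n),
    [/\ forall n, measurable (A n),
        forall n, A n `<=` [set w | E n w] &
        (fun n => P n (A n)) @ \oo --> 1%E].

(** The constants of the setting: none depends on n.  The constants of the
    restricted strong convexity condition depend on the cone parameter a. *)
Record constants (R : realType) := Constants {
  K : 'I_2 -> nat;
  M : R;
  M_W : R;
  c_sigma : R;
  C_sigma : R;
  kappa : R -> R;
  c2 : R -> R;
  c3 : R -> R;
  C_lambda : R;
  C_Upsilon : R;
  c_low : R;
  c_high : R;
  c_phi : R;
  C_phi : R;
  C_M : R }.

Record constants_ok (R : realType) (c : constants R) : Prop := ConstantsOk {
  K_gt0 : forall l, (0 < K c l)%N;
  M_gt0 : 0 < M c;
  M_W_gt0 : 0 < M_W c;
  sigma_range : 0 < c_sigma c <= C_sigma c;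
  rsc_gt0 : forall a, 0 < a -> [/\ 0 < kappa c a, 0 < c2 c a & 0 < c3 c a];
  C_Upsilon_gt0 : 0 < C_Upsilon c;
  C_lambda_gt : C_Upsilon c * M_W c < C_lambda c;
  Lambda_range : 0 < c_low c <= c_high c;
  phi_range : 0 < c_phi c <= C_phi c;
  C_M_gt0 : 0 < C_M c }.

Section DerivedConstants.
Context {R : realType}.
Variable c : constants R.

Definition a_star : R :=
  (C_lambda c + C_Upsilon c * M_W c) / (C_lambda c - C_Upsilon c * M_W c).

Definition C_F1 : R :=
  Num.sqrt (maxn (K c l0).+1 (K c l1))%:R * (M_W c + C_M c)
    * (C_lambda c + C_Upsilon c * M_W c) / (c_low c * kappa c a_star)
  + Num.sqrt (c3 c a_star / kappa c a_star) + Num.sqrt (c2 c a_star).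

Definition C_F2 : R :=
  Num.max (Num.sqrt (K c l0)%:R) (Num.sqrt (K c l1)%:R)
    * C_F1 * C_sigma c * (c_sigma c) ^- 2.

End DerivedConstants.

Definition Lambda {R : realType} (u : R) : R := (1 + expR (- u))^-1.

Definition loglik {R : realType} (y p : R) : R := y * ln p + (1 - y) * ln (1 - p).

Definition trunc {R : realType} (M u : R) : R := Num.max (- M) (Num.min u M).

(** The sampling model, for each n: the primitive variables, the covariate
    matrix, the random set [I1] of the sample split, and the deterministic
    parameters together with a thin SVD
    Theta_l / n = calU_l diag(sigma_l) calV_l^T.
    [sigma n l k] is the (k+1)-st singular value, for [k < K l]. *)
Record network (R : realType) (c : constants R)
    (dT : nat -> measure_display) (T : forall n, measurableType (dT n))
    (dX dE : measure_display)
    (EX : measurableType dX) (EE : measurableType dE) := Network {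
  g1 : EX -> EX -> EE -> R;
  X : forall n, 'I_n -> T n -> EX;
  e : forall n, 'I_n -> 'I_n -> T n -> EE;
  eps : forall n, 'I_n -> 'I_n -> T n -> R;
  W1 : forall n, T n -> 'M[R]_n;
  I1 : forall n, T n -> {set 'I_n};
  zeta : nat -> R;
  Theta : forall n, 'I_2 -> 'M[R]_n;
  calU : forall n l, 'M[R]_(n, K c l);
  sigma : nat -> 'I_2 -> nat -> R;
  calV : forall n l, 'M[R]_(n, K c l) }.

Section Model.
Context {R : realType} {c : constants R}.
Context {dT : nat -> measure_display} {T : forall n, measurableType (dT n)}.
Variable P : forall n, probability (T n) R.
Context {dX dE : measure_display}.
Context {EX : measurableType dX} {EE : measurableType dE}.
Variable N : network c T EX EE.

Definition tau n : R := ln (zeta N n).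

Definition log_rate n : R := ln n%:R / (n%:R * zeta N n).

Definition eta n : R := Num.sqrt (log_rate n) + log_rate n.

Definition Gamma n (l : 'I_2) : 'M[R]_n :=
  if l == l0 then const_mx (tau n) + Theta N n l0 else Theta N n l1.

Definition W n (w : T n) (l : 'I_2) : 'M[R]_n :=
  if l == l0 then const_mx 1 else W1 N w.

Definition edge n (w : T n) (i j : 'I_n) : R :=
  (eps N i j w <= tau n + Theta N n l0 i j + W1 N w i j * Theta N n l1 i j)%R%:R.

(** Only the shocks eps_ij with i < j enter the network. *)
Definition Y n (w : T n) (i j : 'I_n) : R :=
  if (i < j)%N then edge w i j else if (j < i)%N then edge w j i else 0.

(** W_ij^T gamma *)
Definition Wdot n (w : T n) (i j : 'I_n) (g : 'I_2 -> R) : R :=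
  \sum_(l < 2) W w l i j * g l.

Definition Lambda_n n (w : T n) (i j : 'I_n) : R :=
  Lambda (Wdot w i j (fun l => Gamma n l i j)).

Definition I2 n (w : T n) : {set 'I_n} := ~: I1 N w.

(** U_l = sqrt n calU_l Sigma_l and V_l = sqrt n calV_l *)
Definition Sigma n l : 'M[R]_(K c l) := diag_mx (\row_k sigma N n l k).
Definition U n l : 'M[R]_(n, K c l) :=
  Num.sqrt n%:R *: (calU N n l *m Sigma n l).
Definition V n l : 'M[R]_(n, K c l) := Num.sqrt n%:R *: calV N n l.

(** A subset of m nodes used as row indices is given by its labelling
    [f : 'I_m -> 'I_n]: the identity for the full sample, and [rows_of I] for
    the rows in I.  Row k of an m x n matrix then refers to node [f k]. *)
Definition rows_of n (I : {set 'I_n}) : 'I_#|I| -> 'I_n := @enum_val _ (mem I).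

Definition pairs_of n (p : 'I_n * 'I_n) : bool := (p.1 < p.2)%N.

Definition data_events n : set (set (T n)) :=
  events_of xpredT (@X _ _ _ _ _ _ _ _ N n) `|`
  events_of (@pairs_of n) (fun p => e N p.1 p.2).

Definition eps_events n : set (set (T n)) :=
  events_of (@pairs_of n) (fun p => eps N p.1 p.2).

Record DGP : Prop := {
  g1_meas : measurable_fun setT (fun p : EX * EX * EE => g1 N p.1.1 p.1.2 p.2);
  g1_sym : forall x y z, g1 N x y z = g1 N y x z;
  X_iid : forall n, iid (P n) xpredT (@X _ _ _ _ _ _ _ _ N n);
  e_sym : forall n (i j : 'I_n), e N i j = e N j i;
  e_iid : forall n, iid (P n) (@pairs_of n) (fun p => e N p.1 p.2);
  eps_iid : forall n, iid (P n) (@pairs_of n) (fun p => eps N p.1 p.2);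
  eps_logistic : forall n (i j : 'I_n), (i < j)%N -> forall t : R,
    P n [set w | eps N i j w <= t] = (Lambda t)%:E;
  eps_indep : forall n, indep_sigma (P n) (@eps_events n) (@data_events n);
  W1_def : forall n (w : T n) (i j : 'I_n), i != j ->
    W1 N w i j = g1 N (X N i w) (X N j w) (e N i j w);
  (* including the diagonal, which is set by an arbitrary convention *)
  W1_bound : forall n,
    {ae P n, forall w, forall i j : 'I_n, `|W1 N w i j| <= M_W c} }.

(** I1 is uniform among the subsets of a given size, n / 2 up to rounding, and
    independent of everything else. *)
Definition random_split : Prop := forall n, exists n1 : nat,
  [/\ (n./2 <= n1 <= uphalf n)%N,
      (forall w : T n, #|I1 N w| = n1),
      (forall S : {set 'I_n}, measurable [set w : T n | I1 N w = S]),
      (forall S : {set 'I_n}, #|S| = n1 ->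
        P n [set w | I1 N w = S] = ('C(n, n1)%:R^-1)%:E) &
      (forall S : {set 'I_n}, forall B,
        <<s @eps_events n `|` @data_events n >> B ->
        P n ([set w | I1 N w = S] `&` B) =
        (P n [set w | I1 N w = S] * P n B)%E)].

(** The conditions on each fixed matrix are required for all large n: a matrix
    of rank K_l > 0 does not exist for small n. *)
Record LR : Prop := {
  Theta0_center : \forall n \near \oo, \sum_i \sum_j Theta N n l0 i j = 0;
  Theta_sym : \forall n \near \oo, forall l, (Theta N n l)^T = Theta N n l;
  Theta_rank : \forall n \near \oo, forall l, \rank (Theta N n l) = K c l;
  Theta_svd : \forall n \near \oo, forall l,
    n%:R^-1 *: Theta N n l = calU N n l *m Sigma n l *m (calV N n l)^T;
  calU_orth : \forall n \near \oo, forall l,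
    (calU N n l)^T *m calU N n l = 1%:M;
  calV_orth : \forall n \near \oo, forall l,
    (calV N n l)^T *m calV N n l = 1%:M;
  sigma_ge0 : \forall n \near \oo, forall l k,
    (k < K c l)%N -> 0 <= sigma N n l k;
  sigma_dec : \forall n \near \oo, forall l k,
    (k.+1 < K c l)%N -> sigma N n l k.+1 <= sigma N n l k;
  row_bound : \forall n \near \oo, forall l (i : 'I_n),
    enorm (row i (U n l))^T <= M c /\ enorm (row i (V n l))^T <= M c;
  Theta_bound : \forall n \near \oo, forall l (i j : 'I_n),
    `|Theta N n l i j| <= M c;
  sigma_limsup :
    (limn_esup (fun n =>
       (Num.max (sigma N n l0 0) (sigma N n l1 0))%:E) <= (C_sigma c)%:E)%E;
  sigma_liminf :
    ((c_sigma c)%:E <= limn_einf (fun n =>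
       (Num.min (sigma N n l0 (K c l0).-1) (sigma N n l1 (K c l1).-1))%:E))%E }.

(** The cone C(a) built from the pair G *)
Definition cone m n (G : 'I_2 -> 'M[R]_(m, n)) (a : R)
    (D : 'I_2 -> 'M[R]_(m, n)) : Prop :=
  \sum_(l < 2) nuclear (P_perp (G l) (D l))
  <= a * \sum_(l < 2) nuclear (M_part (G l) (D l)).

Definition rsc_event n m (f : 'I_m -> 'I_n) (a : R) (w : T n) : Prop :=
  forall D : 'I_2 -> 'M[R]_(m, n),
    cone (fun l => rowsub f (Gamma n l)) a D ->
    let b := n%:R * ln n%:R / zeta N n in
    \sum_(l < 2) frob (D l) ^+ 2 <= c2 c a * b \/
    kappa c a * (\sum_(l < 2) frob (D l) ^+ 2) - c3 c a * b
      <= frob (D l0 + hadamard (D l1) (rowsub f (W1 N w))) ^+ 2.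

Definition RSC : Prop := forall a, 0 < a ->
  [/\ wpa1 P (fun n w => rsc_event (@id 'I_n) a w),
      wpa1 P (fun n w => rsc_event (@rows_of n (I1 N w)) a w) &
      wpa1 P (fun n w => rsc_event (@rows_of n (I2 w)) a w)].

Definition Upsilon n m (f : 'I_m -> 'I_n) (w : T n) (l : 'I_2) : 'M[R]_(m, n) :=
  \matrix_(k, j) if f k == j then 0
                 else (Y w (f k) j - Lambda_n w (f k) j) * W w l (f k) j.

Definition noise_level n : R := Num.sqrt (zeta N n * n%:R) + Num.sqrt (ln n%:R).

Definition Upsilon_event n m (f : 'I_m -> 'I_n) (w : T n) : Prop :=
  forall l, opnorm (Upsilon f w l) <= C_Upsilon c * M_W c * noise_level n.

(** The inequality C_lambda > C_Upsilon M_W is in [constants_ok].  As I1 is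
    random, the average of Theta_0 over I1 x [n] is o(.) in probability. *)
Record TUNE (c_F : R) : Prop := {
  zeta_gt0 : forall n, 0 < zeta N n;
  Upsilon_split : wpa1 P (fun n w => Upsilon_event (@rows_of n (I1 N w)) w);
  Upsilon_full : wpa1 P (fun n w => Upsilon_event (@id 'I_n) w);
  Lambda_n_range : \forall n \near \oo,
    {ae P n, forall w, forall i j : 'I_n, i != j ->
      c_low c * zeta N n <= Lambda_n w i j <= c_high c * zeta N n};
  zeta_rate : \forall n \near \oo, Num.sqrt (log_rate n) <= c_F;
  Theta0_split : forall delta : R, 0 < delta -> wpa1 P (fun n w =>
    `|(#|I1 N w|%:R * n%:R)^-1 * \sum_(i in I1 N w) \sum_j Theta N n l0 i j|
    <= delta * Num.sqrt (log_rate n)) }.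

(** psi_ij and phi_ij as row vectors *)
Definition psi n (w : T n) (i j : 'I_n) : 'rV[R]_(K c l0 + K c l1) :=
  row_mx (row i (U n l0)) (W1 N w i j *: row i (U n l1)).
Definition phi n (w : T n) (i j : 'I_n) : 'rV[R]_(K c l0 + K c l1) :=
  row_mx (row j (V n l0)) (W1 N w i j *: row j (V n l1)).

Definition Psi2 n (w : T n) (j : 'I_n) : 'M[R]_(K c l0 + K c l1) :=
  #|I2 w|%:R^-1 *: \sum_(i in I2 w | i != j) (psi w i j)^T *m psi w i j.
Definition Phi2 n (w : T n) (i : 'I_n) : 'M[R]_(K c l0 + K c l1) :=
  #|I2 w|%:R^-1 *: \sum_(j in I2 w | j != i) (phi w i j)^T *m phi w i j.

Definition EIG_split : Prop := wpa1 P (fun n w =>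
  (forall j a, eigenvalue (Psi2 w j) a -> c_phi c <= a <= C_phi c) /\
  (forall i a, i \in I2 w ->
     eigenvalue (Phi2 w i) a -> c_phi c <= a <= C_phi c)).

(** Step 1 with rows labelled by f.  For [f = id] this is the full sample;
    for [f = rows_of I1] it is the version on the pairs of I1 x [n]. *)
Section Step1.
Variables (n m : nat) (f : 'I_m -> 'I_n) (w : T n).

Definition npairs : R := m%:R * n.-1%:R.

Definition Q_n (G : 'I_2 -> 'M[R]_(m, n)) : R :=
  - npairs^-1 * \sum_(k < m) \sum_(j < n | j != f k)
     loglik (Y w (f k) j) (Lambda (Wdot w (f k) j (fun l => G l k j))).

Definition lambda_n : R := C_lambda c * noise_level n / npairs.

Definition objective (G : 'I_2 -> 'M[R]_(m, n)) : R :=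
  Q_n G + lambda_n * \sum_(l < 2) nuclear (G l).

Definition mean_offdiag (G : 'I_2 -> 'M[R]_(m, n)) : R :=
  npairs^-1 * \sum_(k < m) \sum_(j < n | j != f k) G l0 k j.

(** Gt and Gh are Gamma-tilde and Gamma-hat *)
Definition step1 (Gt Gh : 'I_2 -> 'M[R]_(m, n)) : Prop :=
  is_argmin [set G : 'I_2 -> 'M[R]_(m, n) | forall l k j, `|G l k j| <= ln n%:R] objective Gt /\
  is_argmin [set G : 'I_2 -> 'M[R]_(m, n) | forall k j,
      `|G l0 k j - mean_offdiag Gt| <= C_M c * Num.sqrt (ln n%:R) /\
      `|G l1 k j| <= C_M c * Num.sqrt (ln n%:R)] objective Gh.

(** Theta-hat_l, from Gamma-hat *)
Definition Theta_hat (Gh : 'I_2 -> 'M[R]_(m, n)) (l : 'I_2) : 'M[R]_(m, n) :=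
  let t := if l == l0 then mean_offdiag Gh else 0 in
  \matrix_(k, j)
    if j == f k then 0
    else if [pick k' | f k' == j] is Some k'
    then trunc (M c) (2^-1 * (Gh l k j + Gh l k' (f k)) - t)
    else trunc (M c) (Gh l k j - t).

End Step1.

(** Generators of the sigma-algebra of the data used in Step 2: I1 and
    (Y_ij, W_1ij) for i in I1 and j != i. *)
Definition step2_events n : set (set (T n)) :=
  [set A | exists i, A = [set w | i \in I1 N w]] `|`
  [set A | exists i j (B : set R), [/\ i != j, measurable B &
     A = [set w | i \in I1 N w /\ B (Y w i j)]]] `|`
  [set A | exists i j (B : set R), [/\ i != j, measurable B &
     A = [set w | i \in I1 N w /\ B (W1 N w i j)]]].

(** L_ij(mu; a), at the estimate [th] of tau_n *)
Definition step3_loglik n (w : T n) (th : R) (i j : 'I_n)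
    (mu a : forall l, 'rV[R]_(K c l)) : R :=
  loglik (Y w i j)
    (Lambda (th + \sum_(l < 2) (\sum_k mu l 0 k * a l 0 k) * W w l i j)).

(** Gt, Gh: Step 1; Gt1, Gh1: Step 2; Vh1: hat V^(1); Oh1: alignment matrix as
    a function of (V_l, hat V_l^(1)); Uh1: hat u^(1), where only the rows in I2
    are relevant; Vd: dot v^(0,1). *)
Record estimators := Estimators {
  Gt : forall n, T n -> 'I_2 -> 'M[R]_n;
  Gh : forall n, T n -> 'I_2 -> 'M[R]_n;
  Gt1 : forall n (w : T n), 'I_2 -> 'M[R]_(#|I1 N w|, n);
  Gh1 : forall n (w : T n), 'I_2 -> 'M[R]_(#|I1 N w|, n);
  Vh1 : forall n, T n -> forall l, 'M[R]_(n, K c l);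
  Oh1_fun : forall n l,
    'M[R]_(n, K c l) -> 'M[R]_(n, K c l) -> 'M[R]_(K c l);
  Uh1 : forall n, T n -> forall l, 'M[R]_(n, K c l);
  Vd : forall n, T n -> forall l, 'M[R]_(n, K c l) }.

Variable E : estimators.

Definition tau_hat n (w : T n) : R := mean_offdiag (@id 'I_n) (Gh E w).

Definition Oh1 n (w : T n) l : 'M[R]_(K c l) :=
  Oh1_fun E (V n l) (Vh1 E w l).

Record estimators_ok : Prop := {
  step1_full : forall n (w : T n), step1 (@id 'I_n) w (Gt E w) (Gh E w);
  step2_split : forall n (w : T n),
    step1 (@rows_of n (I1 N w)) w (Gt1 E w) (Gh1 E w);
  step2_sv : forall n (w : T n) l, exists X : 'M[R]_(n, K c l),
    top_right_sv
      (n%:R^-1 *: Theta_hat (@rows_of n (I1 N w)) (Gh1 E w) l) X /\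
    Vh1 E w l = Num.sqrt n%:R *: X;
  (* hat V^(1) is a statistic of the Step 2 data: this excludes selections
     among non-unique minimizers that look at the rest of the sample *)
  step2_meas : forall n l (j : 'I_n) (k : 'I_(K c l)) (B : set R),
    measurable B -> <<s @step2_events n >> [set w | B (Vh1 E w l j k)];
  Oh1_orth : forall n (w : T n) l, (Oh1 w l)^T *m Oh1 w l = 1%:M;
  Oh1_align : forall l, wpa1 P (fun n w =>
    frob (V n l - Vh1 E w l *m Oh1 w l)
    <= 136 * C_F2 c * Num.sqrt n%:R * eta n);
  step3_u : forall n (w : T n) i, i \in I2 w ->
    maximizes
      (fun mu => \sum_(j in I2 w | j != i)
         step3_loglik w (tau_hat w) i j mu (fun l => row j (Vh1 E w l)))
      (fun l => row i (Uh1 E w l));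
  step3_v : forall n (w : T n) j,
    maximizes
      (fun mu => \sum_(i in I2 w | i != j)
         step3_loglik w (tau_hat w) i j mu (fun l => row i (Uh1 E w l)))
      (fun l => row j (Vd E w l)) }.

End Model.

(* Main.v *)
(** On an event of probability approaching one the argument is deterministic.
    Restricted strong convexity, the decomposability of the nuclear norm and the
    operator norm bound on the noise give the Frobenius rate n eta_n for the
    Step 1 and Step 2 estimates of Gamma, hence the rate eta_n for hat tau_n.

    In Step 3 each node carries a logistic regression of fixed dimension on
    estimated regressors.  Its log-likelihood is compared at the (rotated) true
    coefficient and on a sphere of radius C eta_n around it: the Hessian is
    bounded below by n zeta_n times the eigenvalue condition, and the errors in
    the regressors enter only through their mean square, which the alignment
    bound controls.  So the maximizer exists and lies in the ball as soon as the
    score is O(n zeta_n eta_n).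

    The score at hat v^(1) is small because hat v^(1) depends only on the data
    of the rows in I_1, hence is independent of the shocks of the pairs inside
    I_2: a Chernoff bound conditional on the split, the covariates and those
    data applies, once the entries of hat V^(1) are bounded.  That bound holds
    because hat V^(1) spans almost the same space as V_l, so its singular values
    are bounded below, while the entries of hat Theta^(1) are truncated.  The
    singular values of the rows of U_l in I_1 are bounded below by transferring
    the eigenvalue condition from I_2: the two halves of the split have almost
    the same law.

    In the second regression the regressors hat u^(1) depend on all the shocks,
    but are uniformly within C eta_n of the deterministic u, so the score at
    hat u^(1) differs from the score at u by at most eta_n times the sum of the
    |Y - Lambda|, which is O(n zeta_n). *)

From HB Require Import structures.
Require Import Defs.
From mathcomp Require Import all_boot all_order all_algebra.
From mathcomp Require Import all_classical all_reals all_analysis.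
From mathcomp Require Import measurable_realfun.
From mathcomp Require Import ring lra zify.

Set Implicit Arguments.
Unset Strict Implicit.
Unset Printing Implicit Defensive.

Import Order.TTheory GRing.Theory Num.Theory.
Import numFieldNormedType.Exports.
Local Open Scope classical_set_scope.
Local Open Scope ring_scope.

(** * Frobenius geometry *)

(** The score weights of the first regression are random, and the split takes exponentially many
    values. Both are met by one moment bound on each event {I1 = S}: the shocks of the pairs (i, j)
    are integrated out one at a time, each independent of the sigma-algebra carrying the weights,
    and the factor P(I1 = S) is kept. Over all S these factors sum to 1, so the union bound pays
    only for nodes and coordinates. Bounds that hold only on the favorable event enter the weights
    as cutoffs.

    Curvature is used through the exact Bregman form of the likelihood at the true index: for |d| <=
    b and b >= 1 the divergence is at least Lambda (1 - Lambda) d^2 / (4 b). Being global in d, it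
    gives existence of maximizers as well as rates. It also explains the two minimizations of Step
    1: the squared Frobenius error grows like n b^2 / zeta_n, with b of order log n for the first
    minimizer and sqrt(log n) for the second. The first error serves only to make the truth feasible
    for the second problem, one of the places where c_F must be small. *)

Section InnerProduct.
Context {R : realType}.
Implicit Types m n p : nat.

Definition ip m n (A B : 'M[R]_(m, n)) : R := \sum_i \sum_j A i j * B i j.

Lemma ipE m n (A B : 'M[R]_(m, n)) : ip A B = \tr (A *m B^T).
Proof.
rewrite /ip /mxtrace; apply: eq_bigr => i _; rewrite mxE.
by apply: eq_bigr => j _; rewrite mxE.
Qed.

Lemma ipC m n (A B : 'M[R]_(m, n)) : ip A B = ip B A.
Proof. by apply: eq_bigr => i _; apply: eq_bigr => j _; rewrite mulrC. Qed.

Lemma ipDr m n (A B C : 'M[R]_(m, n)) : ip A (B + C) = ip A B + ip A C.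
Proof. by rewrite !ipE linearD /= mulmxDr mxtraceD. Qed.

Lemma ipDl m n (A B C : 'M[R]_(m, n)) : ip (A + B) C = ip A C + ip B C.
Proof. by rewrite ![ip _ C]ipC ipDr. Qed.

Lemma ipZr m n (A B : 'M[R]_(m, n)) a : ip A (a *: B) = a * ip A B.
Proof. by rewrite !ipE linearZ /= -scalemxAr mxtraceZ. Qed.

Lemma ipZl m n (A B : 'M[R]_(m, n)) a : ip (a *: A) B = a * ip A B.
Proof. by rewrite ![ip _ B]ipC ipZr. Qed.

Lemma ipNr m n (A B : 'M[R]_(m, n)) : ip A (- B) = - ip A B.
Proof. by rewrite -scaleN1r ipZr mulN1r. Qed.

Lemma ipNl m n (A B : 'M[R]_(m, n)) : ip (- A) B = - ip A B.
Proof. by rewrite ![ip _ B]ipC ipNr. Qed.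

Lemma ip0l m n (B : 'M[R]_(m, n)) : ip 0 B = 0.
Proof. by rewrite -(scale0r 0) ipZl mul0r. Qed.

Lemma ip0r m n (B : 'M[R]_(m, n)) : ip B 0 = 0.
Proof. by rewrite ipC ip0l. Qed.

Lemma ip_sumr m n (I : Type) (r : seq I) (Q : pred I) A (F : I -> 'M[R]_(m, n)) :
  ip A (\sum_(i <- r | Q i) F i) = \sum_(i <- r | Q i) ip A (F i).
Proof. by apply: (big_morph (ip A)) => [x y|]; rewrite ?ipDr ?ip0r. Qed.

Lemma ip_tr m n (A B : 'M[R]_(m, n)) : ip A^T B^T = ip A B.
Proof. by rewrite !ipE mxtrace_mulC -mxtrace_tr trmx_mul !trmxK. Qed.

Lemma ip_mulmxl m n p (A : 'M[R]_(m, n)) (B : 'M[R]_(n, p)) C :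
  ip (A *m B) C = ip B (A^T *m C).
Proof.
by rewrite !ipE -mulmxA mxtrace_mulC -mulmxA trmx_mul trmxK.
Qed.

Lemma ip_mulmxr m n p (A : 'M[R]_(m, n)) (B : 'M[R]_(n, p)) C :
  ip (A *m B) C = ip A (C *m B^T).
Proof. by rewrite -ip_tr trmx_mul ip_mulmxl -ip_tr !trmxK trmx_mul !trmxK. Qed.

Lemma ip_ge0 m n (A : 'M[R]_(m, n)) : 0 <= ip A A.
Proof. by apply: sumr_ge0 => i _; apply: sumr_ge0 => j _; rewrite -expr2 sqr_ge0. Qed.

Lemma ip_eq0 m n (A : 'M[R]_(m, n)) : (ip A A == 0) = (A == 0).
Proof.
apply/idP/eqP => [|->]; last by rewrite ip0l.
rewrite psumr_eq0 => [|i _]; last by apply: sumr_ge0 => j _; rewrite -expr2 sqr_ge0.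
move/allP => h; apply/matrixP => i j; rewrite mxE.
have := h i (mem_index_enum _); rewrite /= psumr_eq0; last first.
  by move=> k _; rewrite -expr2 sqr_ge0.
by move/allP => /(_ j (mem_index_enum _)); rewrite /= mulf_eq0 orbb => /eqP.
Qed.

Lemma frobE m n (A : 'M[R]_(m, n)) : frob A = Num.sqrt (ip A A).
Proof.
congr Num.sqrt; apply: eq_bigr => i _; apply: eq_bigr => j _; exact: expr2.
Qed.

Lemma frob_sqr m n (A : 'M[R]_(m, n)) : frob A ^+ 2 = ip A A.
Proof. by rewrite frobE sqr_sqrtr // ip_ge0. Qed.

Lemma frob_ge0 m n (A : 'M[R]_(m, n)) : 0 <= frob A.
Proof. exact: sqrtr_ge0. Qed.

Lemma frob_eq0 m n (A : 'M[R]_(m, n)) : (frob A == 0) = (A == 0).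
Proof. by rewrite -ip_eq0 -frob_sqr sqrf_eq0. Qed.

Lemma frob0 m n : frob (0 : 'M[R]_(m, n)) = 0.
Proof. by apply/eqP; rewrite frob_eq0. Qed.

Lemma frob_gt0 m n (A : 'M[R]_(m, n)) : (0 < frob A) = (A != 0).
Proof. by rewrite lt_def frob_eq0 frob_ge0 andbT. Qed.

Lemma frob_tr m n (A : 'M[R]_(m, n)) : frob A^T = frob A.
Proof. by rewrite !frobE ip_tr. Qed.

Lemma frobZ m n (A : 'M[R]_(m, n)) a : frob (a *: A) = `|a| * frob A.
Proof.
by rewrite !frobE ipZl ipZr mulrA -expr2 sqrtrM ?sqr_ge0 // sqrtr_sqr.
Qed.

Lemma frobN m n (A : 'M[R]_(m, n)) : frob (- A) = frob A.
Proof. by rewrite -scaleN1r frobZ normrN normr1 mul1r. Qed.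

Lemma enormE n (x : 'cV[R]_n) : enorm x = frob x.
Proof.
by congr Num.sqrt; apply: eq_bigr => i _; rewrite big_ord1.
Qed.

Lemma ip_le m n (A B : 'M[R]_(m, n)) : ip A B <= frob A * frob B.
Proof.
have [->|A0] := eqVneq A 0; first by rewrite ip0l frob0 mul0r.
have [->|B0] := eqVneq B 0; first by rewrite ip0r frob0 mulr0.
have a0 : 0 < frob A by rewrite frob_gt0.
have b0 : 0 < frob B by rewrite frob_gt0.
have := ip_ge0 (frob B *: A - frob A *: B).
rewrite ipDl !ipDr !ipNl !ipNr !ipZl !ipZr -!frob_sqr (ipC B A).
set a := frob A; set b := frob B; set x := ip A B => h.
have {}h : 0 <= 2 * (a * b) * (a * b - x) by nra.
rewrite pmulr_rge0 in h; last by rewrite !mulr_gt0.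
by lra.
Qed.

Lemma normr_ip m n (A B : 'M[R]_(m, n)) : `|ip A B| <= frob A * frob B.
Proof.
rewrite ler_norml ip_le andbT lerNl -ipNl.
by apply: le_trans (ip_le _ _) _; rewrite frobN.
Qed.

Lemma frobD m n (A B : 'M[R]_(m, n)) : frob (A + B) <= frob A + frob B.
Proof.
rewrite -(@ler_pXn2r _ 2) ?nnegrE ?addr_ge0 ?frob_ge0 //.
rewrite frob_sqr ipDl !ipDr -!frob_sqr (ipC B A).
by have := ip_le A B; nra.
Qed.

Lemma ip_sqr_le m n (A B : 'M[R]_(m, n)) : ip A B ^+ 2 <= ip A A * ip B B.
Proof.
rewrite -!frob_sqr -exprMn -(real_normK (num_real (ip A B))).
by rewrite lerXn2r ?nnegrE ?mulr_ge0 ?frob_ge0 ?normr_ge0 // normr_ip.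
Qed.

Lemma frobM m n p (A : 'M[R]_(m, n)) (B : 'M[R]_(n, p)) :
  frob (A *m B) <= frob A * frob B.
Proof.
rewrite -(@ler_pXn2r _ 2) ?nnegrE ?mulr_ge0 ?frob_ge0 // exprMn !frob_sqr.
rewrite /ip mulr_suml; apply: ler_sum => i _.
rewrite exchange_big /= mulr_sumr; apply: ler_sum => j _.
rewrite mxE -expr2.
set r := row i A; set q := (col j B)^T.
have [e1 e2 e3] : [/\ ip r q = \sum_k A i k * B k j,
    ip r r = \sum_k A i k * A i k & ip q q = \sum_k B k j * B k j].
  by split; rewrite /ip big_ord1; apply: eq_bigr => k _; rewrite !mxE.
by have := ip_sqr_le r q; rewrite e1 e2 e3.
Qed.

Lemma frob_row_mx m n p (A : 'M[R]_(m, n)) (B : 'M[R]_(m, p)) :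
  frob (row_mx A B) ^+ 2 = frob A ^+ 2 + frob B ^+ 2.
Proof.
rewrite !frob_sqr /ip -big_split; apply: eq_bigr => i _ /=.
by rewrite big_split_ord /=; congr (_ + _); apply: eq_bigr => j _;
  rewrite ?row_mxEl ?row_mxEr.
Qed.

Lemma ip_row_mx m n p (A C : 'M[R]_(m, n)) (B D : 'M[R]_(m, p)) :
  ip (row_mx A B) (row_mx C D) = ip A C + ip B D.
Proof.
rewrite /ip -big_split; apply: eq_bigr => i _ /=.
by rewrite big_split_ord /=; congr (_ + _); apply: eq_bigr => j _;
  rewrite ?row_mxEl ?row_mxEr.
Qed.

Lemma ip_col_mx m n p (A C : 'M[R]_(m, n)) (B D : 'M[R]_(p, n)) :
  ip (col_mx A B) (col_mx C D) = ip A C + ip B D.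
Proof.
by rewrite -ip_tr !tr_col_mx ip_row_mx !ip_tr.
Qed.

Lemma frob_orthl m n p (A : 'M[R]_(m, n)) (B : 'M[R]_(n, p)) :
  A^T *m A = 1%:M -> frob (A *m B) = frob B.
Proof. by move=> oA; rewrite !frobE ip_mulmxl mulmxA oA mul1mx. Qed.

Lemma frob_orthr m n p (A : 'M[R]_(m, n)) (B : 'M[R]_(n, p)) :
  B *m B^T = 1%:M -> frob (A *m B) = frob A.
Proof. by move=> oB; rewrite !frobE ip_mulmxr -mulmxA oB mulmx1. Qed.

Lemma normr_le_frob m n (A : 'M[R]_(m, n)) i j : `|A i j| <= frob A.
Proof.
rewrite -(@ler_pXn2r _ 2) ?nnegrE ?frob_ge0 // frob_sqr real_normK ?num_real //.
rewrite /ip (bigD1 i) //= (bigD1 j) //= -expr2 -!addrA lerDl addr_ge0 //.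
  by apply: sumr_ge0 => k _; rewrite -expr2 sqr_ge0.
by apply: sumr_ge0 => l _; apply: sumr_ge0 => k _; rewrite -expr2 sqr_ge0.
Qed.

Lemma frob_le_const m n (A : 'M[R]_(m, n)) b : 0 <= b ->
  (forall i j, `|A i j| <= b) -> frob A ^+ 2 <= (m * n)%:R * b ^+ 2.
Proof.
move=> b0 h; rewrite frob_sqr.
have -> : (m * n)%:R * b ^+ 2 = \sum_(i < m) \sum_(j < n) b ^+ 2.
  by rewrite !sumr_const !card_ord -mulrnA mulr_natl mulnC.
apply: ler_sum => i _; apply: ler_sum => j _.
by rewrite -expr2 -real_normK ?num_real // lerXn2r ?nnegrE.
Qed.

Lemma frob_sum_row m n (A : 'M[R]_(m, n)) :
  frob A ^+ 2 = \sum_i frob (row i A) ^+ 2.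
Proof.
rewrite frob_sqr; apply: eq_bigr => i _; rewrite frob_sqr /ip big_ord1.
by apply: eq_bigr => j _; rewrite !mxE.
Qed.

End InnerProduct.

(** * Extremal eigenvalues of symmetric matrices by compactness *)

Section Rayleigh.
Context {R : realType}.

Lemma continuous_sum (V : topologicalType) (I : Type) (r : seq I) (Q : pred I)
    (F : I -> V -> R) :
  (forall i, continuous (F i)) -> continuous (fun x => \sum_(i <- r | Q i) F i x).
Proof.
move=> cF; elim: r => [|i r IH] x.
  under [X in continuous_at _ X]eq_fun do rewrite big_nil.
  exact: cvg_cst.
under [X in continuous_at _ X]eq_fun do rewrite big_cons.
case: (Q i); last exact: IH.
by apply: cvgD; [exact: cF | exact: IH].
Qed.

Lemma continuous_mulmx n p (A : 'M[R]_(n, p)) i j :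
  continuous (fun x : 'rV[R]_n => (x *m A) i j).
Proof.
have -> : (fun x : 'rV[R]_n => (x *m A) i j) =
          (fun x => \sum_k x i k * A k j).
  by apply/funext => x; rewrite mxE.
apply: continuous_sum => k x.
have ck : continuous (fun x : 'rV[R]_n => x i k) by apply: (@coord_continuous R).
by apply: (@continuousM _ _ _ (fun=> A k j)); [exact: ck | exact: cst_continuous].
Qed.

Lemma continuous_ip_mulmx n p (A B : 'M[R]_(n, p)) :
  continuous (fun x : 'rV[R]_n => ip (x *m A) (x *m B)).
Proof.
apply: continuous_sum => i; apply: continuous_sum => j x.
by apply: continuousM; exact: continuous_mulmx.
Qed.

Lemma continuous_frob n : continuous (fun x : 'rV[R]_n => frob x).
Proof.
have -> : (fun x : 'rV[R]_n => frob x) = Num.sqrt \o (fun y => ip y y).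
  by apply/funext => y /=; rewrite frobE.
move=> x; apply: continuous_comp; last exact: sqrt_continuous.
have := @continuous_ip_mulmx n n 1%:M 1%:M x.
by under [X in continuous_at _ X -> _]eq_fun do rewrite mulmx1.
Qed.

Lemma normr_le_frob_rV n (x : 'rV[R]_n) : `|x| <= frob x.
Proof.
rewrite [leLHS]/Num.Def.normr /= mx_normrE; apply/bigmax_leP; split; first exact: frob_ge0.
by move=> i _; exact: normr_le_frob.
Qed.

Lemma compact_frob_ball n (r : R) : compact [set x : 'rV[R]_n | frob x <= r].
Proof.
apply: bounded_closed_compact.
  exists r; split; first exact: num_real.
  by move=> M rM x /= xr; rewrite (le_trans (normr_le_frob_rV x)) // (le_trans xr) // ltW.
have -> : [set x : 'rV[R]_n | frob x <= r] = (@frob R 1 n) @^-1` [set y | y <= r].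
  by [].
apply: closed_comp => [x _|]; last exact: closed_le.
exact: continuous_frob.
Qed.

Lemma compact_frob_sphere n (r : R) : compact [set x : 'rV[R]_n | frob x = r].
Proof.
apply: (subclosed_compact _ (@compact_frob_ball n r)); last by move=> x /= ->.
have -> : [set x : 'rV[R]_n | frob x = r] = (@frob R 1 n) @^-1` [set r].
  by [].
apply: closed_comp => [x _|]; last exact: closed_eq.
exact: continuous_frob.
Qed.

(** Moving [x] to [x - t *: (x *m B)] changes the form by [- 2 t q + t^2 w], where [q] is the
    squared norm of [x *m B]. Nonnegativity for small positive [t] forces [q = 0]. *)
Lemma psd_ker n (B : 'M[R]_n) (x : 'rV[R]_n) : B^T = B ->
  (forall y : 'rV[R]_n, 0 <= ip (y *m B) y) -> ip (x *m B) x = 0 -> x *m B = 0.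
Proof.
move=> sB psd x0; apply/eqP; rewrite -ip_eq0; apply/eqP.
set z := x *m B; set q := ip z z; set w := ip (z *m B) z.
have q0 : 0 <= q by exact: ip_ge0.
have w0 : 0 <= w by exact: psd.
have qE : ip (z *m B) x = q by rewrite ip_mulmxr sB.
have h t : 0 <= - 2 * t * q + t ^+ 2 * w.
  have := psd (x - t *: z); rewrite mulmxBl -scalemxAl !(ipDl, ipDr, ipNl, ipNr, ipZl, ipZr).
  by rewrite x0 qE -/z -/q -/w; lra.
have w1 : 0 < w + 1 by lra.
(* The parameter finally used is [t = q / (w + 1)]; the shift by 1 covers [w = 0]. *)
have := h ((w + 1)^-1); set s := _^-1.
have sw : s * (w + 1) = 1 by rewrite mulVf // gt_eqF.
have s0 : 0 < s by rewrite invr_gt0.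
have := h (q * s) => h1 _.
have {}h1 : 0 <= q ^+ 2 * s * (- 2 + s * w) by nra.
have {}h1 : q ^+ 2 * s <= 0 by nra.
have : q ^+ 2 <= 0 by rewrite -(pmulr_lle0 _ s0) .
by move=> ?; apply/eqP; rewrite -sqrf_eq0 eq_le sqr_ge0 andbT.
Qed.

(** The form attains its minimum [a] on the unit sphere at some [c]. Then [A - a%:M] is positive
    semidefinite and its form vanishes at [c], so [psd_ker] makes [c] an eigenvector. *)
Lemma rayleigh_min n (A : 'M[R]_n) : (0 < n)%N -> A^T = A ->
  exists a, [/\ eigenvalue A a, (exists2 v : 'rV[R]_n, v *m A = a *: v & frob v = 1) &
    forall x : 'rV[R]_n, a * frob x ^+ 2 <= ip (x *m A) x].
Proof.
case: n A => // n A _ sA.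
have cf : continuous (fun x : 'rV[R]_n.+1 => ip (x *m A) x).
  have := @continuous_ip_mulmx _ _ A 1%:M.
  by under [X in continuous X]eq_fun do rewrite mulmx1.
have [|c cS cmin] := @EVT_min_rV _ _ _ _ _ (@compact_frob_sphere n.+1 1)
    (continuous_subspaceT cf).
  exists (delta_mx 0 0); rewrite /= frobE ipE trmx_delta mul_delta_mx.
  rewrite /mxtrace big_ord1 mxE !eqxx sqrtr1.
  by [].
rewrite inE /= in cS.
set a := ip (c *m A) c.
have amin (x : 'rV[R]_n.+1) : a * frob x ^+ 2 <= ip (x *m A) x.
  have [->|x0] := eqVneq x 0; first by rewrite frob0 mul0mx ip0l expr0n mulr0.
  have f0 : 0 < frob x by rewrite frob_gt0.
  have := cmin ((frob x)^-1 *: x); rewrite inE /= frobZ ger0_norm; last first.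
    by rewrite invr_ge0 ltW.
  rewrite mulVf ?gt_eqF // => /(_ erefl).
  rewrite -scalemxAl ipZl ipZr mulrA -expr2 exprVn mulrC ler_pdivlMr //.
  by rewrite exprn_gt0.
have ca : c *m A = a *: c.
  apply/eqP; rewrite -subr_eq0 -mul_mx_scalar -mulmxBr; apply/eqP.
  apply: psd_ker.
  - by rewrite linearB /= sA tr_scalar_mx.
  - move=> y; rewrite mulmxBr mul_mx_scalar ipDl ipNl ipZl -frob_sqr subr_ge0.
    exact: amin.
  - by rewrite mulmxBr mul_mx_scalar ipDl ipNl ipZl -frob_sqr cS expr1n mulr1 subrr.
exists a; split => //; last by exists c.
by apply/eigenvalueP; exists c; rewrite // -frob_gt0 cS.
Qed.

(** Turns the eigenvalue conditions on the Gram matrices into bounds on quadratic forms, the only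
    shape in which they are used. *)
Lemma eigenvalue_quad_ge n (A : 'M[R]_n) b : A^T = A ->
  (forall a, eigenvalue A a -> b <= a) ->
  forall x : 'rV[R]_n, b * frob x ^+ 2 <= ip (x *m A) x.
Proof.
case: n A => [|n] A sA h x.
  by rewrite (thinmx0 x) frob0 expr0n mulr0 mul0mx ip0l.
have [a [/h ba _ hx]] := rayleigh_min (ltn0Sn n) sA.
by apply: le_trans (hx x); rewrite ler_wpM2r // exprn_ge0 // frob_ge0.
Qed.

End Rayleigh.

(** * Singular values and the nuclear norm *)

Section SVD.
Context {R : realType}.

Lemma ip_delta m n (C : 'M[R]_(m, n)) i j : ip C (delta_mx i j) = C i j.
Proof.
rewrite /ip (bigD1 i) //= (bigD1 j) //= mxE !eqxx mulr1.
rewrite !big1 ?addr0 // => [k ki|k /negbTE ki]; last by rewrite mxE ki andbF mulr0.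
by apply: big1 => l _; rewrite mxE (negbTE ki) mulr0.
Qed.

Lemma frob_delta m n i j : frob (delta_mx i j : 'M[R]_(m, n)) = 1.
Proof. by rewrite frobE ip_delta mxE !eqxx sqrtr1. Qed.

(** Both sides are homogeneous: after scaling [x] and [y] to unit norm, the sum of squares and twice
    the product of norms agree. The additive form is the one that splits along orthogonal
    decompositions. *)
Lemma bilinear_amgm m n (B : 'M[R]_(m, n)) b :
  (forall (x : 'cV[R]_m) (y : 'cV[R]_n),
     2 * ip x (B *m y) <= b * (frob x ^+ 2 + frob y ^+ 2)) ->
  forall (x : 'cV[R]_m) (y : 'cV[R]_n), ip x (B *m y) <= b * (frob x * frob y).
Proof.
move=> h x y.
have [->|x0] := eqVneq x 0; first by rewrite ip0l frob0 mul0r mulr0.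
have [->|y0] := eqVneq y 0; first by rewrite mulmx0 ip0r frob0 !mulr0.
have a0 : 0 < frob x by rewrite frob_gt0.
have c0 : 0 < frob y by rewrite frob_gt0.
have := h ((frob x)^-1 *: x) ((frob y)^-1 *: y).
rewrite -scalemxAr ipZl ipZr !frobZ !gtr0_norm ?invr_gt0 // !mulVf ?gt_eqF //.
rewrite expr1n; set t := ip _ _ => ht.
have {}ht : (frob x)^-1 * ((frob y)^-1 * t) <= b by lra.
have -> : t = (frob x)^-1 * ((frob y)^-1 * t) * (frob x * frob y).
  by field; rewrite !gt_eqF.
by rewrite ler_wpM2r // mulr_ge0 // ltW.
Qed.

(** Householder reflection along [w = u - e], which exchanges the first basis vector [e] with
    [u]. *)
Lemma orth_complete n (u : 'cV[R]_n.+1) : frob u = 1 ->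
  exists2 P : 'M[R]_n.+1, P^T *m P = 1%:M & P *m delta_mx 0 0 = u.
Proof.
move=> u1; set e : 'cV[R]_n.+1 := delta_mx 0 0.
have e1 : ip e e = 1 by rewrite ip_delta mxE !eqxx.
set w := u - e.
have [w0|w0] := eqVneq w 0.
  by exists 1%:M; rewrite ?trmx1 ?mul1mx //; apply/esym/eqP; rewrite -subr_eq0 -/w w0.
set c := ip w w; have c0 : c != 0 by rewrite /c ip_eq0.
(* Since [u] and [e] have the same norm, [ip w w = - 2 * ip w e]; this is exactly what makes the
   reflection send [e] to [u]. *)
have wE : c = - 2 * ip w e.
  rewrite /c /w !(ipDl, ipDr, ipNl, ipNr) -frob_sqr u1 e1 (ipC e u); ring.
have uE : u = e + w by rewrite addrC subrK.
clearbody w.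
have mE (x y : 'cV[R]_n.+1) : x^T *m y = (ip x y)%:M.
  by rewrite [LHS]mx11_scalar; congr (_%:M); rewrite ipC ipE mxtrace_mulC /mxtrace big_ord1.
exists (1%:M - (2 / c) *: (w *m w^T)).
  have -> : (1%:M - (2 / c) *: (w *m w^T))^T = 1%:M - (2 / c) *: (w *m w^T).
    by rewrite linearB linearZ /= trmx1 trmx_mul trmxK.
  rewrite mulmxBr mulmx1 mulmxBl mul1mx.
  rewrite -scalemxAl -scalemxAr mulmxA -(mulmxA w) mE -/c mul_mx_scalar -scalemxAl !scalerA.
  rewrite [2 / c * (2 / c * c)](_ : _ = 2 / c + 2 / c); last by field.
  by rewrite scalerDl; apply/matrixP => i j; rewrite !mxE; ring.
rewrite mulmxBl mul1mx -scalemxAl -mulmxA mE mul_mx_scalar scalerA.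
rewrite [2 / c * _](_ : _ = -1); last by rewrite (_ : ip w e = - c / 2); [field|rewrite wE; field].
by rewrite scaleN1r opprK uE.
Qed.

(** The symmetric dilation [block_mx 0 A A^T 0] has the singular values of [A] and their opposites
    as its nonzero eigenvalues. Its least eigenvalue [a] is therefore minus the top singular value,
    and the two halves of the eigenvector, which have equal norm, are the singular vectors. *)
Lemma top_singular_pair m n (A : 'M[R]_(m, n)) : A != 0 ->
  exists s (u : 'cV[R]_m) (v : 'cV[R]_n),
    [/\ 0 < s, frob u = 1 /\ frob v = 1, A *m v = s *: u, A^T *m u = s *: v &
     forall (x : 'cV[R]_m) (y : 'cV[R]_n), ip x (A *m y) <= s * (frob x * frob y)].
Proof.
case: m A => [|m] A A0; first by rewrite (flatmx0 A) eqxx in A0.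
have sB : (block_mx 0 A A^T 0)^T = block_mx 0 A A^T 0.
  by rewrite tr_block_mx trmxK !trmx0.
have [a [_ [z za z1] amin]] := rayleigh_min (ltn_addr n (ltn0Sn m)) sB.
move: z za z1 => z.
rewrite -(hsubmxK z); set x := lsubmx z; set y := rsubmx z.
rewrite mul_row_block !mulmx0 add0r addr0 scale_row_mx => /eq_row_mx[yA xA] z1.
have h (x' : 'rV[R]_m.+1) (y' : 'rV[R]_n) :
    a * (frob x' ^+ 2 + frob y' ^+ 2) <= 2 * ip (x' *m A) y'.
  have := amin (row_mx x' y'); rewrite mul_row_block !mulmx0 add0r addr0.
  rewrite -frob_row_mx => /le_trans; apply.
  by rewrite ip_row_mx ip_mulmxr trmxK ipC; lra.
have bil (x' : 'cV[R]_m.+1) (y' : 'cV[R]_n) :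
    ip x' (A *m y') <= - a * (frob x' * frob y').
  apply: bilinear_amgm => {x' y'} x' y'.
  have := h (- x'^T) y'^T; rewrite mulNmx ipNl frobN !frob_tr.
  by rewrite ip_mulmxr -trmx_mul ip_tr; lra.
have s0 : 0 < - a.
  have /matrix0Pn[i [j Aij]] := A0.
  have := bil (A i j *: delta_mx i 0) (delta_mx j 0).
  rewrite frobZ !frob_delta !mulr1 ipZl ipC ip_delta -colE mxE => Aij2.
  have := normr_gt0 (A i j); rewrite Aij => A1.
  have : 0 < A i j * A i j by rewrite -expr2 exprn_even_gt0.
  by nra.
have xy : frob x = frob y.
  have E : a * frob x ^+ 2 = a * frob y ^+ 2.
    by rewrite !frob_sqr -!ipZl -yA -xA ip_mulmxr trmxK ipC.
  have a0 : a != 0 by rewrite -oppr_eq0 gt_eqF.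
  apply/eqP; rewrite -(@eqrXn2 _ 2) ?frob_ge0 //; apply/eqP.
  exact: (mulfI a0).
have x0 : 2 * frob x ^+ 2 = 1 by move: z1; rewrite -[X in X = _ -> _]expr1 => z1;
  have := frob_row_mx x y; rewrite -[frob (row_mx x y)]expr1 z1 -xy; lra.
have q : 0 < frob x.
  by rewrite lt_def frob_ge0 andbT; apply: contra_eqN x0 => /eqP ->; rewrite expr0n mulr0 eq_sym oner_eq0.
(* The eigenvalue is negative, so one half changes sign to make the singular value positive. *)
exists (- a), (- (frob x)^-1 *: x^T), ((frob x)^-1 *: y^T); split => //.
- by rewrite !frobZ !frob_tr normrN gtr0_norm ?invr_gt0 // -xy mulVf // gt_eqF.
- rewrite -scalemxAr -[A]trmxK -trmx_mul yA linearZ /= !scalerA.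
  by congr (_ *: _); ring.
- by rewrite -scalemxAr -trmx_mul xA linearZ /= !scalerA; congr (_ *: _); ring.
Qed.

End SVD.

Section Nuclear.
Context {R : realType}.

Definition rect_diag m n (s : nat -> R) : 'M[R]_(m, n) :=
  \matrix_(i, j) if i == j :> nat then s i else 0.

(** Operator norm at most [b], as a bilinear bound: it avoids the supremum and is visibly stable
    under transposition and orthogonal changes of basis. *)
Definition op_bounded m n (B : 'M[R]_(m, n)) b : Prop :=
  forall (x : 'cV[R]_m) (y : 'cV[R]_n), ip x (B *m y) <= b * (frob x * frob y).

Lemma rect_diag0 m n : rect_diag m n (fun=> 0) = 0.
Proof. by apply/matrixP => i j; rewrite !mxE if_same. Qed.

Lemma rect_diagS m n (s : nat -> R) :
  rect_diag (1 + m) (1 + n) s =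
  block_mx (s 0)%:M 0 0 (rect_diag m n (fun k => s k.+1)).
Proof.
apply/matrixP => i j; rewrite !mxE.
case: splitP => i' ->; rewrite !mxE; case: splitP => j' ->; rewrite !mxE ?ord1 //=.
Qed.

(** Induction on the number of rows. Reflections carry the top singular pair to the first basis
    vectors; the remaining entries of the first row and column then vanish, and the lower block is
    decomposed by induction. The maximality of the pair keeps the singular values ordered. *)
Lemma svd_exists m n (A : 'M[R]_(m, n)) : exists U s V, svd A U s V.
Proof.
elim: m n A => [|m IH] n A.
  exists 1%:M, (fun=> 0), 1%:M; split; rewrite ?trmx1 ?mulmx1 //.
    by rewrite (flatmx0 A) [RHS]flatmx0.
  by move=> k; rewrite lexx.
have [->|A0] := eqVneq A 0.
  exists 1%:M, (fun=> 0), 1%:M; split; rewrite ?trmx1 ?mulmx1 //.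
    by rewrite -[X in _ *m X]/(rect_diag m.+1 n (fun=> 0)) rect_diag0 mulmx0.
  by move=> k; rewrite lexx.
have [s [u [v [s0 [u1 v1] Av Au bil]]]] := top_singular_pair A0.
case: n A A0 v v1 Av Au bil => [|n] A A0 v v1 Av Au bil.
  by rewrite (thinmx0 A) eqxx in A0.
have [P PP Pe] := orth_complete u1; have [Q QQ Qe] := orth_complete v1.
have PP' := mulmx1C PP; have QQ' := mulmx1C QQ.
pose B : 'M[R]_(1 + m, 1 + n) := P^T *m A *m Q.
have AE : A = P *m B *m Q^T.
  by rewrite /B !mulmxA PP' mul1mx -mulmxA QQ' mulmx1.
pose em : 'cV[R]_m.+1 := delta_mx 0 0; pose en : 'cV[R]_n.+1 := delta_mx 0 0.
have Be : P^T *m A *m Q *m en = s *: em.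
  by rewrite -mulmxA Qe -mulmxA Av -scalemxAr -Pe mulmxA PP mul1mx.
have Bt : (P^T *m A *m Q)^T *m em = s *: en.
  by rewrite !trmx_mul trmxK -!mulmxA Pe Au -scalemxAr -Qe mulmxA QQ mul1mx.
have l0 k : lshift k (0 : 'I_1) = 0 by exact/val_inj.
have BE : B = block_mx s%:M 0 0 (drsubmx B).
  rewrite -[LHS]submxK; congr block_mx; apply/matrixP => i j; rewrite !mxE !ord1 ?l0.
  - by have /colP/(_ 0) := Be; rewrite -colE !mxE !eqxx mulr1.
  - by have /colP/(_ (rshift 1 j)) := Bt; rewrite -colE !mxE /= mulr0.
  - by have /colP/(_ (rshift 1 i)) := Be; rewrite -colE !mxE /= mulr0.
have [U' [s' [V' [UU VV BE' sd sz]]]] := IH _ (drsubmx B).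
pose U : 'M[R]_(1 + m) := block_mx 1%:M 0 0 U'.
pose V : 'M[R]_(1 + n) := block_mx 1%:M 0 0 V'.
pose s1 k := if k is k'.+1 then s' k' else s.
have UU1 : U^T *m U = 1%:M.
  rewrite /U tr_block_mx mulmx_block !trmx0 !mul0mx !mulmx0 !addr0 add0r UU.
  by rewrite trmx1 mulmx1 -scalar_mx_block.
have VV1 : V^T *m V = 1%:M.
  rewrite /V tr_block_mx mulmx_block !trmx0 !mul0mx !mulmx0 !addr0 add0r VV.
  by rewrite trmx1 mulmx1 -scalar_mx_block.
have BE2 : B = U *m rect_diag (1 + m) (1 + n) s1 *m V^T.
  rewrite {1}BE rect_diagS {1}BE' /U /V tr_block_mx !mulmx_block !trmx0.
  by rewrite !(mul0mx, mulmx0, addr0, add0r, mul1mx, mulmx1, trmx1).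
exists (P *m U), s1, (Q *m V); split.
- by rewrite trmx_mul -mulmxA (mulmxA P^T) PP mul1mx.
- by rewrite trmx_mul -mulmxA (mulmxA Q^T) QQ mul1mx.
- by rewrite {1}AE BE2 trmx_mul !mulmxA.
- case=> [|k]; last exact: sd.
  rewrite /s1; have /andP[s'0 _] := sd 0; have s'0' : 0 <= s' 0 by apply: le_trans s'0 _; case/andP: (sd 0).
  rewrite s'0' /=.
  have [m0|] := posnP (minn m n); first by rewrite sz ?m0 // ltW.
  rewrite leq_min => /andP[m0 n0].
  (* Top singular vectors of the lower block, padded by 0: the extremal bound of the removed pair,
     tested on them, gives [s' 0 <= s]. *)
  pose x : 'cV[R]_(1 + m) := col_mx 0 (U' *m delta_mx (Ordinal m0) 0).
  pose y : 'cV[R]_(1 + n) := col_mx 0 (V' *m delta_mx (Ordinal n0) 0).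
  have fx : frob x = 1.
    by rewrite frobE ip_col_mx ip0l add0r -frobE frob_orthl // frob_delta.
  have fy : frob y = 1.
    by rewrite frobE ip_col_mx ip0l add0r -frobE frob_orthl // frob_delta.
  have := bil (P *m x) (Q *m y); rewrite !frob_orthl // fx fy !mulr1.
  apply: le_trans.
  have -> : ip (P *m x) (A *m (Q *m y)) = ip x (B *m y).
    by rewrite ip_mulmxl /B !mulmxA.
  rewrite BE mul_block_col !mulmx0 !mul0mx !addr0 !add0r ip_col_mx ip0l add0r {1}BE'.
  rewrite ip_mulmxl -!mulmxA (mulmxA V'^T) VV mul1mx mulmxA UU mul1mx ipC ip_delta -colE.
  by rewrite !mxE.
- by case=> [|k]; rewrite ?minnSS // ltnS; exact: sz.
Qed.

Lemma svd_ofP m n (A : 'M[R]_(m, n)) :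
  svd A (svd_of A).1.1 (svd_of A).1.2 (svd_of A).2.
Proof.
have [U [s [V h]]] := svd_exists A.
by rewrite /svd_of; case: xgetP => [t -> //|/(_ (U, s, V))].
Qed.

End Nuclear.

Section NuclearDuality.
Context {R : realType}.

Lemma op_bounded_tr m n (B : 'M[R]_(m, n)) b : op_bounded B b -> op_bounded B^T b.
Proof. by move=> h x y; rewrite ipC ip_mulmxl trmxK mulrC (mulrC (frob x)) mulrC; exact: h. Qed.

Lemma opnorm_op_bounded m n (B : 'M[R]_(m, n)) b :
  opnorm B <= b -> op_bounded B b.
Proof.
move=> Bb x y; have [->|y0] := eqVneq y 0; first by rewrite mulmx0 ip0r frob0 !mulr0.
have f0 : 0 < frob y by rewrite frob_gt0.
apply: le_trans (ip_le _ _) _; rewrite mulrCA ler_wpM2l ?frob_ge0 //.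
have hs : has_ubound [set enorm (B *m z) | z in [set z : 'cV[R]_n | enorm z <= 1]].
  exists (frob B) => _ [z /= z1 <-]; rewrite enormE in z1; rewrite enormE.
  by rewrite (le_trans (frobM _ _)) // ler_piMr // frob_ge0.
rewrite -ler_pdivrMr //; apply: le_trans Bb.
apply: (ub_le_sup hs); exists ((frob y)^-1 *: y) => /=.
  by rewrite enormE frobZ gtr0_norm ?invr_gt0 // mulVf // gt_eqF.
by rewrite enormE -scalemxAr frobZ gtr0_norm ?invr_gt0 // mulrC.
Qed.

Lemma svd_ge0 m n (A : 'M[R]_(m, n)) U s V k : svd A U s V -> 0 <= s k.
Proof.
case=> _ _ _ sd _; case: k => [|k]; last by have /andP[] := sd k.
by have /andP[] := sd 0; exact: le_trans.
Qed.

Lemma svd_le m n (A : 'M[R]_(m, n)) U s V j k : svd A U s V -> (j <= k)%N -> s k <= s j.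
Proof.
case=> _ _ _ sd _ /subnK <-; elim: (k - j)%N => [//|i IH].
by apply: le_trans IH; rewrite addSn; have /andP[] := sd (i + j)%N.
Qed.

Lemma rect_diag_delta m n (s : nat -> R) :
  rect_diag m n s = \sum_(k < minn m n)
    s k *: delta_mx (widen_ord (geq_minl m n) k) (widen_ord (geq_minr m n) k).
Proof.
apply/matrixP => i j; rewrite summxE mxE.
case: eqP => [ij|ij]; last first.
  rewrite big1 // => k _; rewrite !mxE.
  by case: eqP => [ik|]; case: eqP => [jk|]; rewrite ?mulr0 //; case: ij; rewrite ik jk.
have km : (i < minn m n)%N by rewrite leq_min ltn_ord ij ltn_ord.
rewrite (bigD1 (Ordinal km)) //= !mxE.
rewrite -!val_eqE /= -ij eqxx mulr1.
rewrite big1 ?addr0 // => k kk; rewrite !mxE.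
case: eqP => [ik|]; rewrite ?mulr0 //=.
by case/eqP: kk; apply/val_inj; rewrite /= ik.
Qed.

Lemma ip_rect_diag m n (C : 'M[R]_(m, n)) (s : nat -> R) :
  ip C (rect_diag m n s) = \sum_(k < minn m n)
    s k * C (widen_ord (geq_minl m n) k) (widen_ord (geq_minr m n) k).
Proof.
rewrite rect_diag_delta ip_sumr; apply: eq_bigr => k _.
by rewrite ipZr ip_delta.
Qed.

Lemma colE_delta m n (A : 'M[R]_(m, n)) i j (B : 'M[R]_(m, m)) (C : 'M[R]_(n, n)) :
  (B^T *m A *m C) i j = ip (B *m delta_mx i (0 : 'I_1)) (A *m (C *m delta_mx j 0)).
Proof.
by rewrite ip_mulmxl !mulmxA ipC ip_delta -colE [RHS]mxE.
Qed.

(** In the singular bases of [A] the pairing reads only the diagonal entries of [U^T *m B *m V],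
    each at most [b]. With [nuclear_attained] this is the duality of operator and nuclear norms,
    from which the triangle inequality follows. *)
Lemma nuclear_ge_ip m n (A B : 'M[R]_(m, n)) b : 0 <= b -> op_bounded B b ->
  ip B A <= b * nuclear A.
Proof.
move=> b0 cB; rewrite /nuclear; have H := svd_ofP A; case: (svd_of A) H => -[U s] V /= H.
have [UU VV AE _ _] := H.
rewrite {1}AE -[X in _ *m X *m _]/(rect_diag m n s) ipC ip_mulmxr trmxK ip_mulmxl.
rewrite ipC mulmxA ip_rect_diag mulr_sumr; apply: ler_sum => k _.
rewrite mulrC ler_wpM2r ?(svd_ge0 _ H) // colE_delta.
by apply: le_trans (cB _ _) _; rewrite !frob_orthl // !frob_delta !mulr1.
Qed.

Lemma nuclear_ge0 m n (A : 'M[R]_(m, n)) : 0 <= nuclear A.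
Proof. by apply: sumr_ge0 => k _; exact: svd_ge0 (svd_ofP A). Qed.

Lemma op_bounded_rect_diag m n (s : nat -> R) : (forall k, 0 <= s k <= 1) ->
  op_bounded (rect_diag m n s) 1.
Proof.
move=> s01; apply: bilinear_amgm => x y; rewrite mul1r.
have hx k (F : 'I_k -> R) j (jk : (j <= k)%N) : (forall i, 0 <= F i) ->
    \sum_(i < j) F (widen_ord jk i) <= \sum_i F i.
  move=> F0; rewrite -big_ord_narrow big_mkcond /=.
  by apply: ler_sum => i _; case: ifP.
have E : ip x (rect_diag m n s *m y) = \sum_(k < minn m n)
    s k * (x (widen_ord (geq_minl m n) k) 0 * y (widen_ord (geq_minr m n) k) 0).
  rewrite ipC ip_mulmxr ipC ip_rect_diag.
  by apply: eq_bigr => k _; rewrite mxE big_ord1 mxE.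
rewrite E mulr_sumr.
have := hx m (fun i => x i 0 ^+ 2) _ (geq_minl m n) (fun i => sqr_ge0 _).
have := hx n (fun i => y i 0 ^+ 2) _ (geq_minr m n) (fun i => sqr_ge0 _).
have fE k (z : 'cV[R]_k) : frob z ^+ 2 = \sum_i z i 0 ^+ 2.
  by rewrite frob_sqr; apply: eq_bigr => i _; rewrite big_ord1 expr2.
rewrite -!fE => h1 h2; apply: le_trans (lerD h2 h1).
rewrite -big_split /=; apply: ler_sum => k _.
have /andP[s0 s1] := s01 k.
set a := x _ _; set b := y _ _.
have h : 2 * (a * b) <= a ^+ 2 + b ^+ 2 by have := sqr_ge0 (a - b); nra.
rewrite mulrCA; have [p|p] := lerP 0 (2 * (a * b)).
  by apply: le_trans h; rewrite ler_piMl.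
by apply: (@le_trans _ _ 0); [rewrite nmulr_lle0 | rewrite addr_ge0 ?sqr_ge0].
Qed.

Lemma op_bounded_orth m n (B : 'M[R]_(m, n)) (U : 'M[R]_m) (V : 'M[R]_n) b :
  U *m U^T = 1%:M -> V *m V^T = 1%:M ->
  op_bounded B b -> op_bounded (U *m B *m V^T) b.
Proof.
move=> UU VV cB x y; rewrite -!mulmxA ipC ip_mulmxl ipC.
apply: le_trans (cB _ _) _.
by rewrite !frob_orthl ?trmxK.
Qed.

(** The dual optimum is the polar factor: [A] with its singular values replaced by 1. *)
Lemma nuclear_attained m n (A : 'M[R]_(m, n)) :
  exists2 B, op_bounded B 1 & ip B A = nuclear A.
Proof.
rewrite /nuclear; have H := svd_ofP A; case: (svd_of A) H => -[U s] V /= H.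
have [UU VV AE _ _] := H.
exists (U *m rect_diag m n (fun=> 1) *m V^T).
  apply: op_bounded_orth; [exact: mulmx1C | exact: mulmx1C|].
  by apply: op_bounded_rect_diag => k; rewrite ler01 lexx.
rewrite {1}AE -[X in ip _ (_ *m X *m _)]/(rect_diag m n s).
rewrite ip_mulmxr trmxK -!mulmxA VV mulmx1 ip_mulmxl mulmxA UU mul1mx.
rewrite ip_rect_diag; apply: eq_bigr => k _.
by rewrite mxE eqxx mulr1.
Qed.

Lemma nuclearD m n (A B : 'M[R]_(m, n)) : nuclear (A + B) <= nuclear A + nuclear B.
Proof.
have [C cC <-] := nuclear_attained (A + B).
by rewrite ipDr lerD // -[leRHS]mul1r nuclear_ge_ip.
Qed.

(** If [s k] were nonzero, so would be all the earlier values; rescaling these rows of the diagonal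
    factor gives [pid_mx k.+1], of rank exceeding that of [A]. *)
Lemma svd_rank m n (A : 'M[R]_(m, n)) U s V k : svd A U s V ->
  (\rank A <= k)%N -> s k = 0.
Proof.
move=> H rk; have [UU VV AE sd sz] := H.
have [mk|km] := leqP (minn m n) k; first exact: sz.
apply/eqP; apply: contraLR rk => sk; rewrite -ltnNge.
have skp : 0 < s k by rewrite lt_def sk (svd_ge0 _ H).
pose D := rect_diag m n s.
have DA : (\rank D <= \rank A)%N.
  have -> : D = U^T *m A *m V.
    by rewrite AE -mulmxA -mulmxA VV mulmx1 mulmxA UU mul1mx.
  by rewrite (leq_trans (mxrankM_maxl _ _)) // mxrankM_maxr.
apply: leq_trans DA.
pose F := diag_mx (\row_(i < m) if (i <= k)%N then (s i)^-1 else 0).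
have <- : \rank (F *m D) = k.+1.
  have -> : F *m D = pid_mx k.+1.
    apply/matrixP => i j; rewrite mul_diag_mx !mxE ltnS.
    case: eqP => [_|]; rewrite ?mulr0 //=.
    case: ifP => ik; rewrite ?mul0r // mulVf // gt_eqF //.
    exact: lt_le_trans (svd_le H ik).
  by rewrite rank_pid_mx // (leq_trans km) ?geq_minl ?geq_minr.
exact: mxrankM_maxr.
Qed.

Definition zdiag n (s : nat -> R) : 'M[R]_n := diag_mx (\row_(k < n) (s k == 0)%:R).

Lemma zdiag_tr n s : (zdiag n s)^T = zdiag n s.
Proof. exact: tr_diag_mx. Qed.

Lemma zdiag_idem n s : zdiag n s *m zdiag n s = zdiag n s.
Proof.
rewrite /zdiag mulmx_diag; congr diag_mx; apply/rowP => j; rewrite !mxE.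
by case: eqP; rewrite ?mulr1 ?mulr0.
Qed.

(** Orthogonal projector onto the singular vectors of singular value 0. As [s] vanishes from
    [minn m n] on, the same formula serves both sides of a rectangular matrix. *)
Definition zproj n (s : nat -> R) (U : 'M[R]_n) := U *m zdiag n s *m U^T.

Lemma zproj_tr n s (U : 'M[R]_n) : (zproj s U)^T = zproj s U.
Proof. by rewrite /zproj !trmx_mul trmxK zdiag_tr mulmxA. Qed.

Lemma zproj_idem n s (U : 'M[R]_n) : U^T *m U = 1%:M ->
  zproj s U *m zproj s U = zproj s U.
Proof.
move=> UU; rewrite /zproj -!mulmxA (mulmxA U^T) UU mul1mx.
by rewrite (mulmxA (zdiag n s)) zdiag_idem.
Qed.

Lemma zero_sv_colsE n s (U : 'M[R]_n) :
  zero_sv_cols s U *m (zero_sv_cols s U)^T = zproj s U.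
Proof.
have -> : zero_sv_cols s U = U *m zdiag n s.
  apply/matrixP => i j; rewrite mul_mx_diag !mxE.
  by case: eqP; rewrite ?mulr1 ?mulr0.
by rewrite trmx_mul zdiag_tr !mulmxA -(mulmxA U) zdiag_idem.
Qed.

Lemma zdiag_rect_diag m n s e : (forall k, s k = 0 -> e k = 0) ->
  zdiag m s *m rect_diag m n e = 0.
Proof.
move=> h; apply/matrixP => i j; rewrite mul_diag_mx !mxE.
by case: eqP => [/h ->|_]; rewrite ?if_same ?mulr0 ?mul0r.
Qed.

Lemma rect_diag_zdiag m n s e : (forall k, s k = 0 -> e k = 0) ->
  rect_diag m n e *m zdiag n s = 0.
Proof.
move=> h; apply/matrixP => i j; rewrite mul_mx_diag !mxE.
case: eqP => [->|]; rewrite ?mul0r //.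
by case: eqP => [/h ->|]; rewrite ?mulr0 ?mul0r.
Qed.

Lemma frob_proj n p (Q : 'M[R]_n) (x : 'M[R]_(n, p)) : Q^T = Q -> Q *m Q = Q ->
  frob (Q *m x) ^+ 2 + frob ((1%:M - Q) *m x) ^+ 2 = frob x ^+ 2.
Proof.
move=> Qt QQ; rewrite !frob_sqr mulmxBl mul1mx.
have E : ip (Q *m x) (Q *m x) = ip x (Q *m x) by rewrite ip_mulmxl Qt mulmxA QQ.
by rewrite !(ipDl, ipDr, ipNl, ipNr) E (ipC (Q *m x)); ring.
Qed.

Lemma frob_proj_le n p (Q : 'M[R]_n) (x : 'M[R]_(n, p)) : Q^T = Q -> Q *m Q = Q ->
  frob (Q *m x) <= frob x.
Proof.
move=> Qt QQ; rewrite -(@ler_pXn2r _ 2) ?nnegrE ?frob_ge0 //.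
by rewrite -(frob_proj x Qt QQ) lerDl exprn_ge0 // frob_ge0.
Qed.

(* A dual certificate for [G + P D]: the polar factor of [G] restricted to its
   nonzero singular values plus one of [P D] have orthogonal row and column
   spaces, so their sum still has operator norm at most 1. *)
Lemma nuclear_decomposable m n (G D : 'M[R]_(m, n)) :
  nuclear G + nuclear (P_perp G D) - nuclear (M_part G D) <= nuclear (G + D).
Proof.
rewrite /M_part /P_perp {1}/nuclear; have H := svd_ofP G.
case: (svd_of G) H => -[U s] V /= H.
have [UU VV GE _ _] := H.
rewrite -(mulmxA _ (zero_sv_cols s V)) !zero_sv_colsE.
set P := zproj s U; set Q := zproj s V; set PD := P *m D *m Q.
have [Pt Qt] : P^T = P /\ Q^T = Q by rewrite !zproj_tr.
have [PP QQ] : P *m P = P /\ Q *m Q = Q by rewrite !zproj_idem.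
have [B' cB' BE'] := nuclear_attained PD.
pose e k : R := (s k != 0)%:R.
have e0 k : s k = 0 -> e k = 0 by rewrite /e => ->; rewrite eqxx.
pose B1 := U *m rect_diag m n e *m V^T.
have cB1 : op_bounded B1 1.
  apply: op_bounded_orth; [exact: mulmx1C | exact: mulmx1C|].
  by apply: op_bounded_rect_diag => k; rewrite /e; case: eqP; rewrite /= ?lexx ?ler01.
have PB1 : P *m B1 = 0.
  by rewrite /P /zproj /B1 -!mulmxA (mulmxA U^T) UU mul1mx (mulmxA (zdiag m s))
     zdiag_rect_diag // mul0mx mulmx0.
have B1Q : B1 *m Q = 0.
  by rewrite /Q /zproj /B1 -!mulmxA (mulmxA V^T) VV mul1mx (mulmxA (rect_diag m n e))
     rect_diag_zdiag // mul0mx mulmx0.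
have PG : P *m G = 0.
  rewrite GE -[X in _ *m (_ *m X *m _)]/(rect_diag m n s).
  by rewrite /P /zproj -!mulmxA (mulmxA U^T) UU mul1mx (mulmxA (zdiag m s))
     zdiag_rect_diag // mul0mx mulmx0.
clearbody P Q.
have B1G : ip B1 G = \sum_(k < minn m n) s k.
  rewrite {1}GE -[X in ip _ (_ *m X *m _)]/(rect_diag m n s).
  rewrite ip_mulmxr trmxK -!mulmxA VV mulmx1 ip_mulmxl mulmxA UU mul1mx.
  rewrite ip_rect_diag; apply: eq_bigr => k _.
  by rewrite mxE /= eqxx /e; case: eqP => [->|]; rewrite ?mul0r ?mulr1.
pose B := B1 + P *m B' *m Q.
have cB : op_bounded B 1.
  (* [B1] sees only the complements of [P] and [Q], the other summand only their ranges; by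
     Pythagoras the two additive bounds add up to the one for [x] and [y]. *)
  apply: bilinear_amgm => x y; rewrite mul1r.
  have -> : ip x (B *m y) =
      ip ((1%:M - P) *m x) (B1 *m ((1%:M - Q) *m y)) + ip (P *m x) (B' *m (Q *m y)).
    rewrite /B mulmxDl ipDr !mulmxBl !mul1mx mulmxBr !(mulmxA B1 Q) B1Q mul0mx subr0.
    congr (_ + _); last by rewrite [in RHS]ip_mulmxl Pt !mulmxA.
    by rewrite ipDl ipNl [X in _ - X]ip_mulmxl Pt mulmxA PB1 mul0mx ip0r subr0.
  have := cB1 ((1%:M - P) *m x) ((1%:M - Q) *m y).
  have := cB' (P *m x) (Q *m y).
  have := frob_proj x Pt PP; have := frob_proj y Qt QQ.
  set p1 := frob (P *m x); set p2 := frob (_ *m x).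
  set q1 := frob (Q *m y); set q2 := frob (_ *m y).
  have := sqr_ge0 (p1 - q1); have := sqr_ge0 (p2 - q2).
  by rewrite !expr2; lra.
have := nuclear_ge_ip (G + D) ler01 cB; rewrite mul1r; apply: le_trans.
have -> : ip B (G + D) = ip B G + ip B PD + ip B (D - PD).
  by rewrite -!ipDr -addrA (addrC PD) subrK.
have -> : ip B G = \sum_(k < minn m n) s k.
  by rewrite /B ipDl B1G ip_mulmxr ip_mulmxl mulmxA Pt PG mul0mx ip0r addr0.
have -> : ip B PD = nuclear PD.
  have B1PD : ip B1 PD = 0 by rewrite ipC /PD ip_mulmxr Qt B1Q ip0r.
  have PDE : P *m (PD *m Q) = PD by rewrite /PD !mulmxA PP -(mulmxA _ Q Q) QQ.
  by rewrite /B ipDl B1PD add0r ip_mulmxr Qt ip_mulmxl Pt PDE BE'.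
have : - ip B (D - PD) <= nuclear (D - PD).
  rewrite -ipNl -[leRHS]mul1r; apply: nuclear_ge_ip => // x y.
  by rewrite mulNmx ipNr -ipNl; apply: le_trans (cB _ _) _; rewrite frobN.
lra.
Qed.

End NuclearDuality.

Section NuclearMPart.
Context {R : realType}.

Lemma op_bounded_frob_mul m n (B : 'M[R]_(m, n)) (x : 'cV[R]_n) :
  op_bounded B 1 -> frob (B *m x) <= frob x.
Proof.
move=> cB; have := cB (B *m x) x; rewrite mul1r -frob_sqr expr2.
have [->|h] := eqVneq (B *m x) 0; first by rewrite frob0 frob_ge0.
by rewrite ler_pM2l // frob_gt0.
Qed.

Lemma sum_ltn_le m r : \sum_(k < m) (k < r)%N%:R <= r%:R :> R.
Proof.
have -> : \sum_(k < m) (k < r)%N%:R = (minn m r)%:R :> R.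
  elim: m => [|m IH]; first by rewrite big_ord0 min0n.
  rewrite big_ord_recr /= IH -natrD; congr (_%:R).
  by rewrite /minn; case: (ltnP m r) => h; case: (ltnP m.+1 r) => h'; lia.
by rewrite ler_nat geq_minr.
Qed.

(** In the basis [U] the complementary projector keeps at most [r] rows of [U^T *m B], each of norm
    at most 1. *)
Lemma frob_zproj_compl m n (B : 'M[R]_(m, n)) (U : 'M[R]_m) (s : nat -> R) r :
  U^T *m U = 1%:M -> (forall k, (r <= k)%N -> s k = 0) -> op_bounded B 1 ->
  frob ((1%:M - zproj s U) *m B) <= Num.sqrt r%:R.
Proof.
move=> UU sr cB; have UU' := mulmx1C UU.
have -> : 1%:M - zproj s U = U *m ((1%:M - zdiag m s) *m U^T).
  by rewrite /zproj mulmxBl mul1mx mulmxBr UU' mulmxA.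
rewrite -[leLHS]ger0_norm ?frob_ge0 // -sqrtr_sqr ler_wsqrtr //.
rewrite -!mulmxA frob_orthl // frob_sum_row.
apply: le_trans (sum_ltn_le m r); apply: ler_sum => k _.
have -> : row k ((1%:M - zdiag m s) *m (U^T *m B)) =
    (s k != 0)%:R *: (B^T *m (U *m delta_mx k (0 : 'I_1)))^T.
  apply/rowP => j; rewrite mulmxBl mul1mx /zdiag mul_diag_mx -colE !mxE.
  have -> : \sum_j0 U^T k j0 * B j0 j = \sum_j0 B^T j j0 * col k U j0 0.
    by apply: eq_bigr => i _; rewrite !mxE mulrC.
  by case: eqP; rewrite /= ?mul1r ?mul0r ?subrr ?subr0.
rewrite frobZ frob_tr exprMn real_normK ?num_real //.
have h : frob (B^T *m (U *m delta_mx k (0 : 'I_1))) ^+ 2 <= 1.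
  apply: exprn_ile1; first exact: frob_ge0.
  apply: le_trans (op_bounded_frob_mul _ (op_bounded_tr cB)) _.
  by rewrite frob_orthl // frob_delta.
have [kr|/sr ->] := ltnP k r; last by rewrite eqxx expr0n mul0r.
by case: eqP => _ /=; rewrite ?expr0n ?expr1n ?mul1r ?mul0r.
Qed.

(** [M_part] splits as [(1 - P) D + P D (1 - Q)]. Against a dual certificate the projectors move
    onto the certificate, whose Frobenius norm drops to [Num.sqrt r%:R]; two pieces give the factor
    2. *)
Lemma nuclear_M_part m n (G D : 'M[R]_(m, n)) r : (\rank G <= r)%N ->
  nuclear (M_part G D) <= 2 * Num.sqrt r%:R * frob D.
Proof.
move=> rG; have [B cB <-] := nuclear_attained (M_part G D).
rewrite /M_part /P_perp; have H := svd_ofP G.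
case: (svd_of G) H => -[U s] V /= H; have [UU VV _ _ _] := H.
have sr k : (r <= k)%N -> s k = 0 by move=> rk; apply: (svd_rank H); exact: leq_trans rk.
rewrite -(mulmxA _ (zero_sv_cols s V)) !zero_sv_colsE.
have bU := frob_zproj_compl UU sr cB.
have bV := frob_zproj_compl VV sr (op_bounded_tr cB).
set P := zproj s U; set Q := zproj s V.
have [Pt Qt] : P^T = P /\ Q^T = Q by rewrite !zproj_tr.
have [PP QQ] : P *m P = P /\ Q *m Q = Q by rewrite !zproj_idem.
rewrite -/P in bU; rewrite -/Q in bV; clearbody P Q.
have -> : D - P *m D *m Q = (1%:M - P) *m D + P *m (D *m (1%:M - Q)).
  by rewrite mulmxBl mul1mx !mulmxBr mulmx1 mulmxA addrA subrK.
have E1 : ip B ((1%:M - P) *m D) = ip ((1%:M - P) *m B) D.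
  by rewrite ip_mulmxl linearB /= trmx1 Pt.
have E2 : ip B (P *m (D *m (1%:M - Q))) = ip (P *m (B *m (1%:M - Q))) D.
  by rewrite ipC ip_mulmxl Pt ip_mulmxr linearB /= trmx1 Qt ipC mulmxA.
rewrite ipDr E1 E2 -mulrA mulr2n mulrDl mul1r; apply: lerD.
  by apply: le_trans (ip_le _ _) _; rewrite ler_wpM2r ?frob_ge0.
apply: le_trans (ip_le _ _) _; rewrite ler_wpM2r ?frob_ge0 //.
apply: le_trans (frob_proj_le _ Pt PP) _.
by rewrite -frob_tr trmx_mul linearB /= trmx1 Qt.
Qed.

End NuclearMPart.

(** * Logistic function *)

Section Logistic.
Context {R : realType}.

(** From [1 - x <= expR (- x)] one gets [expR x <= (1 - x)^-1], which the quadratic dominates for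
    [x] at most 1/2. *)
Lemma expR_quad (x : R) : `|x| <= 2^-1 -> expR x <= 1 + x + 2 * x ^+ 2.
Proof.
move=> x2; have := expR_ge1Dx (- x); rewrite expRN => h.
have [x1 x3] : - 2^-1 <= x /\ x <= 2^-1 by move: x2; rewrite ler_norml => /andP.
have h1 : 0 < 1 - x by lra.
have E0 := expR_gt0 x.
have h2 : expR x * (1 - x) <= 1.
  by rewrite -ler_pdivlMl // mulr1.
rewrite -(ler_pM2r h1); apply: le_trans h2 _.
by have := sqr_ge0 x; rewrite expr2; nra.
Qed.

Lemma Lambda_gt0 (u : R) : 0 < Lambda u.
Proof. by rewrite invr_gt0 addr_gt0 // expR_gt0. Qed.

Lemma Lambda_lt1 (u : R) : Lambda u < 1.
Proof. by rewrite invf_lt1 ?addr_gt0 ?expR_gt0 // ltrDl expR_gt0. Qed.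

Lemma LambdaE (u : R) : Lambda u = expR u / (1 + expR u).
Proof.
rewrite /Lambda expRN; have := expR_gt0 u => h; field.
by rewrite !gt_eqF // addr_gt0.
Qed.

Lemma LambdaN (u : R) : 1 - Lambda u = (1 + expR u)^-1.
Proof.
by rewrite LambdaE; have := expR_gt0 u => h; field; rewrite gt_eqF // addr_gt0.
Qed.

Lemma loglik_Lambda (y x : R) : loglik y (Lambda x) = y * x - ln (1 + expR x).
Proof.
have h := expR_gt0 x; have h1 : 0 < 1 + expR x by rewrite addr_gt0.
rewrite /loglik LambdaN LambdaE lnM ?posrE ?invr_gt0 // !lnV ?posrE // expRK; ring.
Qed.

(* The cumulant generating function of a centred Bernoulli([p]) variable. *)
Lemma bernoulli_cgf_lower_pos (p d b : R) : 0 <= p -> p <= 1 -> 0 <= d -> d <= b -> 1 <= b ->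
  p * (1 - p) * d ^+ 2 / (4 * b) <= ln (1 - p + p * expR d) - p * d.
Proof.
move=> p0 p1 d0 db b1.
pose g t := ln (1 - p + p * expR t) - p * t - p * (1 - p) / (4 * b) * t ^+ 2.
have pos t : 0 < 1 - p + p * expR t.
  have E0 := expR_gt0 t; have [->|pn] := eqVneq p 0; first by rewrite mul0r; lra.
  by rewrite ltr_wpDl ?subr_ge0 // mulr_gt0 // lt_def pn.
pose g' t := (p * expR t) / (1 - p + p * expR t) - p - p * (1 - p) / (4 * b) * (2 * t).
have dg (t : R) : is_derive t (1 : R) g (g' t).
  have dh : is_derive t (1 : R) (fun t => 1 - p + p * expR t) (p * expR t).
    by apply: is_derive_eq; rewrite add0r mul1r.
  have dl : is_derive t (1 : R) (fun t => ln (1 - p + p * expR t))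
      ((p * expR t) / (1 - p + p * expR t)).
    by have H := is_derive1_ln (pos t); apply: is_derive_eq; rewrite mulrC.
  by apply: is_derive_eq; rewrite /GRing.scale /= /g'; ring.
suff : g 0 <= g d.
  rewrite /g expR0 mulr1 subrK ln1 mulr0 expr0n mulr0 !subr0.
  rewrite subr_ge0 => h; apply: le_trans h.
  by rewrite le_eqVlt; apply/orP; left; apply/eqP; field; lra.
have [|c] := @MVT_segment R g g' 0 d d0 (fun t _ => dg t).
  by apply: derivable_within_continuous => t _; exact: ex_derive.
move=> cin E; rewrite -subr_ge0 E subr0.
move: cin; rewrite in_itv /= => /andP[c0 cd]; rewrite mulr_ge0 // {E}.
have E1 := expR_ge1Dx c; have P := pos c; rewrite /g'.
set E := expR c in E1 P *.
have -> : p * E / (1 - p + p * E) - p - p * (1 - p) / (4 * b) * (2 * c) =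
  p * (1 - p) * (((E - 1) * (2 * b) - c * (1 - p + p * E)) / ((1 - p + p * E) * (2 * b))).
  by field; rewrite !gt_eqF //; lra.
apply: mulr_ge0; first by rewrite mulr_ge0 // subr_ge0.
apply: divr_ge0; last by apply: mulr_ge0; [exact: ltW | lra].
rewrite subr_ge0.
(* The sign of the derivative reduces to [c E <= 2 b (E - 1)] with [E = expR c]; this follows from
   [c <= b], [c <= E - 1] and [1 <= b]. *)
have h1 : c * (1 - p + p * E) <= c * E by rewrite ler_wpM2l //; nra.
have h2 : c * (E - 1) <= b * (E - 1) by rewrite ler_wpM2r; lra.
have h3 : 1 * (E - 1) <= b * (E - 1) by rewrite ler_wpM2r; lra.
lra.
Qed.

(** A negative [d] is treated by exchanging success and failure: [p] to [1 - p] and [d] to [- d]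
    leave the centred function unchanged. *)
Lemma bernoulli_cgf_lower (p d b : R) : 0 <= p -> p <= 1 -> `|d| <= b -> 1 <= b ->
  p * (1 - p) * d ^+ 2 / (4 * b) <= ln (1 - p + p * expR d) - p * d.
Proof.
move=> p0 p1 db b1; have [d0|d0] := lerP 0 d.
  by apply: bernoulli_cgf_lower_pos => //; rewrite ger0_norm in db.
have q0 : 0 <= 1 - p by lra.
have q1 : 1 - p <= 1 by lra.
have dn : 0 <= - d by lra.
have dbn : - d <= b by rewrite ltr0_norm in db.
have := bernoulli_cgf_lower_pos q0 q1 dn dbn b1.
have -> : 1 - (1 - p) = p by lra.
rewrite sqrrN (mulrC (1 - p) p) => /le_trans; apply.
have E0 := expR_gt0 (- d).
have pos : 0 < p + (1 - p) * expR (- d).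
  have [->|pn] := eqVneq p 0; first by rewrite add0r subr0 mul1r.
  by rewrite ltr_pwDl // ?lt_def ?pn // mulr_ge0 // ltW.
have -> : 1 - p + p * expR d = expR d * (p + (1 - p) * expR (- d)).
  by rewrite mulrDr mulrCA -expRD subrr expR0; ring.
rewrite lnM ?posrE ?expR_gt0 // expRK; lra.
Qed.

(** The increment of [ln (1 + expR x)] is the cumulant generating function of a Bernoulli variable
    with parameter [Lambda x]. The curvature is taken at [x] itself, not at an intermediate point,
    and the range of [d] costs only the factor [b]. *)
Lemma logistic_bregman (x d b : R) : `|d| <= b -> 1 <= b ->
  Lambda x * (1 - Lambda x) * d ^+ 2 / (4 * b) <=
  ln (1 + expR (x + d)) - ln (1 + expR x) - Lambda x * d.
Proof.
move=> db b1.
have := bernoulli_cgf_lower (ltW (Lambda_gt0 x)) (ltW (Lambda_lt1 x)) db b1.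
have E0 := expR_gt0 x; have E1 := expR_gt0 (x + d).
move=> /le_trans; apply; rewrite lerB // -ln_div ?posrE ?addr_gt0 //.
rewrite le_eqVlt; apply/orP; left; apply/eqP; congr ln.
by rewrite LambdaN LambdaE expRD; field; rewrite gt_eqF // addr_gt0.
Qed.

End Logistic.

(** * Chernoff bounds for the network noise *)

Section IndepFubini.
Context {d : measure_display} {T : measurableType d} {R : realType}.
Variable P : probability T R.
Variable G : set (set T).
Hypotheses (Gm : G `<=` measurable) (GI : setI_closed G) (GT : G setT).
Variable eps : T -> R.
Hypothesis meps : measurable_fun setT eps.
Hypothesis indG : forall A C, G A -> measurable C ->
  P (A `&` eps @^-1` C) = (P A * P (eps @^-1` C))%E.

(** Both sides are finite measures in [A] that agree on the pi-system [G], hence on the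
    sigma-algebra it generates. *)
Lemma indep_sigma_of_pi A C : <<s G >> A -> measurable C ->
  P (A `&` eps @^-1` C) = (P A * P (eps @^-1` C))%E.
Proof.
move=> GA mC.
have mE : measurable (eps @^-1` C) by rewrite -[X in measurable X]setTI; exact: meps.
have r0 : 0 <= fine (P (eps @^-1` C)) by exact: fine_ge0.
pose m2 := mscale (NngNum r0) P.
have m2E B : m2 B = (P B * P (eps @^-1` C))%E.
  by rewrite /m2 /mscale /= fineK ?fin_num_measure // muleC.
rewrite -m2E.
apply: (@g_sigma_algebra_measure_unique _ R T G Gm (fun=> setT) _ _ (mrestr P mE) m2) => //.
- by rewrite bigcup_const.
- by move=> B GB; rewrite [RHS]m2E; exact: indG.
- by move=> _; rewrite /= /mrestr setTI ltey_eq fin_num_measure.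
Qed.

End IndepFubini.

Section IndepIntegral.
Context {d d1 d2 : measure_display} {T : measurableType d}
  {T1 : measurableType d1} {T2 : measurableType d2} {R : realType}.
Variables (P : probability T R) (X1 : {mfun T >-> T1}) (X2 : {mfun T >-> T2}).
Hypothesis X12 : forall A B, measurable A -> measurable B ->
  P (X1 @^-1` A `&` X2 @^-1` B) = (P (X1 @^-1` A) * P (X2 @^-1` B))%E.

Let phi (w : T) := (X1 w, X2 w).

Let mphi : measurable_fun setT phi.
Proof. exact: measurable_fun_pair. Qed.

Let pack_phi : {mfun T >-> (T1 * T2)%type} :=
  HB.pack phi (isMeasurableFun.Build _ _ _ _ phi mphi).

(** The joint law is a product, so Tonelli integrates [X1] under its own law with [X2] frozen. This
    takes the place of conditional expectations given [X2]. *)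
Lemma integral_indep (f : T1 * T2 -> \bar R) :
  measurable_fun setT f -> (forall z, 0 <= f z)%E ->
  (\int[P]_w f (X1 w, X2 w) = \int[P]_w \int[distribution P X1]_x f (x, X2 w))%E.
Proof.
move=> mf f0.
transitivity (\int[distribution P pack_phi]_z f z)%E.
  by rewrite [RHS]ge0_integral_pushforward // preimage_setT.
transitivity (\int[distribution P X1 \x distribution P X2]_z f z)%E.
  apply: eq_measure_integral => A mA _; apply/esym.
  by apply: product_measure_unique => // B C mB mC; rewrite -X12.
rewrite fubini_tonelli2 // ge0_integral_pushforward //.
- exact: measurable_fun_fubini_tonelli_G.
- by move=> y _; apply: integral_ge0 => x _.
Qed.

End IndepIntegral.

Section BernoulliMgf.
Context {d d2 : measure_display} {T : measurableType d}
  {T2 : measurableType d2} {R : realType}.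
Variables (P : probability T R) (X1 : {mfun T >-> measurableTypeR R})
  (X2 : {mfun T >-> T2}).
Hypothesis X12 : forall A B, measurable A -> measurable B ->
  P (X1 @^-1` A `&` X2 @^-1` B) = (P (X1 @^-1` A) * P (X2 @^-1` B))%E.
Variable F : R -> R.
Hypothesis F01 : forall t, 0 <= F t <= 1.
Hypothesis mF : measurable_fun setT F.
Hypothesis X1F : forall t, P [set w | (X1 w : R) <= t] = (F t)%:E.
Variable q : T2 -> R.
Hypothesis mq : measurable_fun setT q.

Lemma integral_indep_threshold (H0 H1 : T2 -> R) :
  measurable_fun setT H0 -> measurable_fun setT H1 ->
  (forall w, 0 <= H0 w) -> (forall w, 0 <= H1 w) ->
  (\int[P]_w (if ((X1 w : R) <= q (X2 w))%R then H1 (X2 w) else H0 (X2 w))%:E =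
   \int[P]_w (H1 (X2 w) * F (q (X2 w)) + H0 (X2 w) * (1 - F (q (X2 w))))%:E)%E.
Proof.
move=> mH0 mH1 H00 H10.
pose f (z : measurableTypeR R * T2) :=
  (if (z.1 <= q z.2)%R then H1 z.2 else H0 z.2)%:E.
have mf : measurable_fun setT f.
  apply/measurable_EFinP; apply: measurable_fun_ifT.
  - by apply: measurable_fun_ler => //; exact: (measurableT_comp mq).
  - exact: (measurableT_comp mH1).
  - exact: (measurableT_comp mH0).
rewrite -[LHS]/(\int[P]_w f (X1 w, X2 w))%E integral_indep //; last first.
  by move=> z; rewrite lee_fin; case: ifP.
apply: eq_integral => v _; set w := X2 v.
pose A : set (measurableTypeR R) := [set x : R | x <= q w].
have mA : measurable A.
  rewrite [A](_ : _ = `]-oo, q w]%classic); first exact: measurable_itv.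
  by apply/seteqP; split => x /=; rewrite in_itv.
have PA : distribution P X1 A = (F (q w))%:E by rewrite -X1F.
have PnA : distribution P X1 (~` A) = (1 - F (q w))%:E.
  by rewrite probability_setC // [X in (_ - X)%E]PA.
transitivity (\int[distribution P X1]_x
   ((H1 w)%:E * (\1_A x)%:E + (H0 w)%:E * (\1_(~` A) x)%:E))%E.
  apply: eq_integral => x _; rewrite /f /= !indicE in_setC.
  have -> : (x \in A) = (x <= q w).
    by apply/idP/idP; rewrite inE.
  by case: ifP => _ /=; rewrite ?mule1 ?mule0 ?adde0 ?add0e.
rewrite ge0_integralD //; last 4 first.
- by move=> x _; rewrite mule_ge0 ?lee_fin ?H10 // indicE.
- by apply: measurable_funeM; apply/measurable_EFinP; exact: measurable_indic.
- by move=> x _; rewrite mule_ge0 ?lee_fin ?H00 // indicE.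
- by apply: measurable_funeM; apply/measurable_EFinP; apply: measurable_indic; exact: measurableC.
have intZ (c : R) (B : set (measurableTypeR R)) : 0 <= c -> measurable B ->
    (\int[distribution P X1]_x (c%:E * (\1_B x)%:E) = c%:E * distribution P X1 B)%E.
  move=> c0 mB; rewrite ge0_integralZl ?lee_fin //.
  - by rewrite integral_indic // setIT.
  - by apply/measurable_EFinP; exact: measurable_indic.
by rewrite (intZ _ _ (H10 w) mA) (intZ _ _ (H00 w) (measurableC mA)) PA PnA.
Qed.

(** The exponent is proportional to [p], not only to [b ^+ 2]; this keeps the factor zeta_n of
    sparse networks in the Chernoff bound. *)
Lemma bernoulli_mgf (p b : R) : 0 <= p -> p <= 1 -> `|b| <= 2^-1 ->
  expR (b * (1 - p)) * p + expR (b * (0 - p)) * (1 - p) <= expR (2 * p * b ^+ 2).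
Proof.
move=> p0 p1 b2.
have -> : expR (b * (1 - p)) = expR (- (b * p)) * expR b by rewrite -expRD; congr expR; ring.
have -> : b * (0 - p) = - (b * p) by ring.
have E := expR_gt0 (- (b * p)).
have -> : 2 * p * b ^+ 2 = - (b * p) + p * (b + 2 * b ^+ 2) by ring.
rewrite expRD -mulrA -mulrDr ler_wpM2l ?expR_ge0 //.
apply: le_trans _ (expR_ge1Dx _).
by have := expR_quad b2; nra.
Qed.

(** One step of the Chernoff product: integrating out a single shock, whose weight [b] and threshold
    [q] depend on the rest through [X2], costs the deterministic factor [expR s]. *)
Lemma integral_mgf_step (H b : T2 -> R) (s : R) :
  measurable_fun setT H -> measurable_fun setT b ->
  (forall w, 0 <= H w) -> (forall w, `|b w| <= 2^-1) ->
  (forall w, 2 * F (q w) * b w ^+ 2 <= s) ->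
  (\int[P]_w (H (X2 w) *
      expR (b (X2 w) * (((X1 w : R) <= q (X2 w))%R%:R - F (q (X2 w)))))%:E <=
   (expR s)%:E * \int[P]_w (H (X2 w))%:E)%E.
Proof.
move=> mH mb H0 b2 bs.
have mFq : measurable_fun setT (F \o q) by exact: measurableT_comp.
have mE (c : R) : measurable_fun setT (fun w => H w * expR (b w * (c - F (q w)))).
  apply: measurable_funM => //; apply: measurableT_comp => //.
  by apply: measurable_funM => //; apply: measurable_funB.
have sub (h : T2 -> R) : measurable_fun setT h -> measurable_fun setT (h \o X2).
  by move=> mh; exact: measurableT_comp.
under eq_integral => w _.
  rewrite (_ : _ * expR _ = if ((X1 w : R) <= q (X2 w))%R
             then H (X2 w) * expR (b (X2 w) * (1 - F (q (X2 w))))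
             else H (X2 w) * expR (b (X2 w) * (0 - F (q (X2 w))))); last by case: ifP.
  over.
rewrite (integral_indep_threshold (mE 0) (mE 1)); last 2 first.
- by move=> w; rewrite mulr_ge0 // expR_ge0.
- by move=> w; rewrite mulr_ge0 // expR_ge0.
rewrite -ge0_integralZl ?lee_fin ?expR_ge0 //; last 2 first.
- by apply/measurable_EFinP; exact: sub.
- by move=> w _; rewrite lee_fin.
apply: ge0_le_integral => //.
- move=> w _; rewrite lee_fin; have /andP[f0 f1] := F01 (q (X2 w)).
  by rewrite addr_ge0 // !mulr_ge0 // ?expR_ge0 // subr_ge0.
- apply/measurable_EFinP.
  apply: (sub (fun w => H w * expR (b w * (1 - F (q w))) * F (q w) +
    H w * expR (b w * (0 - F (q w))) * (1 - F (q w)))).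
  apply: measurable_funD; apply: measurable_funM => //.
  exact: measurable_funB.
- by apply: measurable_funeM; apply/measurable_EFinP; exact: sub.
move=> v _; rewrite -EFinM lee_fin; set w := X2 v.
have /andP[f0 f1] := F01 (q w).
have := bernoulli_mgf f0 f1 (b2 w).
rewrite -!mulrA -mulrDr (mulrC (expR s)) => h; rewrite ler_wpM2l //.
by apply: le_trans h _; rewrite ler_expR mulrA.
Qed.

End BernoulliMgf.

(** * Independence of the split, the covariates and the shocks *)

Section ModelIndependence.
Context {R : realType} {c : constants R}.
Context {dT : nat -> measure_display} {T : forall n, measurableType (dT n)}.
Variable P : forall n, probability (T n) R.
Context {dX dE : measure_display}.
Context {EX : measurableType dX} {EE : measurableType dE}.
Variable N : network c T EX EE.
Hypotheses (hD : DGP P N) (hS : random_split P N).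
Variable n : nat.
Implicit Types (S : {set 'I_n}) (D : pred ('I_n * 'I_n)).

Local Notation dataE := (@data_events R c dT T dX dE EX EE N n).
Local Notation epsE := (@eps_events R c dT T dX dE EX EE N n).
Let eps' (p : 'I_n * 'I_n) : T n -> R := eps N p.1 p.2.

Lemma measurable_eps p : pairs_of p -> measurable_fun setT (eps' p).
Proof. by case: (eps_iid hD n) => h _ _; exact: h. Qed.

Lemma data_events_measurable : dataE `<=` measurable.
Proof.
move=> A [|] [j [B [Dj mB ->]]]; rewrite -[X in measurable X]setTI.
  by case: (X_iid hD n) => h _ _; exact: h.
by case: (e_iid hD n) => h _ _; exact: h.
Qed.

Lemma eps_events_measurable : epsE `<=` measurable.
Proof.
move=> A [j [B [Dj mB ->]]]; rewrite -[X in measurable X]setTI.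
exact: (measurable_eps Dj).
Qed.

Lemma sigma_sub_measurable d (Z : measurableType d) (F : set (set Z)) :
  F `<=` measurable -> <<s F >> `<=` measurable.
Proof. by move=> h; apply: smallest_sub => //; exact: sigma_algebra_measurable. Qed.

(* Products of an event on the split, an event on the covariates and a box of
   the shocks indexed by [D]. *)
Definition split_pi S D : set (set (T n)) :=
  [set A | exists I B C, [/\ I = setT \/ I = [set w | I1 N w = S],
     <<s dataE >> B, (forall p, measurable (C p)) &
     A = I `&` B `&` \bigcap_(p in [set p | D p]) eps' p @^-1` C p]].

Lemma split_pi_setI S D : setI_closed (split_pi S D).
Proof.
move=> _ _ [I [B [C [hI hB hC ->]]]] [I' [B' [C' [hI' hB' hC' ->]]]].
exists (I `&` I'), (B `&` B'), (fun p => C p `&` C' p); split.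
- case: hI hI' => -> [] ->; rewrite ?setTI ?setIT ?setIid; [by left|by right..].
- exact: (@measurableI _ (g_sigma_algebraType (dataE))).
- by move=> p; exact: measurableI.
- rewrite [in RHS](eq_bigcapr (fun p _ => preimage_setI (eps' p) (C p) (C' p))).
  by rewrite bigcapI setIACA (setIACA I).
Qed.

Lemma split_pi_setT S D : split_pi S D setT.
Proof.
exists setT, setT, (fun=> setT); split => //; first by left.
  exact: (@measurableT _ (g_sigma_algebraType (dataE))).
rewrite !setTI; apply/esym/seteqP; split => // w _ p _; exact: I.
Qed.

Lemma split_pi_subset S D D' : (forall p, D p -> D' p) ->
  split_pi S D `<=` split_pi S D'.
Proof.
move=> DD A [I [B [C [hI hB hC ->]]]].
exists I, B, (fun p => if D p then C p else setT); split => //.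
  by move=> p; case: ifP.
congr (_ `&` _); apply/seteqP; split => w h p /= Dp.
  by case: ifP => // Dp'; exact: h.
by have := h p (DD _ Dp); rewrite /= Dp.
Qed.

Lemma split_pi_I1 S D : split_pi S D [set w | I1 N w = S].
Proof.
exists [set w | I1 N w = S], setT, (fun=> setT); split => //; first by right.
  exact: (@measurableT _ (g_sigma_algebraType (dataE))).
rewrite setIT; apply/esym/seteqP; split => [w []//|w h]; split => // p _; exact: I.
Qed.

Lemma split_pi_data S D A : <<s dataE >> A -> split_pi S D A.
Proof.
move=> hA; exists setT, A, (fun=> setT); split => //; first by left.
rewrite setTI; apply/esym/seteqP; split => [w []//|w h]; split => // p _; exact: I.
Qed.

Lemma split_pi_eps S D p C : D p -> measurable C -> split_pi S D (eps' p @^-1` C).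
Proof.
move=> Dp mC; exists setT, setT, (fun p' => if p' == p then C else setT); split => //.
- by left.
- exact: (@measurableT _ (g_sigma_algebraType (dataE))).
- by move=> p'; case: ifP.
rewrite !setTI; apply/seteqP; split => w /= h.
  by move=> p' _ /=; case: eqP => // ->.
by have := h p Dp; rewrite /= eqxx.
Qed.

Lemma sigma_eps_bigcap D (C : 'I_n * 'I_n -> set R) : (forall p, D p -> pairs_of p) ->
  (forall p, measurable (C p)) ->
  <<s epsE >> (\bigcap_(p in [set p | D p]) eps' p @^-1` C p).
Proof.
move=> DP mC; apply: (@fin_bigcap_measurable _ (g_sigma_algebraType (epsE))) => //.
move=> p Dp; apply: sub_sigma_algebra; exists p, (C p); split => //; exact: DP.
Qed.

Lemma split_pi_measurable S D : (forall p, D p -> pairs_of p) ->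
  split_pi S D `<=` measurable.
Proof.
move=> DP A [I [B [C [hI hB hC ->]]]].
apply: measurableI; first apply: measurableI.
- case: hI => -> //; by have [k [_ _ h _ _]] := hS n; exact: h.
- by apply: sigma_sub_measurable hB; exact: data_events_measurable.
- apply: (sigma_sub_measurable eps_events_measurable); exact: sigma_eps_bigcap.
Qed.

Lemma prob_eps_bigcap D (C : 'I_n * 'I_n -> set R) : (forall p, D p -> pairs_of p) ->
  (forall p, measurable (C p)) ->
  P n (\bigcap_(p in [set p | D p]) eps' p @^-1` C p) =
  (\prod_(p | D p) P n (eps' p @^-1` C p))%E.
Proof.
move=> DP mC; have [_ ind _] := eps_iid hD n.
have := ind (fun p => if D p then C p else setT).
rewrite (_ : \bigcap_(j in _) _ = \bigcap_(p in [set p | D p]) eps' p @^-1` C p); last first.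
  apply/seteqP; split => w /= h p /= Dp.
    by have := h p (DP _ Dp); rewrite /= Dp.
  by case: ifP => // Dp'; exact: h.
move=> ->; last by move=> p; case: ifP.
rewrite (bigID D) /= [X in (_ * X)%E]big1 ?mule1; last first.
  by move=> p /andP[_ /negbTE ->]; rewrite preimage_setT probability_setT.
apply: eq_big => [p|p /andP[_ ->]//].
by have [/DP->|] := boolP (D p); rewrite ?andbF.
Qed.

(** As [p] lies outside [D], the event on its shock merely enlarges the box of [split_pi] by one
    coordinate, and the probability of a box factorizes. *)
Lemma indep_split_eps S D p A C : (forall p, D p -> pairs_of p) -> pairs_of p -> ~~ D p ->
  split_pi S D A -> measurable C ->
  P n (A `&` eps' p @^-1` C) = (P n A * P n (eps' p @^-1` C))%E.
Proof.
move=> DP pp nDp [I [B [C' [hI hB hC ->]]]] mC.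
pose D' p' := (p' == p) || D p'.
pose C2 p' := if p' == p then C else C' p'.
have DP' p' : D' p' -> pairs_of p' by case/orP => [/eqP ->//|]; exact: DP.
have mC2 p' : measurable (C2 p') by rewrite /C2; case: ifP.
set E := \bigcap_(p in [set p | D p]) _.
have EF : E `&` eps' p @^-1` C = \bigcap_(p in [set p | D' p]) eps' p @^-1` C2 p.
  apply/seteqP; split => w /=.
    move=> [hE hw] p' /= /orP[/eqP ->|Dp]; rewrite /C2 ?eqxx //.
    by case: eqP => [->//|_]; exact: hE.
  move=> h; split => [p' /= Dp'|].
    have := h p'; rewrite /= /D' /C2 Dp' orbT => /(_ isT).
    by case: eqP => // e; rewrite -e Dp' in nDp.
  by have := h p; rewrite /= /D' /C2 eqxx => /(_ isT).
have PEF : P n (E `&` eps' p @^-1` C) = (P n E * P n (eps' p @^-1` C))%E.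
  rewrite EF !prob_eps_bigcap // (bigD1 p) /=; last by rewrite /D' eqxx.
  rewrite {1}/C2 eqxx muleC; congr (_ * _)%E; apply: eq_big => p'.
    rewrite /D'; have [->|] //= := eqVneq p' p; last by rewrite andbT.
    by rewrite (negbTE nDp).
  by move=> /andP[_ /negbTE h]; rewrite /C2 h.
have sE : <<s epsE >> E by exact: sigma_eps_bigcap.
have sEF : <<s epsE >> (E `&` eps' p @^-1` C).
  by rewrite EF; exact: sigma_eps_bigcap.
(* Two layers of independence: the split from everything else, then the shocks from the
   covariates. *)
have key I' E' : I' = setT \/ I' = [set w | I1 N w = S] -> <<s epsE >> E' ->
    P n (I' `&` B `&` E') = (P n I' * P n B * P n E')%E.
  move=> hI' sE'.
  have h : P n (B `&` E') = (P n B * P n E')%E.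
    by rewrite setIC muleC; apply: (eps_indep hD).
  rewrite -setIA -muleA -h.
  case: hI' => ->; first by rewrite setTI probability_setT mul1e.
  have [k [_ _ _ _ hk]] := hS n; apply: hk.
  apply: (@measurableI _ (g_sigma_algebraType (epsE `|` dataE))).
    by apply: (@sub_smallest2r _ (sigma_algebra setT) dataE) hB; [exact: smallest_sigma_algebra | exact: subsetUr].
  by apply: (@sub_smallest2r _ (sigma_algebra setT) epsE) sE'; [exact: smallest_sigma_algebra | exact: subsetUl].
by rewrite -setIA !key // PEF muleA.
Qed.

End ModelIndependence.

Section Chernoff.
Context {R : realType} {c : constants R}.
Context {dT : nat -> measure_display} {T : forall n, measurableType (dT n)}.
Variable P : forall n, probability (T n) R.
Context {dX dE : measure_display}.
Context {EX : measurableType dX} {EE : measurableType dE}.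
Variable N : network c T EX EE.
Hypotheses (hD : DGP P N) (hS : random_split P N).
Variable n : nat.
Implicit Types (S : {set 'I_n}) (D : pred ('I_n * 'I_n)).

Definition opair (i j : 'I_n) : 'I_n * 'I_n := if (i < j)%N then (i, j) else (j, i).

Lemma opair_pairs i j : i != j -> pairs_of (opair i j).
Proof.
move=> ij; rewrite /pairs_of /opair; case: ifP => // h /=.
by rewrite ltn_neqAle eq_sym val_eqE ij leqNgt h.
Qed.

Lemma opair_inj i j k : opair i j = opair i k -> j = k.
Proof. by rewrite /opair; case: ifP; case: ifP => h1 h2 [] // ? ?; subst. Qed.

Definition link_index (w : T n) (i j : 'I_n) : R :=
  tau N n + Theta N n l0 i j + W1 N w i j * Theta N n l1 i j.

Lemma W1_sym (w : T n) i j : W1 N w i j = W1 N w j i.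
Proof.
have [->//|ij] := eqVneq i j.
rewrite (W1_def hD) // (W1_def hD); last by rewrite eq_sym.
by rewrite (g1_sym hD) (e_sym hD).
Qed.

Lemma Y_threshold (w : T n) i j : (forall l, (Theta N n l)^T = Theta N n l) -> i != j ->
  Y N w i j = (eps N (opair i j).1 (opair i j).2 w <= link_index w i j)%R%:R.
Proof.
move=> sT ij; rewrite /Y /opair; case: ltnP => h //=.
rewrite /= ltn_neqAle eq_sym val_eqE ij h /= /edge /link_index.
by rewrite -(W1_sym w i j) -{1}(sT l0) -{1}(sT l1) !mxE.
Qed.

Lemma Wdot2 (w : T n) i j (g : 'I_2 -> R) :
  Wdot N w i j g = g l0 + W1 N w i j * g l1.
Proof.
by rewrite /Wdot big_ord_recr big_ord1 /= /W /= mxE mul1r; congr (g _ + _ * g _); exact: val_inj.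
Qed.

Lemma Lambda_nE (w : T n) i j : Lambda_n N w i j = Lambda (link_index w i j).
Proof. by rewrite /Lambda_n Wdot2 /Gamma /= !mxE. Qed.

Lemma continuous_Lambda : continuous (@Lambda R).
Proof.
move=> x; apply: (@continuousV R R (fun u : R => 1 + expR (- u))).
  by rewrite gt_eqF // addr_gt0 ?expR_gt0.
apply: continuousD; first exact: cst_continuous.
by apply: continuous_comp; [exact: continuousN | exact: continuous_expR].
Qed.

(** The sample space with the sigma-algebra of the event {I1 = S}, the covariates and the shocks in
    [D]. Measurability for it expresses what a weight is allowed to depend on. *)
Local Notation GT S D := (g_sigma_algebraType (@split_pi R c dT T dX dE EX EE N n S D)).

Lemma measurable_split_sub S D D' (f : T n -> R) : (forall p, D p -> D' p) ->
  measurable_fun setT (f : GT S D -> R) -> measurable_fun setT (f : GT S D' -> R).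
Proof.
move=> DD mf _ B mB; have := mf measurableT B mB.
apply: (@sub_smallest2r _ (sigma_algebra setT)); first exact: smallest_sigma_algebra.
exact: split_pi_subset.
Qed.

Lemma measurable_W1 S D i j : i != j ->
  measurable_fun setT ((fun w => W1 N w i j) : GT S D -> R).
Proof.
move=> ij.
have mX k : measurable_fun setT (X N k : GT S D -> EX).
  move=> _ B mB; rewrite setTI; apply: sub_sigma_algebra; apply: split_pi_data.
  by apply: sub_sigma_algebra; left; exists k, B.
have me : measurable_fun setT (e N i j : GT S D -> EE).
  have -> : e N i j = e N (opair i j).1 (opair i j).2.
    by rewrite /opair; case: ifP => // _; rewrite (e_sym hD).
  move=> _ B mB; rewrite setTI; apply: sub_sigma_algebra; apply: split_pi_data.
  apply: sub_sigma_algebra; right; exists (opair i j), B; split => //.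
  exact: opair_pairs.
have -> : (fun w => W1 N w i j) = (fun w => g1 N (X N i w) (X N j w) (e N i j w)).
  by apply/funext => w; rewrite (W1_def hD).
have mp : measurable_fun setT
    ((fun w => (X N i w, X N j w, e N i j w)) : GT S D -> (EX * EX * EE)%type).
  by apply: measurable_fun_pair => //; exact: measurable_fun_pair.
exact: (measurableT_comp (g1_meas hD) mp).
Qed.

Lemma measurable_link_index S D i j : i != j ->
  measurable_fun setT ((fun w => link_index w i j) : GT S D -> R).
Proof.
move=> ij; have mW := measurable_W1 (S := S) (D := D) ij.
by apply: measurable_funD => //; apply: measurable_funM.
Qed.

Lemma measurable_I1_indic S D :
  measurable_fun setT (\1_[set w : T n | I1 N w = S] : GT S D -> R).
Proof.
apply: (measurable_indic (d := sigma_display _)); apply: sub_sigma_algebra.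
exact: split_pi_I1.
Qed.

Variables (S : {set 'I_n}) (D : pred ('I_n * 'I_n)) (i : 'I_n).
Hypothesis sT : forall l, (Theta N n l)^T = Theta N n l.
Hypothesis DP : forall p, D p -> pairs_of p.

(** The pairs whose shocks are revealed once those joining [i] to the nodes of [J] are added to
    [D]. *)
Definition adjoin_pairs (J : seq 'I_n) : pred ('I_n * 'I_n) :=
  fun p => D p || has (fun j => (j != i) && (p == opair i j)) J.

Lemma adjoin_pairsP J p : adjoin_pairs J p -> pairs_of p.
Proof.
by case/orP => [|/hasP[j _ /andP[ji /eqP ->]]]; [exact: DP | apply: opair_pairs; rewrite eq_sym].
Qed.

(** The indicator of {I1 = S} carries the probability of the split through the moment bound, where
    the union over all splits needs it. *)
Definition mgf_weight (b : 'I_n -> T n -> R) (J : seq 'I_n) (w : T n) : R :=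
  \1_[set w | I1 N w = S] w *
    expR (\sum_(j <- J) b j w * (Y N w i j - Lambda_n N w i j)).

(** Induction on [J]: the shock of the new pair is independent of the sigma-algebra of
    [adjoin_pairs J], for which its weight, its threshold and the product built so far are
    measurable. [integral_mgf_step] then applies. Measurability of the product is proved along,
    since the next step needs it. *)
Lemma mgf_bound (J : seq 'I_n) (b : 'I_n -> T n -> R) (s : R) :
  uniq J -> (forall j, j \in J -> j != i /\ ~~ D (opair i j)) ->
  (forall j, j \in J -> measurable_fun setT (b j : GT S D -> R)) ->
  (forall j w, j \in J -> `|b j w| <= 2^-1) ->
  (forall j w, j \in J -> 2 * Lambda_n N w i j * b j w ^+ 2 <= s) ->
  measurable_fun setT (mgf_weight b J : GT S (adjoin_pairs J) -> R) /\
  (\int[P n]_w (mgf_weight b J w)%:E <=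
    P n [set w | I1 N w = S] * (expR (s * (size J)%:R))%:E)%E.
Proof.
elim: J => [|j0 J IH] /=.
  move=> _ _ _ _ _; split.
    rewrite (_ : mgf_weight b [::] = \1_[set w | I1 N w = S]); first exact: measurable_I1_indic.
    by apply/funext => w; rewrite /mgf_weight big_nil expR0 mulr1.
  rewrite mulr0 expR0 mule1.
  under eq_integral do rewrite /mgf_weight big_nil expR0 mulr1.
  rewrite integral_indic ?setIT //.
  by have [k [_ _ h _ _]] := hS n; exact: h.
move=> /andP[j0J uJ] hJ mb b2 bs.
have [mH iH] : measurable_fun setT (mgf_weight b J : GT S (adjoin_pairs J) -> R) /\
  (\int[P n]_w (mgf_weight b J w)%:E <=
    P n [set w | I1 N w = S] * (expR (s * (size J)%:R))%:E)%E.
  apply: IH => // j => [jJ|jJ|w jJ|w jJ].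
  - by apply: hJ; rewrite inE jJ orbT.
  - by apply: mb; rewrite inE jJ orbT.
  - by apply: b2; rewrite inE jJ orbT.
  - by apply: bs; rewrite inE jJ orbT.
have j0in : j0 \in j0 :: J by rewrite inE eqxx.
have [j0i nD0] := hJ _ j0in.
have ij0 : i != j0 by rewrite eq_sym.
set p0 := opair i j0.
have resE w : mgf_weight b (j0 :: J) w = mgf_weight b J w *
    expR (b j0 w * ((eps N p0.1 p0.2 w <= link_index w i j0)%R%:R - Lambda (link_index w i j0))).
  rewrite /mgf_weight big_cons expRD Y_threshold // Lambda_nE -!mulrA; congr (_ * _).
  by rewrite mulrC.
have sub p : adjoin_pairs J p -> adjoin_pairs (j0 :: J) p.
  by rewrite /adjoin_pairs /= => /orP[->//|->]; rewrite !orbT.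
have mb0 D' : (forall p, D p -> D' p) -> measurable_fun setT (b j0 : GT S D' -> R).
  by move=> DD; apply: (measurable_split_sub DD); exact: mb.
have mLam D' : measurable_fun setT ((fun w => Lambda (link_index w i j0)) : GT S D' -> R).
  apply: (measurableT_comp (continuous_measurable_fun continuous_Lambda)).
  exact: measurable_link_index.
split.
  have -> : mgf_weight b (j0 :: J) = (fun w => mgf_weight b J w *
    expR (b j0 w * ((eps N p0.1 p0.2 w <= link_index w i j0)%R%:R -
      Lambda (link_index w i j0)))) by apply/funext => w; exact: resE.
  apply: measurable_funM; first exact: (measurable_split_sub sub).
  apply: measurableT_comp => //; apply: measurable_funM.
    by apply: mb0 => p Dp; rewrite /adjoin_pairs Dp.
  apply: measurable_funB => //.
  have me : measurable_fun setT (eps N p0.1 p0.2 : GT S (adjoin_pairs (j0 :: J)) -> R).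
    move=> _ B mB; rewrite setTI; apply: sub_sigma_algebra.
    by apply: split_pi_eps => //; rewrite /adjoin_pairs /= j0i eqxx orbT.
  rewrite (_ : (fun w => _) = (fun w => if (eps N p0.1 p0.2 w <= link_index w i j0)%R then 1 else 0)); last first.
    by apply/funext => w; case: ifP.
  apply: measurable_fun_ifT => //.
  by apply: measurable_fun_ler => //; exact: measurable_link_index.
under eq_integral do rewrite resE.
have pp0 : pairs_of p0 by exact: opair_pairs.
have nDJ : ~~ adjoin_pairs J p0.
  rewrite /adjoin_pairs negb_or nD0 /=; apply/hasPn => j jJ; rewrite negb_and negbK.
  apply/orP; right; apply/eqP => /opair_inj e; by rewrite e jJ in j0J.
have meps := measurable_eps hD pp0.
pose X1 : {mfun T n >-> measurableTypeR R} :=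
  HB.pack (eps N p0.1 p0.2) (isMeasurableFun.Build _ _ _ (measurableTypeR R) _ meps).
have mid : measurable_fun setT ((fun w => w) : T n -> GT S (adjoin_pairs J)).
  move=> _ B mB; rewrite setTI.
  by apply: (sigma_sub_measurable (split_pi_measurable hD hS (@adjoin_pairsP J))) mB.
pose X2 : {mfun T n >-> GT S (adjoin_pairs J)} :=
  HB.pack (fun w : T n => w : GT S (adjoin_pairs J)) (isMeasurableFun.Build _ _ _ _ _ mid).
have X12 A B : measurable A -> measurable B ->
  P n (X1 @^-1` A `&` X2 @^-1` B) = (P n (X1 @^-1` A) * P n (X2 @^-1` B))%E.
  move=> mA mB; rewrite setIC muleC.
  apply: (@indep_sigma_of_pi _ _ _ (P n) (split_pi N S (adjoin_pairs J))) => //.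
  - exact: (split_pi_measurable hD hS (@adjoin_pairsP J)).
  - exact: split_pi_setI.
  - exact: split_pi_setT.
  - move=> A' C' hA' mC'; exact: (indep_split_eps hD hS (@adjoin_pairsP J) pp0 nDJ hA' mC').
have F01 (t : R) : 0 <= Lambda t <= 1 by rewrite (ltW (Lambda_gt0 t)) (ltW (Lambda_lt1 t)).
have mF := continuous_measurable_fun continuous_Lambda.
have X1F (t : R) : P n [set w | (X1 w : R) <= t] = (Lambda t)%:E.
  exact: (eps_logistic hD).
have mq := @measurable_link_index S (adjoin_pairs J) i j0 ij0.
have mbJ : measurable_fun setT (b j0 : GT S (adjoin_pairs J) -> R).
  by apply: mb0 => p Dp; rewrite /adjoin_pairs Dp.
have H0 w : 0 <= mgf_weight b J w.
  by rewrite mulr_ge0 ?expR_ge0 // indicE.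
have bs' w : 2 * Lambda (link_index w i j0) * b j0 w ^+ 2 <= s.
  by rewrite -Lambda_nE; exact: bs.
have step := integral_mgf_step X12 F01 mF X1F mq mH mbJ H0 (fun w => b2 _ w j0in) bs'.
apply: le_trans step _.
apply: le_trans (lee_wpmul2l _ iH) _; first by rewrite lee_fin expR_ge0.
rewrite muleCA -EFinM -expRD lee_wpmul2l // lee_fin ler_expR.
by rewrite -natr1 mulrDr mulr1 addrC.
Qed.

End Chernoff.

(** * Events of probability approaching one *)

Section Wpa1.
Context {R : realType} {dT : nat -> measure_display}
  {T : forall n, measurableType (dT n)}.
Variable P : forall n, probability (T n) R.
Implicit Types E F : forall n, T n -> Prop.

Lemma wpa1_of_bad E (B : forall n, set (T n)) (r : nat -> R) :
  (\forall n \near \oo, [/\ measurable (B n), (P n (B n) <= (r n)%:E)%E &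
     forall w, ~ B n w -> E n w]) ->
  r @ \oo --> 0 -> wpa1 P E.
Proof.
move=> hB r0.
pose Q n := [/\ measurable (B n), (P n (B n) <= (r n)%:E)%E & forall w, ~ B n w -> E n w].
(* The witness sets must be measurable for every [n], while [B n] is controlled only for large [n];
   the empty set is the default. *)
exists (fun n => if `[< Q n >] then ~` B n else set0); split.
- by move=> n; case: asboolP => [[mB _ _]|_]; [exact: measurableC | exact: measurable0].
- by move=> n; case: asboolP => [[_ _ h]|_] w //= /h.
apply: (@squeeze_cvge _ _ _ _ (fun n => (1 - r n)%:E) _ (fun=> 1%E)); last 2 first.
- apply: cvg_EFin; first by near=> n.
  rewrite -[X in _ --> X]subr0; apply: cvgB r0; exact: cvg_cst.
- exact: cvg_cst.
near=> n.
have hn : Q n by near: n.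
rewrite asboolT //; have [mB Bn _] := hn.
rewrite probability_le1 ?andbT; last exact: measurableC.
by rewrite probability_setC // EFinB leeB.
Unshelve. all: by end_near. Qed.

Lemma wpa1_mono E F : wpa1 P E ->
  (\forall n \near \oo, forall w, E n w -> F n w) -> wpa1 P F.
Proof.
move=> [A [mA AE PA]] EF.
pose Q n := forall w, E n w -> F n w.
exists (fun n => if `[< Q n >] then A n else set0); split.
- by move=> n; case: asboolP => [_|_]; [exact: mA | exact: measurable0].
- by move=> n; case: asboolP => [h|_] w //= /AE /= /h.
apply: cvg_trans PA; apply: near_eq_cvg; near=> n.
by rewrite asboolT //; near: n.
Unshelve. all: by end_near. Qed.

Lemma wpa1_and E F : wpa1 P E -> wpa1 P F -> wpa1 P (fun n w => E n w /\ F n w).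
Proof.
move=> [A [mA AE PA]] [B [mB BF PB]].
exists (fun n => A n `&` B n); split.
- by move=> n; exact: measurableI.
- by move=> n w [/AE ? /BF].
have fP n (C : set (T n)) : P n C \is a fin_num -> P n C = (fine (P n C))%:E.
  by move=> h; rewrite fineK.
apply: (@squeeze_cvge _ _ _ _ (fun n => (P n (A n) + P n (B n) - 1)%E) _ (fun=> 1%E)); last 2 first.
- rewrite [X in _ --> X](_ : _ = (1 + 1 - 1)%E); last by rewrite addeK.
  apply: cvgeB => //; last exact: cvg_cst.
  by apply: cvgeD.
- exact: cvg_cst.
near=> n; rewrite probability_le1 ?andbT; last exact: measurableI.
have : (P n (~` (A n `&` B n)) <= P n (~` A n) + P n (~` B n))%E.
  by rewrite setCI; apply: measureU2; exact: measurableC.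
rewrite !probability_setC //; last exact: measurableI.
have fA : P n (A n) \is a fin_num by exact: fin_num_measure.
have fB : P n (B n) \is a fin_num by exact: fin_num_measure.
have fI : P n (A n `&` B n) \is a fin_num.
  by apply: fin_num_measure; exact: measurableI.
rewrite (fP _ _ fA) (fP _ _ fB) (fP _ _ fI) -!EFinB -!EFinD !lee_fin; lra.
Unshelve. all: by end_near. Qed.

Lemma wpa1_near E : (\forall n \near \oo, forall w, E n w) -> wpa1 P E.
Proof.
move=> h; apply: (@wpa1_of_bad _ (fun=> set0) (fun=> 0)); last exact: cvg_cst.
near=> n; split => //; first by rewrite measure0.
by move=> w _; move: w; near: n.
Unshelve. all: by end_near. Qed.

Lemma wpa1_ae E : (\forall n \near \oo, {ae P n, forall w, E n w}) -> wpa1 P E.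
Proof.
move=> h.
pose Q n (B : set (T n)) := [/\ measurable B, P n B = 0%E & forall w, ~ B w -> E n w].
have hQ n : {ae P n, forall w, E n w} -> exists B, Q n B.
  move=> [B [mB PB EB]]; exists B; split => // w nBw.
  by apply: contrapT => nE; apply: nBw; exact: EB.
apply: (@wpa1_of_bad _ (fun n => xget set0 (Q n)) (fun=> 0)); last exact: cvg_cst.
near=> n.
have /hQ[B0 hB0] : {ae P n, forall w, E n w} by near: n.
have [mB PB hB] : Q n (xget set0 (Q n)) by apply: (xgetPex _ (ex_intro _ B0 hB0)).
by split => //; rewrite PB.
Unshelve. all: by end_near. Qed.

Lemma wpa1_forall_fin (I : finType) (E : I -> forall n, T n -> Prop) :
  (forall i, wpa1 P (E i)) -> wpa1 P (fun n w => forall i, E i n w).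
Proof.
move=> h.
suff H (s : seq I) : wpa1 P (fun n w => forall i, i \in s -> E i n w).
  apply: wpa1_mono (H (enum I)) _; apply: nearW => n w hw i.
  by apply: hw; rewrite mem_enum.
elim: s => [|i s IH]; first exact: wpa1_near (nearW _ _).
apply: wpa1_mono (wpa1_and (h i) IH) _; apply: nearW => n w [h1 h2] j.
by rewrite inE => /orP[/eqP -> //|]; exact: h2.
Qed.

End Wpa1.

Lemma probability_bigsetU_le {d} {T : measurableType d} {R : realType}
    (P : probability T R) (I : Type) (s : seq I) (Q : pred I) (F : I -> set T) (f : I -> R) :
  (forall i, Q i -> measurable (F i)) -> (forall i, Q i -> (P (F i) <= (f i)%:E)%E) ->
  measurable (\big[setU/set0]_(i <- s | Q i) F i) /\
  (P (\big[setU/set0]_(i <- s | Q i) F i) <= (\sum_(i <- s | Q i) f i)%:E)%E.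
Proof.
move=> mF PF; elim: s => [|i s [IH1 IH2]].
  by rewrite !big_nil measure0.
rewrite !big_cons; case: ifP => // Qi; split; first by apply: measurableU => //; exact: mF.
apply: le_trans (measureU2 _ _ _) _ => //; first exact: mF.
by rewrite EFinD; apply: leeD => //; exact: PF.
Qed.

Section Noise.
Context {R : realType} {c : constants R}.
Context {dT : nat -> measure_display} {T : forall n, measurableType (dT n)}.
Variable P : forall n, probability (T n) R.
Context {dX dE : measure_display}.
Context {EX : measurableType dX} {EE : measurableType dE}.
Variable N : network c T EX EE.
Hypotheses (hD : DGP P N) (hS : random_split P N).

Local Notation GT n S D := (g_sigma_algebraType (@split_pi R c dT T dX dE EX EE N n S D)).

(** Markov's inequality for the exponential weight at parameter [lam]. Because of the indicator, its
    superlevel set is exactly the bad event inside {I1 = S}. *)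
Lemma tail_bound_pos n (S : {set 'I_n}) (D : pred ('I_n * 'I_n)) (i : 'I_n)
    (J : seq 'I_n) (a : 'I_n -> T n -> R) (s lam t : R) :
  (forall l, (Theta N n l)^T = Theta N n l) ->
  (forall p, D p -> pairs_of p) -> 0 < lam ->
  uniq J -> (forall j, j \in J -> j != i /\ ~~ D (opair i j)) ->
  (forall j, j \in J -> measurable_fun setT (a j : GT n S D -> R)) ->
  (forall j w, j \in J -> `|lam * a j w| <= 2^-1) ->
  (forall j w, j \in J -> 2 * Lambda_n N w i j * (lam * a j w) ^+ 2 <= s) ->
  let B := [set w | I1 N w = S] `&`
    [set w | t < \sum_(j <- J) a j w * (Y N w i j - Lambda_n N w i j)] in
  measurable B /\
  (P n B <= P n [set w | I1 N w = S] * (expR (s * (size J)%:R - lam * t))%:E)%E.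
Proof.
move=> sT DP l0 uJ hJ ma a2 as_ B.
have mb j : j \in J -> measurable_fun setT ((fun w => lam * a j w) : GT n S D -> R).
  by move=> jJ; apply: measurable_funM => //; exact: ma.
have [] := mgf_bound hD hS sT DP uJ hJ mb a2 as_.
set h := (X in measurable_fun _ X) => mh ih.
have {}mh : measurable_fun setT (h : T n -> R).
  move=> _ C mC.
  apply: (sigma_sub_measurable (split_pi_measurable hD hS _)) (mh measurableT C mC).
  exact: adjoin_pairsP.
have hE w : h w = if I1 N w == S then
    expR (lam * \sum_(j <- J) a j w * (Y N w i j - Lambda_n N w i j)) else 0.
  rewrite /h /mgf_weight indicE; case: eqP => [e|e].
    rewrite mem_set // mul1r mulr_sumr; congr expR.
    by apply: eq_bigr => j _; rewrite mulrA.
  by rewrite memNset // mul0r.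
have BE : B = h @^-1` `]expR (lam * t), +oo[%classic.
  apply/seteqP; split => w /=; rewrite in_itv /= andbT hE.
    by move=> [-> tw]; rewrite eqxx ltr_expR ltr_pM2l.
  case: eqP => [e|_]; first by rewrite ltr_expR ltr_pM2l.
  by rewrite ltNge expR_ge0.
have mB : measurable B by rewrite BE -[X in measurable X]setTI; exact: mh.
split => //.
have E0 : 0 < expR (lam * t) by exact: expR_gt0.
have : ((expR (lam * t))%:E * P n B <= \int[P n]_w (h w)%:E)%E.
  rewrite -(setIT B) -integral_indic // -ge0_integralZl ?lee_fin ?expR_ge0 //; last first.
    by apply/measurable_EFinP; exact: measurable_indic.
  apply: ge0_le_integral => //.
  - by apply: measurable_funeM; apply/measurable_EFinP; exact: measurable_indic.
  - exact/measurable_EFinP.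
  move=> w _; rewrite -EFinM lee_fin indicE.
  case: (boolP (w \in B)) => [|_]; last by rewrite mulr0 hE; case: ifP => // _; exact: expR_ge0.
  by rewrite inE mulr1 BE /= in_itv /= andbT => /ltW.
move=> /le_trans/(_ ih).
have fB : P n B \is a fin_num by exact: fin_num_measure.
have fI : P n [set w | I1 N w = S] \is a fin_num.
  by apply: fin_num_measure; have [k [_ _ h1 _ _]] := hS n; exact: h1.
rewrite -(fineK fB) -(fineK fI) -!EFinM !lee_fin expRD expRN.
by rewrite mulrA ler_pdivlMr // mulrC.
Qed.

Lemma tail_bound n (S : {set 'I_n}) (D : pred ('I_n * 'I_n)) (i : 'I_n)
    (J : seq 'I_n) (a : 'I_n -> T n -> R) (s lam t : R) :
  (forall l, (Theta N n l)^T = Theta N n l) ->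
  (forall p, D p -> pairs_of p) -> 0 < lam ->
  uniq J -> (forall j, j \in J -> j != i /\ ~~ D (opair i j)) ->
  (forall j, j \in J -> measurable_fun setT (a j : GT n S D -> R)) ->
  (forall j w, j \in J -> `|lam * a j w| <= 2^-1) ->
  (forall j w, j \in J -> 2 * Lambda_n N w i j * (lam * a j w) ^+ 2 <= s) ->
  let B := [set w | I1 N w = S] `&`
    [set w | t < `|\sum_(j <- J) a j w * (Y N w i j - Lambda_n N w i j)|] in
  measurable B /\
  (P n B <= P n [set w | I1 N w = S] * (2 * expR (s * (size J)%:R - lam * t))%:E)%E.
Proof.
move=> sT DP lam0 uJ hJ ma a2 as_ B.
have [m1 p1] := tail_bound_pos t sT DP lam0 uJ hJ ma a2 as_.
have [||| m2 p2] := @tail_bound_pos n S D i J (fun j w => - a j w) s lam t sT DP lam0 uJ hJ.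
- by move=> j jJ; apply: measurableT_comp => //; exact: ma.
- by move=> j w jJ; rewrite mulrN normrN; exact: a2.
- by move=> j w jJ; rewrite mulrN sqrrN; exact: as_.
have -> : B = ([set w | I1 N w = S] `&`
    [set w | t < \sum_(j <- J) a j w * (Y N w i j - Lambda_n N w i j)]) `|`
  ([set w | I1 N w = S] `&`
    [set w | t < \sum_(j <- J) - a j w * (Y N w i j - Lambda_n N w i j)]).
  rewrite -setIUr; congr (_ `&` _); apply/seteqP; split => w /=.
    under [X in _ \/ _ < X]eq_bigr do rewrite mulNr.
    by rewrite sumrN lter_normr => /orP.
  under [X in _ \/ _ < X]eq_bigr do rewrite mulNr.
  by rewrite sumrN lter_normr => /orP.
split; first exact: measurableU.
apply: le_trans (measureU2 _ _ _) _ => //; apply: le_trans (leeD p1 p2) _.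
have fI : P n [set w | I1 N w = S] \is a fin_num.
  by apply: fin_num_measure; have [k [_ _ h1 _ _]] := hS n; exact: h1.
by rewrite -(fineK fI) -!EFinM -EFinD lee_fin; lra.
Qed.

Lemma sum_prob_I1 n : \sum_(S : {set 'I_n}) fine (P n [set w | I1 N w = S]) = 1.
Proof.
have [n1 [hn h1 h2 h3 _]] := hS n.
have -> : \sum_(S : {set 'I_n}) fine (P n [set w | I1 N w = S]) =
    \sum_(S : {set 'I_n} | #|S| == n1) 'C(n, n1)%:R^-1.
  rewrite [RHS]big_mkcond; apply: eq_bigr => S _; case: eqP => [/h3 ->//|e].
  rewrite (_ : [set w | _] = set0) ?measure0 //.
  by apply/seteqP; split => w //= e'; apply: e; rewrite -e'.
rewrite sumr_const.
have -> : #|[pred S : {set 'I_n} | #|S| == n1]| = 'C(n, n1).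
  by rewrite -[in RHS](card_ord n) -card_draws; apply: eq_card => S; rewrite !inE.
rewrite -[LHS]mulr_natr mulVf // pnatr_eq0 -lt0n bin_gt0.
case/andP: hn => _; rewrite uphalf_half => h; apply: leq_trans h _.
rewrite -[leqRHS]odd_double_half -addnn; case: (odd n) => /=; lia.
Qed.

(* [a n S i k j] is the weight of the pair (i, j) in the k-th linear statistic
   attached to the node i when the split is S. *)
Lemma noise_wpa1 (I : finType) (B cb : R)
    (a : forall n, {set 'I_n} -> 'I_n -> I -> 'I_n -> T n -> R)
    (D : forall n, {set 'I_n} -> pred ('I_n * 'I_n))
    (valid : forall n, {set 'I_n} -> pred 'I_n) :
  0 < B -> 0 <= cb -> (forall n, 0 < zeta N n) ->
  (\forall n \near \oo, forall l, (Theta N n l)^T = Theta N n l) ->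
  (\forall n \near \oo, Num.sqrt (log_rate N n) <= 2^-1) ->
  (forall n S p, D n S p -> pairs_of p) ->
  (forall n S i j, valid n S i -> j \notin S -> j != i -> ~~ D n S (opair i j)) ->
  (forall n S i k j, valid n S i -> j \notin S -> j != i ->
     measurable_fun setT (a n S i k j : GT n S (D n S) -> R)) ->
  (forall n S i k j w, `|a n S i k j w| <= B) ->
  (forall n S i k j w, a n S i k j w != 0 -> Lambda_n N w i j <= cb * zeta N n) ->
  wpa1 P (fun n w => forall i k, valid n (I1 N w) i ->
    `|\sum_(j in I2 N w | j != i)
        a n (I1 N w) i k j w * (Y N w i j - Lambda_n N w i j)| <=
    B * (2 * cb + 2) * (n%:R * zeta N n * Num.sqrt (log_rate N n))).
Proof.
move=> B0 cb0 z0 sT hrho DP hDv ma aB aL.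
pose t n := B * (2 * cb + 2) * (n%:R * zeta N n * Num.sqrt (log_rate N n)).
pose J n (S : {set 'I_n}) i := [seq j <- enum 'I_n | (j \in ~: S) && (j != i)].
have JE n (S : {set 'I_n}) i (F : 'I_n -> R) :
    \sum_(j in ~: S | j != i) F j = \sum_(j <- J n S i) F j.
  by rewrite big_filter big_enum_cond /=; apply: eq_bigl => j; rewrite inE.
pose bad n (S : {set 'I_n}) i k := [set w | I1 N w = S] `&`
  [set w | t n < `|\sum_(j <- J n S i) a n S i k j w * (Y N w i j - Lambda_n N w i j)|].
pose BB n := \big[setU/set0]_(x : ({set 'I_n} * 'I_n * I)%type | valid n x.1.1 x.1.2)
   bad n x.1.1 x.1.2 x.2.
apply: (@wpa1_of_bad _ _ _ _ _ BB (fun n => (2 * #|I|%:R) * n%:R^-1)); last first.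
  rewrite -[X in _ --> X](mulr0 (2 * #|I|%:R)); apply: cvgMr.
  rewrite -cvg_shiftS; exact: cvg_harmonic.
near=> n.
have sTn : forall l, (Theta N n l)^T = Theta N n l by near: n.
have rhon : Num.sqrt (log_rate N n) <= 2^-1 by near: n.
have n2 : (2 <= n)%N by near: n; exists 2%N.
have n0 : 0 < n%:R :> R by rewrite ltr0n; lia.
have ln0 : 0 < ln n%:R :> R by rewrite ln_gt0 // ltr1n.
set rho := Num.sqrt (log_rate N n) in rhon *.
have lr0 : 0 < log_rate N n by rewrite divr_gt0 // mulr_gt0.
have rho0 : 0 < rho by rewrite sqrtr_gt0.
have rho2 : rho ^+ 2 * (n%:R * zeta N n) = ln n%:R.
  rewrite sqr_sqrtr; last exact: ltW.
  by rewrite /log_rate mulfVK // gt_eqF // mulr_gt0.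
have badP (x : ({set 'I_n} * 'I_n * I)%type) : valid n x.1.1 x.1.2 ->
    measurable (bad n x.1.1 x.1.2 x.2) /\
    (P n (bad n x.1.1 x.1.2 x.2) <=
     (fine (P n [set w | I1 N w = x.1.1]) * (2 * n%:R ^- 2))%:E)%E.
  case: x => [[S i] k] /= vi.
  have rB0 : 0 <= rho / B by rewrite divr_ge0 // ltW.
  have aB2 w j : `|rho / B * a n S i k j w| <= rho.
    rewrite normrM (ger0_norm rB0) mulrAC ler_pdivrMr //.
    by rewrite ler_wpM2l // ltW.
  (* With [lam = rho / B] and [rho ^+ 2 * (n * zeta) = ln n], the quadratic term is at most
     [2 cb ln n] while [lam * t n = (2 cb + 2) ln n]. What remains is [2 n^-2]. *)
  have [|||||| mB pB] := @tail_bound n S (D n S) i (J n S i) (a n S i k)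
     (2 * cb * zeta N n * rho ^+ 2) (rho / B) (t n) sTn (DP n S).
  - exact: divr_gt0.
  - by rewrite filter_uniq // enum_uniq.
  - move=> j; rewrite mem_filter inE => /andP[/andP[jS ji] _]; split => //.
    exact: hDv.
  - move=> j; rewrite mem_filter inE => /andP[/andP[jS ji] _]; exact: ma.
  - by move=> j w _; apply: le_trans (aB2 _ _) _.
  (* The bound on [Lambda_n] is available only where the weight is nonzero; elsewhere the left side
     vanishes. *)
  - move=> j w _; have [->|aj] := eqVneq (a n S i k j w) 0.
      by rewrite mulr0 expr0n mulr0 !mulr_ge0 ?sqr_ge0 //; exact: ltW.
    have L0 := Lambda_gt0 (link_index N w i j); rewrite -Lambda_nE in L0.
    apply: ler_pM; [by rewrite mulr_ge0 // ltW | exact: sqr_ge0 | |].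
      by rewrite -[leRHS]mulrA ler_pM2l //; exact: aL aj.
    rewrite -(real_normK (num_real (_ * a _ _ _ _ _ _))) lerXn2r ?nnegrE //; exact: ltW.
  split => //; apply: le_trans pB _.
  have fI : P n [set w | I1 N w = S] \is a fin_num.
    by apply: fin_num_measure; have [q [_ _ h1 _ _]] := hS n; exact: h1.
  rewrite -{1}(fineK fI) -EFinM lee_fin ler_wpM2l ?fine_ge0 // ler_wpM2l //.
  rewrite -[X in _ <= X^-1]lnK; last by rewrite posrE exprn_gt0.
  rewrite -expRN ler_expR lnXn //.
  have sJ : (size (J n S i))%:R <= n%:R :> R.
    rewrite ler_nat size_filter; apply: leq_trans (count_size _ _) _.
    by rewrite size_enum_ord.
  have h1 : 2 * cb * zeta N n * rho ^+ 2 * (size (J n S i))%:R <= 2 * cb * ln n%:R.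
    have hz : zeta N n * (size (J n S i))%:R <= zeta N n * n%:R by rewrite ler_wpM2l // ltW.
    have hc : 0 <= 2 * cb * rho ^+ 2.
      by apply: mulr_ge0; [exact: mulr_ge0 | exact: sqr_ge0].
    by have := ler_wpM2l hc hz; rewrite -rho2; nra.
  have h2 : rho / B * t n = (2 * cb + 2) * ln n%:R.
    rewrite -rho2 /t -/rho; field; exact: lt0r_neq0.
  by rewrite h2 mulr2n; lra.
have [mBB pBB] := @probability_bigsetU_le _ _ _ (P n) _ (index_enum _) _ _ _ (fun x vx => (badP x vx).1)
   (fun x vx => (badP x vx).2).
split => //.
- apply: le_trans pBB _; rewrite lee_fin.
  apply: (@le_trans _ _ (\sum_(x : ({set 'I_n} * 'I_n * I)%type)
      fine (P n [set w | I1 N w = x.1.1]) * (2 * n%:R ^- 2))).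
    rewrite [leLHS]big_mkcond; apply: ler_sum => x _; case: ifP => // _.
    by rewrite mulr_ge0 ?fine_ge0 // mulr_ge0 // invr_ge0 exprn_ge0 // ltW.
  rewrite -mulr_suml.
  (* The probabilities of the splits sum to 1, so only [n * #|I|] events are paid for, against a
     tail of order [n^-2]. *)
  have -> : \sum_(x : ({set 'I_n} * 'I_n * I)%type) fine (P n [set w | I1 N w = x.1.1]) =
     (n * #|I|)%:R.
    rewrite -(pair_bigA _ (fun (y : ({set 'I_n} * 'I_n)%type) (k : I) =>
       fine (P n [set w | I1 N w = y.1]))) /=.
    under eq_bigr do rewrite sumr_const.
    rewrite -(pair_bigA _ (fun (S : {set 'I_n}) (k : 'I_n) =>
       fine (P n [set w | I1 N w = S]) *+ #|I|)) /=.
    under eq_bigr do rewrite sumr_const card_ord -mulrnA -mulr_natr.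
    by rewrite -mulr_suml sum_prob_I1 mul1r mulnC.
  rewrite natrM le_eqVlt; apply/orP; left; apply/eqP; field.
  exact: lt0r_neq0.
move=> w nBB i k vi; rewrite leNgt; apply/negP => h; apply: nBB.
rewrite /BB -bigcup_seq_cond /=; exists (I1 N w, i, k) => /=.
  by rewrite mem_index_enum.
by split => //=; rewrite /= -JE.
Unshelve. all: by end_near. Qed.

End Noise.

(** * Transfer of an event from one half of the split to the other *)

Lemma double_count (A B : finType) (QA : pred A) (QB : pred B) (r : A -> B -> bool) k :
  (0 < k)%N -> (forall x, QA x -> #|[pred y | r x y]| = k) ->
  (forall y, QB y -> #|[pred x | QA x && r x y]| <= k)%N ->
  (forall x y, QA x -> r x y -> QB y) ->
  (#|[pred x | QA x]| <= #|[pred y | QB y]|)%N.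
Proof.
move=> k0 hA hB hAB; rewrite -(leq_pmul2r k0).
have -> : (#|[pred x | QA x]| * k = \sum_(x | QA x) \sum_(y | QB y) r x y)%N.
  rewrite -sum_nat_const; apply: eq_bigr => x Qx; rewrite -(hA x Qx) -sum1_card.
  rewrite big_mkcond [RHS]big_mkcond; apply: eq_bigr => y _; rewrite inE /=.
  by case: (boolP (r x y)) => [/(hAB x y Qx) -> //|_]; case: ifP.
rewrite exchange_big -sum_nat_const; apply: leq_sum => y Qy.
apply: leq_trans (hB y Qy); rewrite -sum1_card big_mkcond [leqRHS]big_mkcond.
by apply: leq_sum => x _; rewrite inE; case: ifP => // ->; case: ifP; case: (r x y).
Qed.

(** When [a + b = n], inclusion between subsets of sizes [a] and [b] is biregular with equal
    degrees: 'C(a, b) on both sides if [b <= a], 'C(b, a) otherwise. Double counting therefore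
    compares the two families without loss. *)
Lemma count_subset_transfer n (a b : nat) (Q Q' : pred {set 'I_n}) :
  (a + b = n)%N ->
  (forall S T : {set 'I_n}, #|S| = a -> #|T| = b -> (S \subset T) || (T \subset S) ->
     Q' S -> Q T) ->
  (#|[pred S : {set 'I_n} | (#|S| == a) && Q' S]| <=
   #|[pred T : {set 'I_n} | (#|T| == b) && Q T]|)%N.
Proof.
move=> abn h.
have cC (S : {set 'I_n}) : #|~: S| = (n - #|S|)%N.
  by rewrite cardsCs finset.setCK card_ord.
have sup (T : {set 'I_n}) k : #|[pred S : {set 'I_n} | (T \subset S) && (#|S| == (n - k)%N)]|
     = 'C(n - #|T|, k) \/ (n < k)%N.
  have [kn|] := leqP k n; [left | by right].
  rewrite -cC -cards_draws -(card_imset _ (@finset.setC_inj _)).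
  apply: eq_card => S; rewrite !inE; apply/andP/imsetP => [[TS /eqP cS]|[S' + ->]].
    exists (~: S); last by rewrite finset.setCK.
    by rewrite inE finset.setCS TS cC cS subKn /=.
  rewrite inE => /andP[S'T /eqP cS']; rewrite -finset.setCS finset.setCK S'T cC cS'.
  by [].
have [ba|ab] := leqP b a.
  apply: (@double_count {set 'I_n} {set 'I_n} (fun S => (#|S| == a) && Q' S) (fun T => (#|T| == b) && Q T)
    (fun S T => (T \subset S) && (#|T| == b)) 'C(a, b)).
  - by rewrite bin_gt0.
  - move=> S /andP[/eqP <- _]; rewrite -cards_draws -cardsE.
    by apply: eq_card => T; rewrite !inE.
  - move=> T /andP[/eqP cT _].
    have [E|] := sup T b; last lia.
    have nba : (n - b = a)%N by lia.
    rewrite cT nba in E.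
    rewrite -E; apply: subset_leq_card; apply/fintype.subsetP => S; rewrite !inE.
    by move=> /andP[/andP[-> _]] /andP[-> _].
  - by move=> S T /andP[/eqP cS QS] /andP[TS /eqP cT]; rewrite cT eqxx (h S T) // TS orbT.
apply: (@double_count {set 'I_n} {set 'I_n} (fun S => (#|S| == a) && Q' S) (fun T => (#|T| == b) && Q T)
  (fun S T => (S \subset T) && (#|T| == b)) 'C(b, a)).
- by rewrite bin_gt0 ltnW.
- move=> S /andP[/eqP cS _].
  have [E|] := sup S a; last lia.
  have nab : (n - a = b)%N by lia.
  by rewrite cS nab in E.
- move=> T /andP[/eqP cT _]; rewrite -cT -cards_draws -cardsE.
  apply: subset_leq_card; apply/fintype.subsetP => S; rewrite !inE.
  by move=> /andP[/andP[-> _]] /andP[-> _].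
- by move=> S T /andP[/eqP cS QS] /andP[ST /eqP cT]; rewrite cT eqxx (h S T) // ST.
Qed.

Section SplitTransfer.
Context {R : realType} {c : constants R}.
Context {dT : nat -> measure_display} {T : forall n, measurableType (dT n)}.
Variable P : forall n, probability (T n) R.
Context {dX dE : measure_display}.
Context {EX : measurableType dX} {EE : measurableType dE}.
Variable N : network c T EX EE.
Hypothesis hS : random_split P N.

Lemma prob_I1_le n n1 (Q : pred {set 'I_n}) :
  (forall w : T n, #|I1 N w| = n1) ->
  (forall S : {set 'I_n}, measurable [set w : T n | I1 N w = S]) ->
  (forall S : {set 'I_n}, #|S| = n1 ->
        P n [set w | I1 N w = S] = ('C(n, n1)%:R^-1)%:E) ->
  measurable [set w : T n | Q (I1 N w)] /\
  (P n [set w | Q (I1 N w)] <=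
    (#|[pred S : {set 'I_n} | (#|S| == n1) && Q S]|%:R / 'C(n, n1)%:R)%:E)%E.
Proof.
move=> h1 h2 h3.
have -> : [set w : T n | Q (I1 N w)] =
   \big[setU/set0]_(S : {set 'I_n} | (#|S| == n1) && Q S) [set w | I1 N w = S].
  apply/seteqP; split => w /=.
    move=> q; rewrite -bigcup_seq_cond; exists (I1 N w) => //=.
    by rewrite mem_index_enum h1 eqxx.
  by rewrite -bigcup_seq_cond => -[S /= /andP[_ /andP[_ QS]] ->].
have h3' (S : {set 'I_n}) : (#|S| == n1) && Q S ->
    (P n [set w | I1 N w = S] <= ('C(n, n1)%:R^-1)%:E)%E.
  by move=> /andP[/eqP cS _]; rewrite h3.
have [m p] := @probability_bigsetU_le _ _ _ (P n) _ (index_enum _)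
   (fun S : {set 'I_n} => (#|S| == n1) && Q S) (fun S => [set w | I1 N w = S])
   (fun=> 'C(n, n1)%:R^-1) (fun S _ => h2 S) h3'.
split => //; apply: le_trans p _; rewrite lee_fin sumr_const.
rewrite -[leLHS]mulr_natl le_eqVlt; apply/orP; left; apply/eqP; congr (_%:R * _).
Qed.

(** [I1] and its complement are uniform over subsets whose sizes differ by at most 1. Matching the
    two sizes by inclusion shows that [Q'] fails for [I1] at most as often as [Q] fails for [I2]. *)
Lemma wpa1_split_transfer (Q Q' : forall n, {set 'I_n} -> Prop) :
  (\forall n \near \oo, forall S S' : {set 'I_n}, (#|S| + #|S'| = n)%N ->
     (#|S| <= #|S'|.+1)%N -> (#|S'| <= #|S|.+1)%N ->
     (S \subset S') || (S' \subset S) -> Q n S' -> Q' n S) ->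
  wpa1 P (fun n w => Q n (I2 N w)) -> wpa1 P (fun n w => Q' n (I1 N w)).
Proof.
move=> hQ [A [mA AQ PA]].
pose q n (S : {set 'I_n}) := `[< Q n S >].
pose q' n (S : {set 'I_n}) := `[< Q' n S >].
apply: (@wpa1_of_bad _ _ _ P _ (fun n => [set w | ~~ q' n (I1 N w)])
  (fun n => 1 - fine (P n (A n)))); last first.
  rewrite -(subrr 1); apply: cvgB; first exact: cvg_cst.
  exact: (@fine_cvg R _ _ _ _ (1 : R) PA).
near=> n.
have hQn : forall S S' : {set 'I_n}, (#|S| + #|S'| = n)%N ->
     (#|S| <= #|S'|.+1)%N -> (#|S'| <= #|S|.+1)%N ->
     (S \subset S') || (S' \subset S) -> Q n S' -> Q' n S by near: n.
have [n1 [/andP[hn hn'] h1 h2 h3 _]] := hS n.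
have n1n : (n1 <= n)%N.
  move: hn'; rewrite uphalf_half => h; apply: leq_trans h _.
  by rewrite -[leqRHS]odd_double_half -addnn; case: (odd n) => /=; lia.
have [mB pB] := prob_I1_le (predC (q' n)) h1 h2 h3.
have [mC pC] := prob_I1_le (fun S => q n (~: S)) h1 h2 h3.
split => //; last by move=> w /negP; rewrite negbK => /asboolP.
apply: le_trans pB _; rewrite lee_fin lerBrDr.
have PAq : fine (P n (A n)) <= #|[pred S : {set 'I_n} | (#|S| == n1) && q n (~: S)]|%:R / 'C(n, n1)%:R.
  rewrite -lee_fin fineK ?fin_num_measure //; apply: le_trans pC.
  apply: le_measure; rewrite ?inE //.
  by move=> w /AQ; rewrite /= => h; apply/asboolP.
apply: le_trans (lerD (lexx _) PAq) _.
rewrite -mulrDl ler_pdivrMr ?ltr0n ?bin_gt0 // mul1r -natrD ler_nat.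
(* The hypothesis in contrapositive form: a bad set of size [n1] makes every nested set of the other
   size bad. *)
have tr : (#|[pred S : {set 'I_n} | (#|S| == n1) && ~~ q' n S]| <=
    #|[pred S : {set 'I_n} | (#|S| == (n - n1)%N) && ~~ q n S]|)%N.
  apply: count_subset_transfer; first by rewrite subnKC.
  move=> S S' cS cS' sub; apply: contra => /asboolP QS'; apply/asboolP.
  apply: hQn QS' => //; rewrite cS cS' ?subnKC //; move: hn hn'; rewrite uphalf_half.
    by rewrite -{2 4}(odd_double_half n) -addnn; case: (odd n) => /=; lia.
  by rewrite -{2 4}(odd_double_half n) -addnn; case: (odd n) => /=; lia.
apply: leq_trans (leq_add tr (leqnn _)) _.
have -> : #|[pred S : {set 'I_n} | (#|S| == (n - n1)%N) && ~~ q n S]| =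
    #|[pred S : {set 'I_n} | (#|S| == n1) && ~~ q n (~: S)]|.
  rewrite -(card_imset _ (@finset.setC_inj _)); apply: eq_card => S; rewrite !inE.
  have cC (S' : {set 'I_n}) : #|~: S'| = (n - #|S'|)%N.
    by rewrite cardsCs finset.setCK card_ord.
  apply/imsetP/andP => [[S' + ->]|[/eqP cS qS]].
    by rewrite inE => /andP[/eqP cS' qS']; rewrite finset.setCK cC cS' subKn.
  by exists (~: S); rewrite ?finset.setCK // inE cC cS eqxx.
have cardC : (#|[pred S : {set 'I_n} | #|S| == n1]| <= 'C(n, n1))%N.
  rewrite -[in leqRHS](card_ord n) -card_draws; apply: subset_leq_card.
  by apply/fintype.subsetP => S; rewrite !inE.
apply: leq_trans cardC.
rewrite addnC -[leqLHS]/(#|_| + #|_|)%N.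
rewrite -[leqRHS](cardID [pred S : {set 'I_n} | q n (~: S)]) leq_add //.
by apply: subset_leq_card; apply/fintype.subsetP => S; rewrite !inE => /andP[-> ->].
Unshelve. all: by end_near. Qed.

End SplitTransfer.

(** At index [ln z + u] the odds are [z * expR u], and [z <= b^-1] bounds the denominator, so the
    variance is of exact order [z]. This is how the curvature acquires the factor zeta_n. *)
Lemma logistic_curvature {R : realType} (u z b L : R) : 0 < z -> 0 < b -> b * z <= 1 ->
  `|u| <= L ->
  expR (- L) / (1 + expR L / b) ^+ 2 * z <=
    Lambda (ln z + u) * (1 - Lambda (ln z + u)).
Proof.
move=> z0 b0 bz uL; rewrite LambdaN LambdaE expRD lnK ?posrE //.
move: uL; rewrite ler_norml => /andP[uL1 uL2].
have E1 : expR (- L) <= expR u by rewrite ler_expR.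
have E2 : expR u <= expR L by rewrite ler_expR.
have E0 := expR_gt0 (- L); have Eu := expR_gt0 u; have EL := expR_gt0 L.
have zb : z <= b^-1 by rewrite -[leRHS]mul1r ler_pdivlMr // mulrC.
have h1 : z * expR u <= expR L / b.
  by rewrite mulrC; apply: ler_pM => //; exact: ltW.
have p1 : 0 < 1 + z * expR u by rewrite addr_gt0 // mulr_gt0.
have p2 : 0 < 1 + expR L / b by rewrite addr_gt0 // divr_gt0.
have -> : z * expR u / (1 + z * expR u) / (1 + z * expR u) =
    z * expR u / (1 + z * expR u) ^+ 2 by field; exact: lt0r_neq0.
rewrite mulrAC.
apply: ler_pM; [by rewrite mulr_ge0 // ltW | by rewrite invr_ge0 exprn_ge0 // ltW | | ].
  by rewrite mulrC ler_pM2l.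
by rewrite lef_pV2 ?posrE ?exprn_gt0 // lerXn2r ?nnegrE ?(ltW p1) ?(ltW p2) // lerD2l.
Qed.

(** * Nuclear norm estimation *)

Section Step1.
Context {R : realType} {c : constants R}.
Context {dT : nat -> measure_display} {T : forall n, measurableType (dT n)}.
Context {dX dE : measure_display}.
Context {EX : measurableType dX} {EE : measurableType dE}.
Variable N : network c T EX EE.
Variables (n m : nat) (f : 'I_m -> 'I_n) (w : T n).
Implicit Type G : 'I_2 -> 'M[R]_(m, n).

Let Gs (l : 'I_2) : 'M[R]_(m, n) := rowsub f (Gamma N n l).

Definition off_sum (F : 'I_m -> 'I_n -> R) : R :=
  \sum_(k < m) \sum_(j < n | j != f k) F k j.

(** Bregman divergence of the log-partition function [ln (1 + expR x)]. *)
Definition bregman (x d : R) : R := ln (1 + expR (x + d)) - ln (1 + expR x) - Lambda x * d.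

Definition index_diff G (k : 'I_m) (j : 'I_n) : R :=
  (G l0 k j - Gs l0 k j) + W1 N w (f k) j * (G l1 k j - Gs l1 k j).

Lemma off_sumD (F F' : 'I_m -> 'I_n -> R) :
  off_sum (fun k j => F k j + F' k j) = off_sum F + off_sum F'.
Proof. by rewrite /off_sum -big_split; apply: eq_bigr => k _; rewrite big_split. Qed.

Lemma off_sumN (F : 'I_m -> 'I_n -> R) : off_sum (fun k j => - F k j) = - off_sum F.
Proof. by rewrite /off_sum -sumrN; apply: eq_bigr => k _; rewrite sumrN. Qed.

Lemma sum_I2 (F : 'I_2 -> R) : \sum_(l < 2) F l = F l0 + F l1.
Proof. by rewrite big_ord_recr big_ord1 /=; congr (F _ + F _); exact: val_inj. Qed.

Lemma ip_Upsilon l (A : 'M[R]_(m, n)) : ip (Upsilon N f w l) A =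
  off_sum (fun k j => (Y N w (f k) j - Lambda_n N w (f k) j) * W N w l (f k) j * A k j).
Proof.
apply: eq_bigr => k _; rewrite [RHS]big_mkcond /=; apply: eq_bigr => j _.
by rewrite !mxE eq_sym; case: eqP; rewrite /= ?mul0r.
Qed.

(** The logistic log-likelihood is linear in [y] minus the log-partition, so the excess loss is
    exactly a Bregman sum minus the pairing with the noise; no Taylor remainder appears. *)
Lemma npairs_Qn G : npairs n m != 0 :> R ->
  npairs n m * (Q_n N f w G - Q_n N f w Gs) =
  off_sum (fun k j => bregman (link_index N w (f k) j) (index_diff G k j))
  - \sum_(l < 2) ip (Upsilon N f w l) (G l - Gs l).
Proof.
move=> NP0.
have QE G' : npairs n m * Q_n N f w G' = off_sum (fun k j =>
    - loglik (Y N w (f k) j) (Lambda (Wdot N w (f k) j (fun l => G' l k j)))).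
  by rewrite off_sumN /Q_n mulNr mulrN mulrA divff // mul1r.
rewrite mulrBr !QE sum_I2 !ip_Upsilon -off_sumD -!off_sumN -!off_sumD.
apply: eq_bigr => k _; apply: eq_bigr => j _.
rewrite !loglik_Lambda !Wdot2 /bregman /index_diff Lambda_nE.
have -> : Gs l0 k j + W1 N w (f k) j * Gs l1 k j = link_index N w (f k) j.
  by rewrite /Gs /Gamma /link_index /= !mxE.
rewrite /W /= !mxE.
set x := link_index _ _ _ _.
have -> : G l0 k j + W1 N w (f k) j * G l1 k j = x + index_diff G k j.
  rewrite /index_diff /x /Gs /Gamma /link_index /= !mxE; ring.
rewrite /index_diff !mxE; ring.
Qed.

End Step1.

Lemma mxrank_const_le1 {R : fieldType} m n (a : R) : (\rank (const_mx a : 'M[R]_(m, n)) <= 1)%N.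
Proof.
have -> : const_mx a = (const_mx 1 : 'cV[R]_m) *m (const_mx a : 'rV[R]_n).
  by apply/matrixP => i j; rewrite !mxE big_ord1 !mxE mul1r.
exact: leq_trans (mxrankM_maxl _ _) (rank_leq_col _).
Qed.

(** Basic inequality for any candidate no worse than the truth, with index error at most [B]. It is
    used for both minimizations of Step 1; only [B] changes. The condition [ln n <= B ^+ 2] lets the
    slack of restricted strong convexity be absorbed in the final rate. *)
Lemma step1_bound {R : realType} (c : constants R) : constants_ok c ->
  exists2 C0 : R, 0 < C0 &
  forall (dT : nat -> measure_display) (T : forall n, measurableType (dT n))
    (dX dE : measure_display) (EX : measurableType dX) (EE : measurableType dE)
    (N : network c T EX EE) n m (f : 'I_m -> 'I_n) (w : T n) (B : R)
    (G : 'I_2 -> 'M[R]_(m, n)),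
  (0 < m)%N -> (m <= n)%N -> (1 < n)%N ->
  0 < zeta N n -> c_low c * zeta N n <= 1 ->
  (forall i j, `|W1 N w i j| <= M_W c) ->
  (forall l i j, `|Theta N n l i j| <= M c) ->
  (forall l, \rank (Theta N n l) = K c l) ->
  ln n%:R <= n%:R * zeta N n ->
  rsc_event N f (a_star c) w -> Upsilon_event N f w ->
  1 <= B -> ln n%:R <= B ^+ 2 ->
  (forall k j, `|index_diff N f w G k j| <= B) ->
  objective N f w G <= objective N f w (fun l => rowsub f (Gamma N n l)) ->
  \sum_(l < 2) frob (G l - rowsub f (Gamma N n l)) ^+ 2 <= C0 * (n%:R * B ^+ 2 / zeta N n).
Proof.
move=> hc.
have M0 := M_gt0 hc; have MW0 := M_W_gt0 hc; have CU0 := C_Upsilon_gt0 hc.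
have CL0 := C_lambda_gt hc; have /andP[cl0 _] := Lambda_range hc.
have CUM0 : 0 < C_Upsilon c * M_W c by rewrite mulr_gt0.
have a0 : 0 < a_star c by rewrite divr_gt0; lra.
have [k0 c20 c30] := rsc_gt0 hc a0.
set kp := kappa c (a_star c) in k0; set c2' := c2 c (a_star c) in c20.
set c3' := c3 c (a_star c) in c30.
pose L := M c * (1 + M_W c).
pose om := expR (- L) / (1 + expR L / c_low c) ^+ 2.
have om0 : 0 < om.
  by rewrite divr_gt0 ?expR_gt0 // exprn_gt0 // addr_gt0 // divr_gt0 // expR_gt0.
(* The additional 1 is the rank of the constant matrix tau_n contained in the first layer. *)
pose r := maxn (K c l0).+1 (K c l1).
pose C1 := C_lambda c + C_Upsilon c * M_W c.
have C10 : 0 < C1 by rewrite /C1; lra.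
pose C2 := 16 * C1 * Num.sqrt r%:R / om.
have C20 : 0 <= C2.
  by rewrite divr_ge0 ?(ltW om0) // !mulr_ge0 ?sqrtr_ge0 // ltW.
(* [c2'] answers the first alternative of restricted strong convexity. In the second, [c3'] is its
   slack, [(c_low c)^-1] pays for the diagonal and [C2 ^+ 2 / kp] comes from completing the
   square. *)
pose C0 := c2' + 2 * (c3' + (c_low c)^-1 + C2 ^+ 2 / kp) / kp.
have ci0 : 0 < (c_low c)^-1 by rewrite invr_gt0.
have hC2k : 0 <= C2 ^+ 2 / kp by rewrite divr_ge0 ?sqr_ge0 // ltW.
exists C0.
  rewrite /C0 ltr_wpDr // divr_ge0 ?(ltW k0) // mulr_ge0 //.
  by rewrite addr_ge0 // addr_ge0 // ltW.
move=> dT T dX dE EX EE N n m f w B G m0 mn n1 z0 clz hW hT hr hln rsc ups B1 lnB hd hobj.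
set Gs := fun l => rowsub f (Gamma N n l).
pose D l := G l - Gs l.
have n0 : 0 < n%:R :> R by rewrite ltr0n (ltnW n1).
have NP0 : 0 < npairs n m :> R.
  by rewrite /npairs mulr_gt0 // ltr0n // -subn1 subn_gt0.
have ln0 : 0 < ln n%:R :> R by rewrite ln_gt0 // ltr1n.
set N0 := noise_level N n.
have B0 : 0 < B by exact: lt_le_trans B1.
have N00 : 0 < N0 by rewrite addr_gt0 // sqrtr_gt0 // mulr_gt0.
have N0le : N0 <= 2 * Num.sqrt (zeta N n * n%:R).
  by rewrite mulr2n mulrDl mul1r lerD2l ler_wsqrtr // mulrC.
pose p := \sum_(l < 2) nuclear (P_perp (Gs l) (D l)).
pose q := \sum_(l < 2) nuclear (M_part (Gs l) (D l)).
have p0 : 0 <= p by apply: sumr_ge0 => l _; exact: nuclear_ge0.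
have q0 : 0 <= q by apply: sumr_ge0 => l _; exact: nuclear_ge0.
set SB := off_sum f (fun k j => bregman (link_index N w (f k) j) (index_diff N f w G k j)).
have GD l : G l = Gs l + D l by rewrite /D addrC subrK.
have SBle : SB <= N0 * (C1 * q - (C_lambda c - C_Upsilon c * M_W c) * p).
  have := npairs_Qn N f w G (lt0r_neq0 NP0); rewrite -/SB => QE.
  have h1 : npairs n m * (Q_n N f w G - Q_n N f w Gs) <=
      C_lambda c * N0 * (\sum_(l < 2) nuclear (Gs l) - \sum_(l < 2) nuclear (G l)).
    have -> : C_lambda c * N0 = npairs n m * lambda_n N n m.
      by rewrite /lambda_n -/N0 [RHS]mulrC divfK // lt0r_neq0.
    rewrite -mulrA ler_pM2l //.
    by move: hobj; rewrite /objective -/Gs mulrBr; lra.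
  have h2 : \sum_(l < 2) nuclear (Gs l) - \sum_(l < 2) nuclear (G l) <= q - p.
    rewrite -!sumrB; apply: ler_sum => l _.
    by have := nuclear_decomposable (Gs l) (D l); rewrite -GD; lra.
  have h3 : \sum_(l < 2) ip (Upsilon N f w l) (D l) <= C_Upsilon c * M_W c * N0 * (p + q).
    rewrite -big_split mulr_sumr; apply: ler_sum => l _ /=.
    apply: le_trans (nuclear_ge_ip (D l) _ (opnorm_op_bounded (ups l))) _.
      by rewrite !mulr_ge0 // ltW.
    rewrite ler_wpM2l ?(mulr_ge0 (ltW CUM0) (ltW N00)) //.
    rewrite -[D l in leLHS](subrK (P_perp (Gs l) (D l))) addrC.
    by rewrite -/(M_part (Gs l) (D l)) nuclearD.
  have h4 : C_lambda c * N0 * (\sum_(l < 2) nuclear (Gs l) - \sum_(l < 2) nuclear (G l))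
     <= C_lambda c * N0 * (q - p).
    by rewrite ler_wpM2l // mulr_ge0 ?(ltW N00) //; lra.
  rewrite -/D in QE.
  have -> : SB = npairs n m * (Q_n N f w G - Q_n N f w Gs) +
      \sum_(l < 2) ip (Upsilon N f w l) (D l) by rewrite QE subrK.
  by rewrite /C1; lra.
have SBge : om * zeta N n / (4 * B) * off_sum f (fun k j => index_diff N f w G k j ^+ 2) <= SB.
  rewrite mulr_sumr; apply: ler_sum => k _; rewrite mulr_sumr; apply: ler_sum => j _.
  apply: le_trans (logistic_bregman _ (hd k j) B1).
  rewrite mulrAC ler_wpM2r //; first by rewrite invr_ge0 mulr_ge0 // ltW.
  rewrite ler_wpM2r ?sqr_ge0 // /link_index /tau -addrA.
  apply: logistic_curvature => //.
  apply: le_trans (ler_normD _ _) _; rewrite normrM /L mulrDr mulr1 lerD //.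
  by rewrite mulrC ler_pM.
have d20 : 0 <= off_sum f (fun k j => index_diff N f w G k j ^+ 2).
  by apply: sumr_ge0 => k _; apply: sumr_ge0 => j _; exact: sqr_ge0.
have omB : 0 < om * zeta N n / (4 * B) by apply: divr_gt0; exact: mulr_gt0.
have SB0 : 0 <= SB by apply: le_trans SBge; rewrite mulr_ge0 // ltW.
(* The Bregman sum is nonnegative, so the upper bound [SBle] already contains the cone inequality,
   with ratio [a_star]. *)
have cn : cone Gs (a_star c) D.
  rewrite /cone -/p -/q /a_star -/C1 mulrAC ler_pdivlMr; last lra.
  have := le_trans SB0 SBle; rewrite pmulr_rge0 //; lra.
set F2 := \sum_(l < 2) _.
have F2E : F2 = frob (D l0) ^+ 2 + frob (D l1) ^+ 2 by rewrite /F2 sum_I2.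
pose Z := n%:R * B ^+ 2 / zeta N n.
have Z0 : 0 <= Z by rewrite /Z divr_ge0 ?(ltW z0) // mulr_ge0 ?sqr_ge0 // ltW.
have bZ : n%:R * ln n%:R / zeta N n <= Z.
  by rewrite /Z ler_wpM2r ?invr_ge0 ?(ltW z0) // ler_wpM2l ?(ltW n0).
have qle : q <= 2 * Num.sqrt r%:R * (frob (D l0) + frob (D l1)).
  rewrite /q sum_I2 mulrDr lerD //; apply: nuclear_M_part.
  - rewrite /Gs rowsubE (leq_trans (mxrankM_maxr _ _)) // /Gamma /=.
    rewrite (leq_trans (mxrank_add _ _)) // hr.
    apply: leq_trans (leq_maxl _ _).
    exact: (leq_add (mxrank_const_le1 _ _ _) (leqnn _)).
  - rewrite /Gs rowsubE (leq_trans (mxrankM_maxr _ _)) // /Gamma /= hr.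
    exact: leq_maxr.
have offle : off_sum f (fun k j => index_diff N f w G k j ^+ 2) <=
    C2 * Num.sqrt Z * (frob (D l0) + frob (D l1)).
  rewrite -(ler_pM2l omB); apply: le_trans SBge _; apply: le_trans SBle _.
  have h1 : N0 * (C1 * q - (C_lambda c - C_Upsilon c * M_W c) * p) <= N0 * (C1 * q).
    by rewrite ler_pM2l // gerBl mulr_ge0 //; lra.
  apply: le_trans h1 _.
  have h2 : N0 * (C1 * q) <= 2 * Num.sqrt (zeta N n * n%:R) *
      (C1 * (2 * Num.sqrt r%:R * (frob (D l0) + frob (D l1)))).
    apply: ler_pM => //; [exact: ltW | by rewrite mulr_ge0 // ltW | by rewrite ler_pM2l].
  apply: le_trans h2 _.
  have sZ : Num.sqrt Z = B * Num.sqrt (zeta N n * n%:R) / zeta N n.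
    apply/eqP; rewrite -(@eqrXn2 _ 2) ?sqrtr_ge0 //; last first.
      by rewrite divr_ge0 ?(ltW z0) // mulr_ge0 ?sqrtr_ge0 // ltW.
    rewrite sqr_sqrtr // !exprMn exprVn sqr_sqrtr ?mulr_ge0 ?(ltW z0) ?(ltW n0) //.
    by rewrite /Z; apply/eqP; field; exact: lt0r_neq0.
  rewrite sZ le_eqVlt; apply/orP; left; apply/eqP; rewrite /C2; field.
  by rewrite !lt0r_neq0.
(* Restricted strong convexity involves all entries, the likelihood only those off the diagonal. The
   missing ones, one per row, cost at most [B ^+ 2] each. *)
have alld : frob (D l0 + hadamard (D l1) (rowsub f (W1 N w))) ^+ 2 <=
    off_sum f (fun k j => index_diff N f w G k j ^+ 2) + n%:R * B ^+ 2.
  rewrite frob_sqr.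
  have -> : n%:R * B ^+ 2 = \sum_(k < n) B ^+ 2.
    by rewrite sumr_const card_ord mulr_natl.
  apply: (@le_trans _ _ (off_sum f (fun k j => index_diff N f w G k j ^+ 2) + \sum_(k < m) B ^+ 2)).
    rewrite -big_split; apply: ler_sum => k _ /=.
    have E j : (D l0 + hadamard (D l1) (rowsub f (W1 N w))) k j = index_diff N f w G k j.
      by rewrite /index_diff /D !mxE mulrC.
    rewrite (bigD1 (f k)) //= addrC; apply: lerD.
      by apply: ler_sum => j _; rewrite E expr2.
    by rewrite E -expr2 -real_normK ?num_real // lerXn2r ?nnegrE //; lra.
  rewrite lerD2l !sumr_const !card_ord ler_wpMn2l ?sqr_ge0 //.
have nBZ : n%:R * B ^+ 2 <= (c_low c)^-1 * Z.
  have -> : (c_low c)^-1 * Z = n%:R * B ^+ 2 / (c_low c * zeta N n).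
    by rewrite /Z; field; rewrite !lt0r_neq0.
  by rewrite ler_pdivlMr ?mulr_gt0 // ler_piMr // mulr_ge0 ?sqr_ge0 // ltW.
have F20 : 0 <= F2 by rewrite F2E addr_ge0 ?sqr_ge0.
rewrite -/Z.
have hC0 : c2' * Z <= C0 * Z /\ 2 * (c3' + (c_low c)^-1 + C2 ^+ 2 / kp) / kp * Z <= C0 * Z.
  split; rewrite ler_wpM2r // /C0.
    by rewrite lerDl divr_ge0 ?(ltW k0) // mulr_ge0 // addr_ge0 // addr_ge0 // ltW.
  by rewrite lerDr ltW.
have [h|h] := rsc D cn.
  apply: le_trans h _; apply: le_trans hC0.1.
  by rewrite ler_wpM2l // ltW.
apply: le_trans hC0.2.
have h5 : kp * F2 <= (c3' + (c_low c)^-1) * Z + C2 * Num.sqrt Z * (frob (D l0) + frob (D l1)).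
  have h6 : c3' * (n%:R * ln n%:R / zeta N n) <= c3' * Z by rewrite ler_wpM2l // ltW.
  move: h; rewrite -/kp -/c3' -/F2 => h.
  by rewrite mulrDl; lra.
(* Half of the strong convexity term absorbs the square; this is the factor [2 / kp] in [C0]. *)
have amgm (x : R) : C2 * Num.sqrt Z * x <= kp / 2 * x ^+ 2 + C2 ^+ 2 / (2 * kp) * Z.
  rewrite -[Z in leRHS]sqr_sqrtr // -subr_ge0.
  have -> : kp / 2 * x ^+ 2 + C2 ^+ 2 / (2 * kp) * Num.sqrt Z ^+ 2 - C2 * Num.sqrt Z * x =
    (kp * x - C2 * Num.sqrt Z) ^+ 2 / (2 * kp) by field; exact: lt0r_neq0.
  by rewrite divr_ge0 ?sqr_ge0 // mulr_ge0 // ltW.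
have := amgm (frob (D l0)); have := amgm (frob (D l1)) => a1 a2.
rewrite (mulrAC _ _ Z) ler_pdivlMr // mulrC.
have hk2 : C2 ^+ 2 / (2 * kp) = C2 ^+ 2 / kp / 2 by field; exact: lt0r_neq0.
rewrite hk2 in a1 a2; rewrite F2E in h5 *.
by lra.
Qed.

Lemma rows_gt0 n m : (1 < n)%N -> (n <= 4 * m)%N -> (0 < m)%N.
Proof. lia. Qed.

(** The part of the assumptions that the deterministic argument of Step 1 needs at a fixed [n] and
    outcome; [r] is the size allowed for the rate. *)
Record regular {R : realType} {c : constants R}
    {dT : nat -> measure_display} {T : forall n, measurableType (dT n)}
    {dX dE : measure_display} {EX : measurableType dX} {EE : measurableType dE}
    (N : network c T EX EE) n (w : T n) (r : R) : Prop := Regular {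
  reg_zeta : 0 < zeta N n;
  reg_zeta_le : c_low c * zeta N n <= 1;
  reg_W : forall i j, `|W1 N w i j| <= M_W c;
  reg_Theta : forall l i j, `|Theta N n l i j| <= M c;
  reg_rank : forall l, \rank (Theta N n l) = K c l;
  reg_rate : Num.sqrt (log_rate N n) <= r }.

Section MeanClose.
Context {R : realType} {c : constants R}.
Context {dT : nat -> measure_display} {T : forall n, measurableType (dT n)}.
Context {dX dE : measure_display}.
Context {EX : measurableType dX} {EE : measurableType dE}.
Variable N : network c T EX EE.

Lemma off_sum_frob m n (f : 'I_m -> 'I_n) (A : 'M[R]_(m, n)) :
  `|off_sum f (fun k j => A k j)| <= Num.sqrt (npairs n m) * frob A.
Proof.
pose J : 'M[R]_(m, n) := \matrix_(k, j) (j != f k)%:R.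
have -> : off_sum f (fun k j => A k j) = ip J A.
  apply: eq_bigr => k _; rewrite big_mkcond; apply: eq_bigr => j _ /=.
  by rewrite mxE; case: eqP; rewrite ?mul0r ?mul1r.
apply: le_trans (normr_ip _ _) _; rewrite ler_wpM2r ?frob_ge0 // frobE ler_wsqrtr //.
rewrite /ip /npairs.
have -> : m%:R * n.-1%:R = \sum_(k < m) n.-1%:R :> R by rewrite sumr_const card_ord mulr_natl.
apply: ler_sum => k _; rewrite (bigD1 (f k)) //= mxE eqxx mulr0 add0r.
under eq_bigr => j jk do rewrite mxE jk mulr1.
rewrite sumr_const ler_nat; apply/eq_leq.
have := cardC1 (f k); rewrite card_ord => <-; exact: eq_card.
Qed.

Lemma off_sum_const m n (f : 'I_m -> 'I_n) (a : R) :
  off_sum f (fun _ _ => a) = npairs n m * a.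
Proof.
rewrite /off_sum /npairs; under eq_bigr => k _.
  rewrite sumr_const (_ : #|_| = n.-1); last first.
    have := cardC1 (f k); rewrite card_ord => <-; exact: eq_card.
  over.
by rewrite sumr_const card_ord -mulrnA -[LHS]mulr_natl natrM; ring.
Qed.

Lemma off_sum_le m n (f : 'I_m -> 'I_n) (F : 'I_m -> 'I_n -> R) b :
  (forall k j, `|F k j| <= b) -> `|off_sum f F| <= npairs n m * b.
Proof.
move=> h; rewrite -(off_sum_const f); apply: le_trans (ler_norm_sum _ _ _) _.
apply: ler_sum => k _; apply: le_trans (ler_norm_sum _ _ _) _.
by apply: ler_sum.
Qed.

Lemma npairs_ge m n : (1 < n)%N -> (n <= 4 * m)%N -> n%:R ^+ 2 <= 9 * npairs n m :> R.
Proof.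
move=> n1 nm; rewrite /npairs -natrM -natrX -[9]/(9%:R) -natrM ler_nat.
have : (n <= 2 * n.-1)%N by case: n n1 {nm} => // n; lia.
by nia.
Qed.

(** By Cauchy-Schwarz an average over the pairs is at most the Frobenius norm divided by the square
    root of [npairs]. From [n <= 4 * m] and [n <= 2 * n.-1] one has [n ^+ 2 <= 9 * npairs], hence
    the factor 3. *)
Lemma mean_close m n (f : 'I_m -> 'I_n) (G : 'I_2 -> 'M[R]_(m, n)) :
  (1 < n)%N -> (n <= 4 * m)%N ->
  `|mean_offdiag f G - tau N n| <=
    3 / n%:R * frob (G l0 - rowsub f (Gamma N n l0)) +
    `|(npairs n m)^-1 * off_sum f (fun k j => Theta N n l0 (f k) j)|.
Proof.
move=> n1 nm.
have n0 : 0 < n%:R :> R by rewrite ltr0n (ltnW n1).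
have m0 := rows_gt0 n1 nm.
have NP0 : 0 < npairs n m :> R.
  by rewrite /npairs mulr_gt0 // ltr0n // -subn1 subn_gt0.
have cE := off_sum_const f (tau N n).
have -> : mean_offdiag f G - tau N n =
   (npairs n m)^-1 * off_sum f (fun k j => (G l0 - rowsub f (Gamma N n l0)) k j) +
   (npairs n m)^-1 * off_sum f (fun k j => Theta N n l0 (f k) j).
  rewrite -mulrDr -off_sumD -[tau N n in LHS](mulKf (lt0r_neq0 NP0)) -cE -mulrBr.
  rewrite -off_sumN -off_sumD; congr (_ * _).
  by apply: eq_bigr => k _; apply: eq_bigr => j _; rewrite /Gamma /= !mxE; ring.
apply: le_trans (ler_normD _ _) _; rewrite lerD2r normrM ger0_norm ?invr_ge0 ?(ltW NP0) //.
apply: (@le_trans _ _ ((npairs n m)^-1 * (Num.sqrt (npairs n m) *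
    frob (G l0 - rowsub f (Gamma N n l0))))).
  by rewrite ler_wpM2l ?invr_ge0 ?(ltW NP0) // off_sum_frob.
rewrite mulrA ler_wpM2r ?frob_ge0 //.
set s := Num.sqrt _.
have s0 : 0 < s by rewrite sqrtr_gt0.
have -> : (npairs n m)^-1 * s = s^-1.
  rewrite -[npairs n m](sqr_sqrtr (ltW NP0)) -/s; field; exact: lt0r_neq0.
rewrite -[leRHS]invf_div lef_pV2 ?posrE ?divr_gt0 //.
rewrite ler_pdivrMr // -(@ler_pXn2r _ 2) ?nnegrE ?(ltW n0) ?mulr_ge0 ?(ltW s0) //.
rewrite exprMn sqr_sqrtr ?(ltW NP0) // mulrC.
by have := npairs_ge n1 nm; rewrite (_ : 3 ^+ 2 = 9) //; rewrite expr2 -natrM.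
Qed.

End MeanClose.

Lemma ln_nat_large {R : realType} (A : R) :
  exists n0, (1 < n0)%N /\ forall n, (n0 <= n)%N -> A <= ln n%:R :> R.
Proof.
have E := expR_gt0 A.
exists (Num.bound (expR A)).+2; split => // n hn.
rewrite -[A]expRK ler_ln ?posrE ?ltr0n //; last exact: leq_trans hn.
apply: ltW; apply: lt_le_trans (archi_boundP (ltW E)) _.
by rewrite ler_nat; apply: leq_trans hn; exact: leqW (leqnSn _).
Qed.

(** [step1_bound] at the first minimizer, with [B] of order [ln n], loses a factor [ln n] in the
    squared error but locates tau_n up to a fraction of [C_M c * Num.sqrt (ln n)]. The truth is then
    feasible for the second problem, where [B] of order [Num.sqrt (ln n)] gives the sharp rate. *)
Lemma step1_rate {R : realType} (c : constants R) : constants_ok c ->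
  exists C0 cF0 (n0 : nat), [/\ 0 < C0, 0 < cF0, (1 < n0)%N &
  forall (dT : nat -> measure_display) (T : forall n, measurableType (dT n))
    (dX dE : measure_display) (EX : measurableType dX) (EE : measurableType dE)
    (N : network c T EX EE) n m (f : 'I_m -> 'I_n) (w : T n) (cF : R)
    (Gt Gh : 'I_2 -> 'M[R]_(m, n)),
  (n0 <= n)%N -> (m <= n)%N -> (n <= 4 * m)%N -> cF <= cF0 -> cF <= 4^-1 ->
  regular N w cF ->
  rsc_event N f (a_star c) w -> Upsilon_event N f w ->
  step1 N f w Gt Gh ->
  \sum_(l < 2) frob (Gh l - rowsub f (Gamma N n l)) ^+ 2 <=
    C0 * (n%:R ^+ 2 * log_rate N n)].
Proof.
move=> hc; have [C0 C00 hC0] := step1_bound hc.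
have M0 := M_gt0 hc; have MW0 := M_W_gt0 hc; have CM0 := C_M_gt0 hc.
have /andP[cl0 _] := Lambda_range hc.
pose B1 := 2 * (1 + M_W c); pose B2 := 2 * C_M c * (1 + M_W c) + 1.
have B10 : 1 <= B1 by rewrite /B1; lra.
have B1p : 0 <= B1 by exact: le_trans B10.
have B20 : 1 <= B2 by rewrite /B2 lerDr !mulr_ge0 //; lra.
(* Solves [3 * Num.sqrt C0 * B1 * cF0 = C_M c / 2], so that the error of the first estimate of tau_n
   uses half of the later constraint. *)
pose cF0 := C_M c / (6 * Num.sqrt C0 * B1).
have sC0 : 0 < Num.sqrt C0 by rewrite sqrtr_gt0.
have cF00 : 0 < cF0 by rewrite divr_gt0 // !mulr_gt0 //; lra.
have [n0 [n01 hn0]] : exists n0, (1 < n0)%N /\ forall n, (n0 <= n)%N ->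
    [/\ 1 <= ln n%:R :> R, M c <= ln (ln n%:R), M c - ln (c_low c) <= ln n%:R :> R,
     M c <= ln n%:R :> R & 4 * M c <= C_M c * Num.sqrt (ln n%:R)].
  have := ln_nat_large (1 + expR (M c) + `|M c - ln (c_low c)| + M c + (4 * M c / C_M c) ^+ 2).
  move=> [n0 [n01 hn0]]; exists n0; split => // n /hn0.
  have e1 := expR_gt0 (M c); have e2 := normr_ge0 (M c - ln (c_low c)).
  have e3 := sqr_ge0 (4 * M c / C_M c); have e4 := ler_norm (M c - ln (c_low c)).
  move=> h; split; try lra.
    by rewrite -[M c]expRK ler_ln ?posrE //; lra.
  rewrite [leRHS]mulrC -ler_pdivrMr // -[leLHS]ger0_norm ?divr_ge0 ?mulr_ge0 ?(ltW M0) ?(ltW CM0) //.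
  by rewrite -sqrtr_sqr ler_wsqrtr //; lra.
exists (C0 * B2 ^+ 2), cF0, n0; split => //.
  by rewrite mulr_gt0 // exprn_gt0 //; lra.
move=> dT T dX dE EX EE N n m f w cF Gt Gh n0n mn nm cFle cF4 reg rsc ups [[Gtd Gtm] [Ghd Ghm]].
have [z0 zl hW hT hr hrate] := reg.
have n1 : (1 < n)%N by apply: leq_trans n0n.
have m0 := rows_gt0 n1 nm.
have [L1 L2 L3 L4 L5] := hn0 n n0n.
have nR : 0 < n%:R :> R by rewrite ltr0n (ltnW n1).
set L := ln n%:R in L1 L2 L3 L4 L5 *.
have L0 : 0 < L by lra.
have lrE : log_rate N n = L / (n%:R * zeta N n) by [].
have lr0 : 0 < log_rate N n by rewrite lrE divr_gt0 // mulr_gt0.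
have s0 : 0 < Num.sqrt (log_rate N n) by rewrite sqrtr_gt0.
have lr1 : log_rate N n <= 1.
  rewrite -[log_rate N n](sqr_sqrtr (ltW lr0)) expr_le1 ?(ltW s0) //; lra.
have Lnz : L <= n%:R * zeta N n.
  by move: lr1; rewrite lrE ler_pdivrMr ?mulr_gt0 // mul1r.
(* Feasibility of the truth for the first problem: the rate condition gives [ln n / n <= zeta], and
   [c_low * zeta <= 1] bounds it from above. *)
have tauL : `|tau N n| + M c <= L.
  rewrite -lerBrDr ler_norml /tau; apply/andP; split.
    have : L / n%:R <= zeta N n by rewrite ler_pdivrMr // mulrC.
    rewrite -ler_ln ?posrE ?divr_gt0 // ln_div ?posrE // -/L; lra.
  have : zeta N n <= (c_low c)^-1 by rewrite -[leRHS]mul1r ler_pdivlMr // mulrC.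
  rewrite -ler_ln ?posrE ?invr_gt0 // lnV ?posrE //; lra.
have GsE0 k j : rowsub f (Gamma N n l0) k j = tau N n + Theta N n l0 (f k) j.
  by rewrite /Gamma /= !mxE.
have GsE1 k j : rowsub f (Gamma N n l1) k j = Theta N n l1 (f k) j.
  by rewrite /Gamma /= !mxE.
have idx (G : 'I_2 -> 'M[R]_(m, n)) b k j :
    `|G l0 k j - rowsub f (Gamma N n l0) k j| <= b ->
    `|G l1 k j - rowsub f (Gamma N n l1) k j| <= b ->
    `|index_diff N f w G k j| <= b * (1 + M_W c).
  move=> h0 h1; rewrite /index_diff; apply: le_trans (ler_normD _ _) _.
  rewrite [leRHS]mulrDr mulr1 lerD // normrM mulrC ler_pM //.
have F1 : \sum_(l < 2) frob (Gt l - rowsub f (Gamma N n l)) ^+ 2 <=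
    C0 * (n%:R * (B1 * L) ^+ 2 / zeta N n).
  have BL : L <= B1 * L by rewrite ler_peMl // ltW.
  have BL1 : 1 <= B1 * L by exact: le_trans BL.
  apply: (hC0 _ _ _ _ _ _ N n m f w (B1 * L)) => //.
  - by apply: le_trans BL _; rewrite expr2 ler_peMr // (le_trans ler01).
  - move=> k j.
    have -> : B1 * L = (2 * L) * (1 + M_W c) by rewrite /B1; ring.
    apply: idx.
      apply: le_trans (ler_normB _ _) _; rewrite mulr2n mulrDl mul1r lerD ?(Gtd l0 k j) //.
      rewrite GsE0; apply: le_trans (ler_normD _ _) _.
      by apply: le_trans tauL; rewrite lerD2l.
    apply: le_trans (ler_normB _ _) _; rewrite mulr2n mulrDl mul1r lerD ?(Gtd l1 k j) //.
    by rewrite GsE1; apply: le_trans L4.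
  - apply: Gtm => l k j.
    have [->|->] : l = l0 \/ l = l1 by case: l => -[|[|//]] ?; [left|right]; exact: val_inj.
      rewrite GsE0; apply: le_trans (ler_normD _ _) _.
      by apply: le_trans tauL; rewrite lerD2l.
    by rewrite GsE1; apply: le_trans L4.
have NP0 : 0 < npairs n m :> R.
  by rewrite /npairs mulr_gt0 // ltr0n // -subn1 subn_gt0.
have avgT : `|(npairs n m)^-1 * off_sum f (fun k j => Theta N n l0 (f k) j)| <= M c.
  rewrite normrM ger0_norm ?invr_ge0 ?(ltW NP0) // mulrC ler_pdivrMr // mulrC.
  by apply: off_sum_le => k j; exact: hT.
have tauT : `|mean_offdiag f Gt - tau N n| <= C_M c / 2 * Num.sqrt L + M c.
  apply: le_trans (mean_close N f Gt n1 nm) _; apply: lerD => //.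
  have h1 : frob (Gt l0 - rowsub f (Gamma N n l0)) ^+ 2 <=
      (n%:R * (Num.sqrt C0 * B1 * Num.sqrt L * cF)) ^+ 2.
    apply: le_trans (_ : _ <= \sum_(l < 2) frob (Gt l - rowsub f (Gamma N n l)) ^+ 2) _.
      by rewrite sum_I2 lerDl sqr_ge0.
    apply: le_trans F1 _.
    have -> : (n%:R * (Num.sqrt C0 * B1 * Num.sqrt L * cF)) ^+ 2 =
       n%:R ^+ 2 * (C0 * B1 ^+ 2 * L) * cF ^+ 2.
      by rewrite !exprMn !sqr_sqrtr ?(ltW C00) ?(ltW L0) //; ring.
    have -> : C0 * (n%:R * (B1 * L) ^+ 2 / zeta N n) =
       n%:R ^+ 2 * (C0 * B1 ^+ 2 * L) * log_rate N n.
      by rewrite lrE; field; rewrite !lt0r_neq0.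
    apply: ler_wpM2l.
      apply: mulr_ge0; first exact: sqr_ge0.
      exact: (mulr_ge0 (mulr_ge0 (ltW C00) (sqr_ge0 _)) (ltW L0)).
    rewrite -(sqr_sqrtr (ltW lr0)) lerXn2r ?nnegrE ?(ltW s0) //.
    by apply: le_trans hrate; exact: ltW.
  have cFp : 0 <= cF by apply: le_trans hrate; exact: ltW.
  have fle : frob (Gt l0 - rowsub f (Gamma N n l0)) <=
      n%:R * (Num.sqrt C0 * B1 * Num.sqrt L * cF).
    rewrite -(@ler_pXn2r _ 2) ?nnegrE ?frob_ge0 //.
    exact: (mulr_ge0 (ler0n _ _) (mulr_ge0 (mulr_ge0 (mulr_ge0 (sqrtr_ge0 _) B1p) (sqrtr_ge0 _)) cFp)).
  apply: le_trans (_ : _ <= 3 / n%:R * (n%:R * (Num.sqrt C0 * B1 * Num.sqrt L * cF))) _.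
    by rewrite ler_wpM2l // divr_ge0 // ltW.
  have -> : 3 / n%:R * (n%:R * (Num.sqrt C0 * B1 * Num.sqrt L * cF)) =
    (3 * Num.sqrt C0 * B1 * cF) * Num.sqrt L by field; exact: lt0r_neq0.
  rewrite ler_wpM2r ?sqrtr_ge0 //.
  apply: le_trans (_ : _ <= 3 * Num.sqrt C0 * B1 * cF0) _.
    by apply: ler_wpM2l => //; exact: (mulr_ge0 (mulr_ge0 (ler0n _ 3) (sqrtr_ge0 _)) B1p).
  rewrite /cF0 le_eqVlt; apply/orP; left; apply/eqP; field.
  by rewrite !lt0r_neq0 //; lra.
set t := mean_offdiag f Gt in tauT Ghd *.
have sL1 : 1 <= Num.sqrt L by rewrite -[leLHS]sqrtr1 ler_wsqrtr.
(* Feasibility of the truth for the second problem: half of the width covers the error in tau_n, and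
   [4 * M c <= C_M c * Num.sqrt L] leaves room for the two terms [M c]. *)
have Gs0t k j : `|rowsub f (Gamma N n l0) k j - t| <= C_M c * Num.sqrt L.
  rewrite GsE0.
  have -> : tau N n + Theta N n l0 (f k) j - t = Theta N n l0 (f k) j - (t - tau N n) by ring.
  apply: le_trans (ler_normB _ _) _; have := hT l0 (f k) j; lra.
have Gs1t k j : `|rowsub f (Gamma N n l1) k j| <= C_M c * Num.sqrt L.
  by rewrite GsE1; have := hT l1 (f k) j; lra.
have BL : Num.sqrt L <= B2 * Num.sqrt L by rewrite ler_peMl // sqrtr_ge0.
have -> : C0 * B2 ^+ 2 * (n%:R ^+ 2 * log_rate N n) =
    C0 * (n%:R * (B2 * Num.sqrt L) ^+ 2 / zeta N n).
  by rewrite lrE exprMn sqr_sqrtr ?(ltW L0) //; field; rewrite !lt0r_neq0.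
apply: (hC0 _ _ _ _ _ _ N n m f w (B2 * Num.sqrt L)) => //.
- by apply: le_trans BL.
- rewrite -[leLHS](sqr_sqrtr (ltW L0)) lerXn2r ?nnegrE ?sqrtr_ge0 // mulr_ge0 ?sqrtr_ge0 //; lra.
- move=> k j; have [g0 g1] := Ghd k j.
  apply: le_trans (_ : _ <= 2 * C_M c * Num.sqrt L * (1 + M_W c)) _; last first.
    have -> : 2 * C_M c * Num.sqrt L * (1 + M_W c) = (2 * C_M c * (1 + M_W c)) * Num.sqrt L by ring.
    by rewrite ler_wpM2r ?sqrtr_ge0 // /B2 lerDl.
  apply: idx.
    have -> : Gh l0 k j - rowsub f (Gamma N n l0) k j =
      (Gh l0 k j - t) - (rowsub f (Gamma N n l0) k j - t) by ring.
    by apply: le_trans (ler_normB _ _) _; have := Gs0t k j; lra.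
  by apply: le_trans (ler_normB _ _) _; have := Gs1t k j; lra.
- apply: Ghm => k j; split; [exact: Gs0t | exact: Gs1t].
Qed.

(** Below [b] the slope of [Lambda] is at most [expR b]. At indices near ln zeta_n the Lipschitz
    constant is thus of order zeta_n, which a constant bound on the slope would lose. *)
Lemma Lambda_lipschitz {R : realType} (x y b : R) : x <= b -> y <= b ->
  `|Lambda x - Lambda y| <= expR b * `|x - y|.
Proof.
wlog xy : x y / y <= x => [h xb yb|xb yb].
  have [yx|/ltW xy] := leP y x; first exact: h.
  by rewrite distrC (distrC x); exact: h.
have E0 := expR_gt0 x; have E1 := expR_gt0 y.
have p1 : 0 < 1 + expR x by rewrite addr_gt0.
have p2 : 0 < 1 + expR y by rewrite addr_gt0.
have Exy : expR y <= expR x by rewrite ler_expR.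
have -> : Lambda x - Lambda y = (expR x - expR y) / ((1 + expR x) * (1 + expR y)).
  by rewrite !LambdaE; field; rewrite !lt0r_neq0.
rewrite ger0_norm; last by rewrite divr_ge0 ?subr_ge0 // mulr_ge0 // ltW.
rewrite (ger0_norm (x := x - y)) ?subr_ge0 //.
have d1 : 1 <= (1 + expR x) * (1 + expR y).
  by rewrite -[leLHS]mulr1 ler_pM // lerDl ltW.
have h1 : (expR x - expR y) / ((1 + expR x) * (1 + expR y)) <= expR x - expR y.
  by rewrite ler_pdivrMr ?mulr_gt0 // ler_peMr // subr_ge0.
apply: le_trans h1 _.
have h2 : expR x - expR y <= expR x * (x - y).
  have := ler_wpM2l (ltW E0) (expR_ge1Dx (y - x)).
  have -> : expR x * expR (y - x) = expR y by rewrite -expRD; congr expR; ring.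
  by lra.
by apply: le_trans h2 _; rewrite ler_wpM2r ?subr_ge0 // ler_expR.
Qed.

Lemma sqrD_ge_half {R : realFieldType} (u v : R) : u ^+ 2 / 2 - v ^+ 2 <= (u + v) ^+ 2.
Proof. by have := sqr_ge0 (u + 2 * v); nra. Qed.

(** * Logistic regression on estimated regressors *)

Section LogisticRegression.
Context {R : realType}.
Variables (d n : nat) (J : pred 'I_n) (y x : 'I_n -> R) (a : 'I_n -> 'rV[R]_d).

Definition logit_loglik (D : 'rV[R]_d) : R :=
  \sum_(j | J j) loglik (y j) (Lambda (x j + ip D (a j))).

Lemma continuous_logit_loglik : continuous logit_loglik.
Proof.
apply: continuous_sum => j D.
have -> : (fun D => loglik (y j) (Lambda (x j + ip D (a j)))) =
  (fun D => y j * (x j + ip D (a j)) - ln (1 + expR (x j + ip D (a j)))).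
  by apply/funext => D'; exact: loglik_Lambda.
have ci0 : continuous (fun D : 'rV[R]_d => ip D (a j)).
  have -> : (fun D : 'rV[R]_d => ip D (a j)) = (fun D => (D *m (a j)^T) 0 0).
    by apply/funext => D'; rewrite ipE /mxtrace big_ord1.
  exact: continuous_mulmx.
have ci : continuous (fun D : 'rV[R]_d => x j + ip D (a j)).
  move=> D'; apply: (@continuousD R _ _ (fun=> x j) (fun D => ip D (a j))).
    exact: cst_continuous.
  exact: ci0.
have ce : continuous (fun D : 'rV[R]_d => 1 + expR (x j + ip D (a j))).
  move=> D'; apply: (@continuousD R _ _ (fun=> 1 : R) (fun D => expR (x j + ip D (a j)))).
    exact: cst_continuous.
  apply: (@continuous_comp _ _ _ (fun D : 'rV[R]_d => x j + ip D (a j)) (@expR R)).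
    exact: ci.
  exact: continuous_expR.
apply: (@continuousB R _ _ (fun D : 'rV[R]_d => y j * (x j + ip D (a j)))
   (fun D : 'rV[R]_d => ln (1 + expR (x j + ip D (a j))))).
  by apply: (@continuousM _ _ (fun=> y j)); [exact: cst_continuous | exact: ci].
apply: (@continuous_comp _ _ _ (fun D : 'rV[R]_d => 1 + expR (x j + ip D (a j))) (@ln R)).
  exact: ce.
by apply: continuous_ln; rewrite addr_gt0 // expR_gt0.
Qed.

Variables (A om nu s r : R).
Hypotheses (r0 : 0 < r) (om0 : 0 < om) (nu0 : 0 < nu).
Hypothesis ha : forall j, J j -> frob (a j) <= A.
Hypothesis hx : forall j, J j -> om <= Lambda (x j) * (1 - Lambda (x j)).
Hypothesis hnu : forall D, nu * frob D ^+ 2 <= \sum_(j | J j) ip D (a j) ^+ 2.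
Hypothesis hs : forall D, \sum_(j | J j) (y j - Lambda (x j)) * ip D (a j) <= s * frob D.
Hypotheses (sr : 4 * s < om * nu * r) (sA : 4 * s * A < om * nu).

(** The score gains at most [s * frob D]; the Bregman loss is at least
    [om * nu * frob D ^+ 2 / (4 b)] with [b] the larger of 1 and [A * frob D]. It is quadratic for
    small [D] and linear for large [D]: [sr] wins the first regime and [sA] the second. *)
Lemma logit_loglik_outside (D : 'rV[R]_d) : r <= frob D -> logit_loglik D < logit_loglik 0.
Proof.
move=> rD; have f0 : 0 < frob D by exact: lt_le_trans rD.
pose b := Num.max 1 (A * frob D).
have b1 : 1 <= b by rewrite le_max lexx.
have bp : 0 < b by exact: lt_le_trans b1.
rewrite -subr_lt0.
have E : logit_loglik D - logit_loglik 0 = \sum_(j | J j) (y j - Lambda (x j)) * ip D (a j)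
   - \sum_(j | J j) bregman (x j) (ip D (a j)).
  rewrite /logit_loglik -!sumrB; apply: eq_bigr => j Jj.
  by rewrite !loglik_Lambda ip0l addr0 /bregman; ring.
have h1 : om / (4 * b) * (nu * frob D ^+ 2) <= \sum_(j | J j) bregman (x j) (ip D (a j)).
  have h : om / (4 * b) * (\sum_(j | J j) ip D (a j) ^+ 2) <=
      \sum_(j | J j) bregman (x j) (ip D (a j)).
    rewrite mulr_sumr; apply: ler_sum => j Jj.
    have db : `|ip D (a j)| <= b.
      apply: le_trans (normr_ip _ _) _; rewrite le_max mulrC ler_wpM2r ?orbT ?(ltW f0) //.
      exact: ha.
    apply: le_trans (logistic_bregman _ db b1).
    rewrite mulrAC ler_wpM2r ?invr_ge0 ?mulr_ge0 ?(ltW bp) //.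
    by rewrite ler_wpM2r ?sqr_ge0 //; exact: hx.
  by apply: le_trans h; rewrite ler_wpM2l // divr_ge0 ?mulr_ge0 // ltW.
have h2 : s * frob D < om / (4 * b) * (nu * frob D ^+ 2).
  have -> : om / (4 * b) * (nu * frob D ^+ 2) = (om * nu * frob D) / (4 * b) * frob D.
    by field; exact: lt0r_neq0.
  rewrite ltr_pM2r // ltr_pdivlMr ?mulr_gt0 // mulrCA mulrA /b.
  have [h|h] := leP 1 (A * frob D).
    by rewrite mulrA ltr_pM2r.
  by rewrite mulr1; apply: lt_le_trans sr _; rewrite ler_wpM2l // mulr_ge0 // ltW.
by rewrite E; have := hs D; move: h1 h2; lra.
Qed.

(** A maximizer over the compact ball is global, as the exterior lies below the centre. Existence
    has to be proved because [maximizes] says nothing without it. *)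
Lemma logit_argmax_exists : exists D, is_argmax logit_loglik D.
Proof.
have [||D0 _ D0m] := @EVT_max_rV _ _ logit_loglik [set D | frob D <= r] _ (@compact_frob_ball _ d r).
- by exists 0; rewrite /= frob0 ltW.
- exact: continuous_subspaceT continuous_logit_loglik.
have h0 : logit_loglik 0 <= logit_loglik D0 by apply: D0m; rewrite inE /= frob0 ltW.
exists D0 => D; have [Dr|rD] := lerP (frob D) r; first by apply: D0m; rewrite inE.
by apply: le_trans h0; apply: ltW; apply: logit_loglik_outside; exact: ltW.
Qed.

Lemma logit_argmax_lt D : is_argmax logit_loglik D -> frob D < r.
Proof.
by move=> h; rewrite ltNge; apply/negP => /logit_loglik_outside; rewrite ltNge h.
Qed.

End LogisticRegression.

Section Alignment.
Context {R : realType} {c : constants R}.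
Implicit Types (mu th : forall l : 'I_2, 'rV[R]_(K c l)).

(** [conform_mx] serves as a cast, the row length depending on [l]; its default 0 is never
    reached. *)
Definition pair_coef (D : 'rV[R]_(K c l0 + K c l1)) (l : 'I_2) : 'rV[R]_(K c l) :=
  if l == l0 then conform_mx 0 (lsubmx D) else conform_mx 0 (rsubmx D).

Lemma pair_coef0 D : pair_coef D l0 = lsubmx D.
Proof. by rewrite /pair_coef eqxx conform_mx_id. Qed.

Lemma pair_coef1 D : pair_coef D l1 = rsubmx D.
Proof. by rewrite /pair_coef /= conform_mx_id. Qed.

Definition step3_index (t v : R) mu (z : forall l : 'I_2, 'rV[R]_(K c l)) : R :=
  t + (ip (mu l0) (z l0) + ip (mu l1) (z l1) * v).

(* The likelihood in the coordinates [mu l = (th l + D_l) O_l^T]. *)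
Lemma step3_argmax n (J : pred 'I_n) (y v : 'I_n -> R) (t : R)
    (z : 'I_n -> forall l, 'rV[R]_(K c l)) (O : forall l, 'M[R]_(K c l)) th mu A om nu s r :
  (forall l, (O l)^T *m O l = 1%:M) ->
  let zt j l := z j l *m O l in
  let x j := step3_index t (v j) th (zt j) in
  let a j := row_mx (zt j l0) (v j *: zt j l1) in
  0 < r -> 0 < om -> 0 < nu ->
  (forall j, J j -> frob (a j) <= A) ->
  (forall j, J j -> om <= Lambda (x j) * (1 - Lambda (x j))) ->
  (forall D, nu * frob D ^+ 2 <= \sum_(j | J j) ip D (a j) ^+ 2) ->
  (forall D, \sum_(j | J j) (y j - Lambda (x j)) * ip D (a j) <= s * frob D) ->
  4 * s < om * nu * r -> 4 * s * A < om * nu ->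
  maximizes (fun mu => \sum_(j | J j) loglik (y j) (Lambda (step3_index t (v j) mu (z j)))) mu ->
  forall l, frob (mu l *m O l - th l) < r.
Proof.
move=> oO zt x a r0 om0 nu0 ha hx hnu hs sr sA hmu.
pose F mu := \sum_(j | J j) loglik (y j) (Lambda (step3_index t (v j) mu (z j))).
have oO' l : O l *m (O l)^T = 1%:M by exact: mulmx1C.
have FE mu' D : (forall l, mu' l *m O l = th l + pair_coef D l) -> F mu' = logit_loglik J y x a D.
  move=> h; apply: eq_bigr => j _; congr (loglik _ (Lambda _)).
  have E l : ip (mu' l) (z j l) = ip (th l) (zt j l) + ip (pair_coef D l) (zt j l).
    by rewrite -ipDl -h ip_mulmxr /zt -mulmxA oO' mulmx1.
  rewrite /x /step3_index !E pair_coef0 pair_coef1 /a -[in RHS](hsubmxK D) ip_row_mx ipZr.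
  ring.
pose back D l : 'rV[R]_(K c l) := (th l + pair_coef D l) *m (O l)^T.
have backE D l : back D l *m O l = th l + pair_coef D l.
  by rewrite /back -mulmxA oO mulmx1.
have [D0 hD0] := logit_argmax_exists (y := y) r0 om0 nu0 ha hx hnu hs sr sA.
pose Dof mu' := row_mx (mu' l0 *m O l0 - th l0) (mu' l1 *m O l1 - th l1).
have DofE mu' l : mu' l *m O l = th l + pair_coef (Dof mu') l.
  have [->|->] : l = l0 \/ l = l1 by case: l => -[|[|//]] ?; [left|right]; exact: val_inj.
    by rewrite pair_coef0 row_mxKl addrC subrK.
  by rewrite pair_coef1 row_mxKr addrC subrK.
(* The change of coordinates is a bijection, so the maximizer in [D] transports back and unlocks the
   hypothesis on [mu]. *)
have ex : exists mu', is_argmax F mu'.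
  exists (back D0) => mu'; rewrite (FE _ _ (DofE mu')) (FE _ _ (backE D0)); exact: hD0.
have hm : is_argmax (logit_loglik J y x a) (Dof mu).
  move=> D; rewrite -(FE _ _ (DofE mu)) -(FE _ _ (backE D)); exact: (hmu ex).
have := logit_argmax_lt r0 om0 nu0 ha hx hnu hs sr sA hm.
rewrite -(@ltr_pXn2r _ 2) ?nnegrE ?frob_ge0 ?(ltW r0) // frob_row_mx => h l.
rewrite -(@ltr_pXn2r _ 2) ?nnegrE ?frob_ge0 ?(ltW r0) //; apply: le_lt_trans h.
have [->|->] : l = l0 \/ l = l1 by case: l => -[|[|//]] ?; [left|right]; exact: val_inj.
  by rewrite lerDl sqr_ge0.
by rewrite lerDr sqr_ge0.
Qed.

End Alignment.

Section Step3Rate.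
Context {R : realType} {c : constants R}.
Hypothesis hc : constants_ok c.

Lemma norm_step3_index t v (th z : forall l : 'I_2, 'rV[R]_(K c l)) a b w :
  0 <= a -> (forall l, frob (th l) <= a) -> (forall l, frob (z l) <= b) -> `|v| <= w ->
  `|step3_index t v th z - t| <= a * (1 + w) * b.
Proof.
move=> a0 ha hb vw; rewrite /step3_index addrAC subrr add0r.
apply: le_trans (ler_normD _ _) _; rewrite normrM.
have h l : `|ip (th l) (z l)| <= a * b.
  by apply: le_trans (normr_ip _ _) _; rewrite ler_pM ?frob_ge0.
have -> : a * (1 + w) * b = a * b + a * b * w by ring.
by rewrite lerD // ler_pM.
Qed.

(** Termwise [F j <= (F j ^+ 2 / e + e) / 2]. It turns the mean-square control of the regressors
    into the mean control needed for the score. *)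
Lemma sum_le_of_sqr n (J : pred 'I_n) (F : 'I_n -> R) e : 0 < e ->
  \sum_(j | J j) F j ^+ 2 <= n%:R * e ^+ 2 -> \sum_(j | J j) F j <= n%:R * e.
Proof.
move=> e0 h.
have h1 : \sum_(j | J j) F j <= \sum_(j | J j) (F j ^+ 2 / e + e) / 2.
  apply: ler_sum => j _.
  have -> : (F j ^+ 2 / e + e) / 2 = F j + (F j - e) ^+ 2 / (2 * e).
    by field; exact: lt0r_neq0.
  by rewrite lerDl divr_ge0 ?sqr_ge0 // mulr_ge0 // ltW.
apply: le_trans h1 _; rewrite -mulr_suml big_split /= -mulr_suml.
have h2 : \sum_(j | J j) e <= n%:R * e.
  rewrite sumr_const mulr_natl ler_wpMn2l ?(ltW e0) //.
  by rewrite -[leqRHS](card_ord n) max_card.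
have h3 : (\sum_(j | J j) F j ^+ 2) / e <= n%:R * e.
  by rewrite ler_pdivrMr // -mulrA -expr2.
by lra.
Qed.

(** The radius [(16 S + 1) / (om nu) * e] satisfies condition [sr]; the added 1 keeps the inequality
    strict when [S = 0]. *)
Let consts_lt (S om nu z n e : R) : 0 <= S -> 0 < om -> 0 < nu -> 0 < z -> 0 < n -> 0 < e ->
  4 * (n * z * e * S) < (om * z) * (n * nu / 4) * ((16 * S + 1) / (om * nu) * e).
Proof.
move=> S0 om0 nu0 z0 n0 e0.
have -> : (om * z) * (n * nu / 4) * ((16 * S + 1) / (om * nu) * e) =
  4 * (n * z * e * S) + n * z * e / 4 by field; rewrite !lt0r_neq0.
by rewrite ltrDl divr_gt0 // !mulr_gt0.
Qed.

Let consts_lt2 (S A om nu z n e : R) : 0 <= S -> 0 <= A ->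
  0 < om -> 0 < nu -> 0 < z -> 0 < n -> 0 < e -> e <= om * nu / (16 * S * A + 1) ->
  4 * (n * z * e * S) * A < (om * z) * (n * nu / 4).
Proof.
move=> S0 A0 om0 nu0 z0 n0 e0.
have SA : 0 <= S * A by rewrite mulr_ge0.
rewrite ler_pdivlMr; last by lra.
move=> h.
have -> : 4 * (n * z * e * S) * A = n * z / 4 * (16 * S * A * e) by field.
have -> : (om * z) * (n * nu / 4) = n * z / 4 * (om * nu) by field.
rewrite ltr_pM2l ?divr_gt0 ?mulr_gt0 //; nra.
Qed.

(** Common form of the two regressions: [a0] are the true regressors, [a] the estimated ones and
    [th] the true coefficient. The noise is assumed centred at the true index, whereas the
    regression is expanded at the index built from [a] and [t]; the drift between the two means is
    part of the score. *)
Lemma step3_rate (e0 e1 e2 Bz nu0 : R) :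
  0 <= e0 -> 0 < e1 -> 0 <= e2 -> 0 < Bz -> 0 < nu0 ->
  exists C h0, [/\ 0 < C, 0 < h0 &
  forall n (J : pred 'I_n) (y v : 'I_n -> R) (z eta t : R)
    (a a0 : 'I_n -> forall l, 'rV[R]_(K c l)) (O : forall l, 'M[R]_(K c l))
    (th mu : forall l, 'rV[R]_(K c l)),
  let at_ j l := a j l *m O l in
  (0 < n)%N -> 0 < z -> c_low c * z <= 1 -> 0 < eta -> eta <= h0 ->
  (forall l, (O l)^T *m O l = 1%:M) -> (forall j, `|v j| <= M_W c) ->
  (forall l, frob (th l) <= M c) -> (forall j l, frob (a0 j l) <= M c) ->
  (forall j l, J j -> frob (at_ j l) <= Bz) ->
  `|t - ln z| <= e0 * eta ->
  (forall l, \sum_(j | J j) frob (at_ j l - a0 j l) ^+ 2 <= n%:R * (e1 * eta) ^+ 2) ->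
  (forall D, n%:R * nu0 * frob D ^+ 2 <=
     \sum_(j | J j) ip D (row_mx (a0 j l0) (v j *: a0 j l1)) ^+ 2) ->
  (forall D, \sum_(j | J j) (y j - Lambda (step3_index (ln z) (v j) th (a0 j))) *
     ip D (row_mx (at_ j l0) (v j *: at_ j l1)) <= e2 * (n%:R * z * eta) * frob D) ->
  maximizes (fun mu => \sum_(j | J j) loglik (y j) (Lambda (step3_index t (v j) mu (a j)))) mu ->
  forall l, frob (mu l *m O l - th l) <= C * eta].
Proof.
move=> e00 e10 e20 Bz0 nu00.
have M0 := M_gt0 hc; have MW0 := M_W_gt0 hc; have /andP[cl0 _] := Lambda_range hc.
have MW1 : 0 < 1 + M_W c by rewrite addr_gt0.
pose A := (1 + M_W c) * Bz; pose Lx := e0 + M c * (1 + M_W c) * (Bz + M c).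
pose om := expR (- Lx) / (1 + expR Lx / c_low c) ^+ 2.
(* [e2] bounds the noise. The other term bounds the drift of the mean: Lipschitz constant [expR Lx]
   (times zeta_n), regressor norm [A], and the index error caused by [t] and by the regressors of
   both layers. *)
pose S := e2 + expR Lx * A * (e0 + 2 * (M c * (1 + M_W c)) * e1).
have A0 : 0 < A by rewrite mulr_gt0.
have om0 : 0 < om.
  by rewrite divr_gt0 ?expR_gt0 // exprn_gt0 // addr_gt0 // divr_gt0 // expR_gt0.
have S0 : 0 <= S.
  apply: addr_ge0 => //; apply: mulr_ge0.
    by apply: mulr_ge0; [exact: expR_ge0 | exact: ltW].
  apply: addr_ge0 => //; apply: mulr_ge0; last exact: ltW.
  by rewrite !mulr_ge0 // ltW.
have MW2 : 0 < 1 + M_W c ^+ 2 by rewrite addr_gt0 // exprn_gt0.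
pose h1 := om * nu0 / (16 * S * A + 1).
(* Ensures that regressor errors remove at most [n * nu0 / 4] of the quadratic form, half of what
   [sqrD_ge_half] leaves. *)
pose h2 := nu0 / (8 * (1 + M_W c ^+ 2) * e1 ^+ 2).
exists ((16 * S + 1) / (om * nu0)), (Num.min 1 (Num.min h1 h2)); split.
- by apply: divr_gt0; [rewrite ltr_wpDl // mulr_ge0 | exact: mulr_gt0].
- rewrite !lt_min ltr01 /=; apply/andP; split.
    apply: divr_gt0; first exact: mulr_gt0.
    by rewrite ltr_wpDl //; apply: mulr_ge0; [exact: mulr_ge0 | exact: ltW].
  by rewrite /h2 divr_gt0 // !mulr_gt0 ?exprn_gt0.
move=> n J y v z eta t a a0 O th mu at_ n0 z0 clz eta0.
rewrite !le_min => /andP[eta1 /andP[etah1 etah2]].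
move=> oO hv hth ha0 hat ht hclose heig hnoise hmax l.
have nR : 0 < n%:R :> R by rewrite ltr0n.
set C := (16 * S + 1) / (om * nu0).
have C0 : 0 < C.
  by apply: divr_gt0; [rewrite ltr_wpDl // mulr_ge0 | exact: mulr_gt0].
pose x j := step3_index t (v j) th (at_ j).
pose x0 j := step3_index (ln z) (v j) th (a0 j).
have e0eta : e0 * eta <= e0 by rewrite ler_piMr.
have MMW : 0 <= M c * (1 + M_W c) by rewrite mulr_ge0 // ltW.
have LxE : Lx = e0 + M c * (1 + M_W c) * Bz + M c * (1 + M_W c) * M c.
  by rewrite /Lx mulrDr addrA.
have xL j : J j -> `|x j - ln z| <= Lx.
  move=> Jj; have -> : x j - ln z = (x j - t) + (t - ln z) by rewrite addrA subrK.
  apply: le_trans (ler_normD _ _) _.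
  have hz := norm_step3_index t (ltW M0) hth (fun l => hat j l Jj) (hv j).
  have -> : Lx = (M c * (1 + M_W c) * Bz + M c * (1 + M_W c) * M c) + e0.
    by rewrite LxE; ring.
  apply: lerD; last exact: (le_trans ht e0eta).
  apply: le_trans hz _; rewrite lerDl; apply: mulr_ge0 => //; exact: ltW.
have x0L j : `|x0 j - ln z| <= Lx.
  have hz := norm_step3_index (ln z) (ltW M0) hth (ha0 j) (hv j).
  apply: le_trans hz _; rewrite LxE lerDr; apply: addr_ge0 => //.
  by apply: mulr_ge0 => //; exact: ltW.
have frow j (D : forall l : 'I_2, 'rV[R]_(K c l)) : frob (row_mx (D l0) (v j *: D l1)) <=
    frob (D l0) + M_W c * frob (D l1).
  have p0 : 0 <= frob (D l0) + M_W c * frob (D l1).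
    by rewrite addr_ge0 ?frob_ge0 // mulr_ge0 ?frob_ge0 // ltW.
  rewrite -(@ler_pXn2r _ 2) ?nnegrE ?frob_ge0 // frob_row_mx frobZ.
  have hh : (`|v j| * frob (D l1)) ^+ 2 <= (M_W c * frob (D l1)) ^+ 2.
    rewrite lerXn2r ?nnegrE ?mulr_ge0 ?frob_ge0 ?(ltW MW0) //.
    by rewrite ler_wpM2r ?frob_ge0.
  rewrite sqrrD; apply: le_trans (_ : _ <= frob (D l0) ^+ 2 + (M_W c * frob (D l1)) ^+ 2) _.
    by rewrite lerD2l.
  by rewrite lerD2r lerDl mulrn_wge0 // !mulr_ge0 ?frob_ge0 // ltW.
have fA j : J j -> frob (row_mx (at_ j l0) (v j *: at_ j l1)) <= A.
  move=> Jj; apply: le_trans (frow j (at_ j)) _.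
  by rewrite /A mulrDl mul1r lerD ?hat // ler_wpM2l ?(ltW MW0) ?hat.
pose r := C * eta.
have : frob (mu l *m O l - th l) < r; last exact: ltW.
apply: (@step3_argmax _ _ n J y v t a O th mu A (om * z) (n%:R * nu0 / 4)
   (n%:R * z * eta * S) r) => //.
- exact: mulr_gt0.
- exact: mulr_gt0.
- by rewrite divr_gt0 // mulr_gt0.
- move=> j Jj; rewrite -[step3_index _ _ _ _]/(x j) -[x j](subrK (ln z)) addrC.
  by apply: logistic_curvature => //; exact: xL.
- move=> D.
  have h := heig D.
  pose b j := row_mx (at_ j l0 - a0 j l0) (v j *: (at_ j l1 - a0 j l1)).
  have bE j : ip D (row_mx (at_ j l0) (v j *: at_ j l1)) =
      ip D (row_mx (a0 j l0) (v j *: a0 j l1)) + ip D (b j).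
    rewrite -ipDr add_row_mx; congr (ip _ (row_mx _ _)); first by rewrite addrC subrK.
    by rewrite -scalerDr addrC subrK.
  have hb : \sum_(j | J j) ip D (b j) ^+ 2 <= n%:R * nu0 / 4 * frob D ^+ 2.
    apply: (@le_trans _ _ (\sum_(j | J j) (frob (at_ j l0 - a0 j l0) ^+ 2 +
        M_W c ^+ 2 * frob (at_ j l1 - a0 j l1) ^+ 2) * frob D ^+ 2)).
      apply: ler_sum => j _; apply: le_trans (ip_sqr_le _ _) _.
      rewrite -!frob_sqr mulrC ler_wpM2r ?sqr_ge0 // frob_row_mx lerD2l frobZ exprMn.
      by rewrite ler_wpM2r ?sqr_ge0 // lerXn2r ?nnegrE // ltW.
    rewrite -mulr_suml ler_wpM2r ?sqr_ge0 // big_split -mulr_sumr /=.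
    apply: (@le_trans _ _ (n%:R * (e1 * eta) ^+ 2 + M_W c ^+ 2 * (n%:R * (e1 * eta) ^+ 2))).
      by rewrite lerD ?hclose // ler_wpM2l ?sqr_ge0 // hclose.
    have -> : n%:R * (e1 * eta) ^+ 2 + M_W c ^+ 2 * (n%:R * (e1 * eta) ^+ 2) =
      n%:R * ((1 + M_W c ^+ 2) * e1 ^+ 2 * eta ^+ 2) by ring.
    rewrite -[leRHS]mulrA ler_pM2l //.
    apply: (@le_trans _ _ ((1 + M_W c ^+ 2) * e1 ^+ 2 * eta)).
      apply: ler_wpM2l; first by apply: mulr_ge0; [exact: ltW | exact: sqr_ge0].
      by rewrite expr2 ler_piMr // ltW.
    move: etah2; rewrite /h2 ler_pdivlMr ?mulr_gt0 ?exprn_gt0 // => hh.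
    have -> : (1 + M_W c ^+ 2) * e1 ^+ 2 * eta = eta * (8 * (1 + M_W c ^+ 2) * e1 ^+ 2) / 8 by field.
    clear -hh nu00; lra.
  apply: (@le_trans _ _ ((\sum_(j | J j) ip D (row_mx (a0 j l0) (v j *: a0 j l1)) ^+ 2) / 2 -
      \sum_(j | J j) ip D (b j) ^+ 2)).
    by move: h hb; set X := \sum_(j | J j) _; set Y := \sum_(j | J j) _; clear; lra.
  rewrite mulr_suml -sumrB; apply: ler_sum => j _; rewrite bE; exact: sqrD_ge_half.
- move=> D.
  have -> : \sum_(j | J j) (y j - Lambda (x j)) * ip D (row_mx (at_ j l0) (v j *: at_ j l1)) =
    \sum_(j | J j) (y j - Lambda (x0 j)) * ip D (row_mx (at_ j l0) (v j *: at_ j l1)) +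
    \sum_(j | J j) (Lambda (x0 j) - Lambda (x j)) * ip D (row_mx (at_ j l0) (v j *: at_ j l1)).
    by rewrite -big_split; apply: eq_bigr => j _ /=; ring.
  have -> : n%:R * z * eta * S * frob D = e2 * (n%:R * z * eta) * frob D +
     expR Lx * z * (A * frob D) * (n%:R * (e0 * eta) +
       M c * (1 + M_W c) * (n%:R * (e1 * eta) + n%:R * (e1 * eta))) by rewrite /S; ring.
  apply: lerD; first exact: hnoise.
  apply: (@le_trans _ _ (\sum_(j | J j) expR Lx * z * (A * frob D) * (e0 * eta +
      M c * (1 + M_W c) * (frob (at_ j l0 - a0 j l0) + frob (at_ j l1 - a0 j l1))))).
    apply: ler_sum => j Jj; apply: le_trans (ler_norm _) _; rewrite normrM.
    have hLam : `|Lambda (x0 j) - Lambda (x j)| <= expR Lx * z * (e0 * eta +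
        M c * (1 + M_W c) * (frob (at_ j l0 - a0 j l0) + frob (at_ j l1 - a0 j l1))).
      have xb : x j <= ln z + Lx by have := ler_normlW (xL j Jj); rewrite lerBlDl.
      have x0b : x0 j <= ln z + Lx by have := ler_normlW (x0L j); rewrite lerBlDl.
      apply: le_trans (Lambda_lipschitz x0b xb) _.
      rewrite expRD lnK ?posrE // (mulrC z) ler_wpM2l ?mulr_ge0 ?expR_ge0 ?(ltW z0) //.
      have -> : x0 j - x j = - (t - ln z) -
        (ip (th l0) (at_ j l0 - a0 j l0) + ip (th l1) (at_ j l1 - a0 j l1) * v j).
        by rewrite /x /x0 /step3_index !ipDr !ipNr; ring.
      apply: le_trans (ler_normB _ _) _; rewrite normrN lerD //.
      apply: le_trans (ler_normD _ _) _.
      have hi k : `|ip (th k) (at_ j k - a0 j k)| <= M c * frob (at_ j k - a0 j k).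
        by apply: le_trans (normr_ip _ _) _; rewrite ler_wpM2r ?frob_ge0.
      rewrite mulrDr lerD //.
        apply: le_trans (hi l0) _; rewrite ler_wpM2r ?frob_ge0 // ler_peMr ?(ltW M0) //.
        by rewrite lerDl ltW.
      rewrite normrM; apply: (@le_trans _ _ (M c * frob (at_ j l1 - a0 j l1) * M_W c)).
        by rewrite ler_pM.
      have fM : 0 <= M c * frob (at_ j l1 - a0 j l1) by rewrite mulr_ge0 ?frob_ge0 // ltW.
      by rewrite [leRHS]mulrAC ler_wpM2l // lerDr.
    apply: le_trans (ler_pM _ _ hLam (normr_ip _ _)) _ => //.
    rewrite mulrAC; apply: ler_wpM2r.
      apply: addr_ge0; first by apply: mulr_ge0 => //; exact: ltW.
      by apply: mulr_ge0 => //; rewrite addr_ge0 ?frob_ge0.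
    apply: ler_wpM2l; first by apply: mulr_ge0; [exact: expR_ge0 | exact: ltW].
    by rewrite mulrC ler_wpM2r ?frob_ge0 // fA.
  rewrite -mulr_sumr; apply: ler_wpM2l.
    apply: mulr_ge0; first by apply: mulr_ge0; [exact: expR_ge0 | exact: ltW].
    by apply: mulr_ge0; [exact: ltW | exact: frob_ge0].
  rewrite big_split /=; apply: lerD.
    rewrite sumr_const mulr_natl; apply: ler_wpMn2l; first by apply: mulr_ge0 => //; exact: ltW.
    by rewrite -[leqRHS](card_ord n) max_card.
  rewrite -mulr_sumr big_split /=.
  apply: ler_wpM2l => //; apply: lerD; apply: sum_le_of_sqr; rewrite ?mulr_gt0 //; exact: hclose.
- exact: consts_lt.
- by apply: consts_lt2 => //; exact: ltW.
Qed.

End Step3Rate.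

(** * Entrywise bound on singular vectors *)

Section SingularVectors.
Context {R : realType}.

Lemma rect_diag_gram m n (s : nat -> R) (k : 'I_n) :
  (forall i, (minn m n <= i)%N -> s i = 0) ->
  (rect_diag m n s)^T *m (rect_diag m n s *m delta_mx k (0 : 'I_1)) =
    s k ^+ 2 *: delta_mx k 0.
Proof.
move=> sz; apply/matrixP => a b; rewrite ord1 mulmxA -colE !mxE andbT.
under eq_bigr do rewrite !mxE.
have [km|mk] := ltnP k m.
  rewrite (bigD1 (Ordinal km)) //= eqxx big1 ?addr0; last first.
    move=> i ik; rewrite [X in _ * X](_ : _ = 0) ?mulr0 //.
    by case: eqP => // e; case/eqP: ik; exact/val_inj.
  by rewrite -val_eqE /= eq_sym; case: eqP => [<-|]; rewrite ?mulr1 ?mulr0 ?mul0r.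
rewrite sz; last by rewrite (leq_trans (geq_minl _ _)).
rewrite expr0n mul0r big1 // => i _.
case: (_ =P nat_of_ord k) => [ik|]; rewrite ?mulr0 //.
by move: (ltn_ord i); rewrite ik ltnNge mk.
Qed.

(** For a right singular vector [v], [A^T A v = s^2 v]. Its j-th coordinate times [s^2] is the inner
    product of the j-th column of [A] with [A v], whose norm is [s]. *)
Lemma svd_col_bound m n (A : 'M[R]_(m, n)) U s V (k : 'I_n) (j : 'I_n) : svd A U s V ->
  frob (A *m col k V) = s k /\ `|V j k| * s k <= frob (col j A).
Proof.
move=> H; have [UU VV AE sd sz] := H.
have sk0 := svd_ge0 k H.
have gram : A^T *m (A *m col k V) = s k ^+ 2 *: col k V.
  rewrite !colE AE -[X in _ *m X *m _]/(rect_diag m n s) !trmx_mul trmxK.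
  rewrite -!mulmxA (mulmxA V^T V) VV mul1mx (mulmxA U^T) UU mul1mx.
  by rewrite rect_diag_gram // -scalemxAr.
have fV : frob (col k V) = 1 by rewrite colE frob_orthl // frob_delta.
have fA : frob (A *m col k V) = s k.
  apply/eqP; rewrite -(@eqrXn2 _ 2) ?frob_ge0 // frob_sqr ip_mulmxl gram ipZr.
  by rewrite -frob_sqr fV expr1n mulr1.
split => //; have [->|sn] := eqVneq (s k) 0; first by rewrite mulr0 frob_ge0.
have sp : 0 < s k by rewrite lt_def sn.
rewrite -(ler_pM2r sp) -mulrA -expr2 -{2}fA.
have -> : `|V j k| * s k ^+ 2 = `|ip (col j A) (A *m col k V)|.
  have -> : ip (col j A) (A *m col k V) = (A^T *m (A *m col k V)) j 0.
    set v := A *m _; rewrite /ip mxE; apply: eq_bigr => i _.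
    by rewrite big_ord1 !mxE.
  by rewrite gram !mxE normrM mulrC ger0_norm ?sqr_ge0.
exact: normr_ip.
Qed.

(** Bounded entries give columns of norm at most [M / Num.sqrt n] after scaling, so [svd_col_bound]
    only needs the singular values away from 0. Each is the norm of the scaled [A] at a column of
    [X]. That column is close to a unit vector of the row space of [B], where the energy condition
    applies. No gap between singular values enters. *)
Lemma sv_row_bound m n K0 (A B : 'M[R]_(m, n)) (X cV : 'M[R]_(n, K0)) (U0 : 'M[R]_(m, K0))
    (O : 'M[R]_K0) (M c1 e1 e2 : R) :
  0 < c1 -> (0 < n)%N -> (m <= n)%N -> (K0 <= n)%N ->
  top_right_sv (n%:R^-1 *: A) X -> O^T *m O = 1%:M -> cV^T *m cV = 1%:M ->
  B = Num.sqrt n%:R *: (U0 *m cV^T) ->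
  (forall i j, `|A i j| <= M) -> (forall i j, `|B i j| <= M) -> 0 <= M ->
  frob (cV - X *m O) <= e1 -> frob (A - B) <= n%:R * e2 ->
  (forall q : 'cV[R]_K0, c1 * n%:R * frob q ^+ 2 <= frob (U0 *m q) ^+ 2) ->
  M * e1 + e2 <= Num.sqrt c1 / 2 ->
  forall j k, `|Num.sqrt n%:R * X j k| <= 2 * M / Num.sqrt c1.
Proof.
move=> c10 n0 mn Kn [U [s [V [H XV]]]] oO ocV BE hA hB M0 he1 he2 henergy hsmall j k.
have nR : 0 < n%:R :> R by rewrite ltr0n.
have sn0 : 0 < Num.sqrt n%:R :> R by rewrite sqrtr_gt0.
have sc0 : 0 < Num.sqrt c1 by rewrite sqrtr_gt0.
have k'P : (k < n)%N by exact: leq_trans Kn.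
pose k' := Ordinal k'P.
have [fA hj] := svd_col_bound k' j H.
have XE : col k X = col k' V by apply/colP => i; rewrite !mxE; exact: XV.
have XjE : X j k = V j k' by exact: XV.
have [_ VV _ _ _] := H.
have fV : frob (col k' V) = 1 by rewrite colE frob_orthl // frob_delta.
have oO' : O *m O^T = 1%:M by exact: mulmx1C.
(* Coordinates in which the k-th column of [X] is [X *m O *m q], comparable to [cV *m q]. *)
pose q : 'cV[R]_K0 := O^T *m delta_mx k 0.
have fq : frob q = 1 by rewrite /q frob_orthl ?trmxK // frob_delta.
have Xq : col k X = X *m O *m q by rewrite /q -mulmxA (mulmxA O) oO' mul1mx colE.
have h1 : n%:R * Num.sqrt c1 <= frob (B *m (cV *m q)).
  rewrite BE -scalemxAl -!mulmxA (mulmxA cV^T) ocV mul1mx frobZ ger0_norm ?sqrtr_ge0 //.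
  have := henergy q; rewrite fq expr1n mulr1 => h.
  have h' : Num.sqrt (c1 * n%:R) <= frob (U0 *m q).
    by rewrite -[leRHS]ger0_norm ?frob_ge0 // -sqrtr_sqr ler_wsqrtr.
  rewrite -{1}(sqr_sqrtr (ltW nR)) expr2 -mulrA ler_pM2l //.
  by rewrite mulrC -sqrtrM // ltW.
have fB : frob B <= n%:R * M.
  rewrite -(@ler_pXn2r _ 2) ?nnegrE ?frob_ge0 ?mulr_ge0 //.
  apply: le_trans (frob_le_const M0 hB) _; rewrite exprMn ler_wpM2r ?sqr_ge0 //.
  by rewrite -natrX ler_nat expnS expn1 leq_mul2r mn orbT.
have h2 : frob (B *m (cV *m q)) <= frob (A *m col k X) + n%:R * e2 + n%:R * M * e1.
  have -> : B *m (cV *m q) = A *m col k X + - ((A - B) *m col k X) + B *m ((cV - X *m O) *m q).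
    have -> : (cV - X *m O) *m q = cV *m q - col k X by rewrite mulmxBl Xq.
    by rewrite mulmxBl mulmxBr opprB (addrCA (A *m _)) subrr addr0 addrC subrK.
  apply: le_trans (frobD _ _) _; apply: lerD.
    apply: le_trans (frobD _ _) _; rewrite lerD2l frobN.
    by apply: le_trans (frobM _ _) _; rewrite XE fV mulr1.
  apply: le_trans (frobM _ _) _; apply: ler_pM => //; rewrite ?frob_ge0 //.
  by apply: le_trans (frobM _ _) _; rewrite fq mulr1.
have sk : Num.sqrt c1 / 2 <= s k'.
  have E : frob (A *m col k X) = n%:R * s k'.
    rewrite -fA XE -scalemxAl frobZ ger0_norm ?invr_ge0 ?(ltW nR) //.
    by rewrite mulrA mulfV ?mul1r // gt_eqF.
  rewrite E in h2; have := le_trans h1 h2.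
  have -> : n%:R * s k' + n%:R * e2 + n%:R * M * e1 = n%:R * (s k' + (M * e1 + e2)) by ring.
  by rewrite ler_pM2l //; move: hsmall; clear; lra.
have fc : frob (col j (n%:R^-1 *: A)) <= M / Num.sqrt n%:R.
  have M1 : 0 <= M / n%:R by rewrite divr_ge0.
  have M2 : 0 <= M / Num.sqrt n%:R by rewrite divr_ge0 // ltW.
  rewrite -(@ler_pXn2r _ 2) ?nnegrE ?frob_ge0 //.
  apply: (@le_trans _ _ ((m * 1)%:R * (M / n%:R) ^+ 2)).
    apply: frob_le_const => // i a; rewrite !mxE normrM.
    by rewrite (ger0_norm (x := n%:R^-1)) ?invr_ge0 ?(ltW nR) // mulrC ler_wpM2r // invr_ge0 ltW.
  rewrite muln1 !exprMn !exprVn sqr_sqrtr ?(ltW nR) // mulrCA ler_wpM2l ?sqr_ge0 //.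
  rewrite expr2 invfM mulrA ler_piMl ?invr_ge0 ?(ltW nR) //.
  by rewrite ler_pdivrMr // mul1r ler_nat.
have sk0 : 0 < s k' by apply: lt_le_trans sk; rewrite divr_gt0.
rewrite normrM ger0_norm ?sqrtr_ge0 // XjE.
have h3 : `|V j k'| * s k' <= M / Num.sqrt n%:R by exact: le_trans hj fc.
have h4 : `|V j k'| * (Num.sqrt c1 / 2) <= M / Num.sqrt n%:R.
  by apply: le_trans h3; rewrite ler_wpM2l.
rewrite ler_pdivlMr // mulrC.
move: h4; rewrite ler_pdivlMr // => h4.
have -> : Num.sqrt c1 * (Num.sqrt n%:R * `|V j k'|) =
  2 * (`|V j k'| * (Num.sqrt c1 / 2) * Num.sqrt n%:R) by field.
by rewrite ler_pM2l.
Qed.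

End SingularVectors.

(** * Frobenius error of the truncated, symmetrized estimate *)

Section ThetaHat.
Context {R : realType} {c : constants R}.
Hypothesis hc : constants_ok c.
Context {dT : nat -> measure_display} {T : forall n, measurableType (dT n)}.
Context {dX dE : measure_display}.
Context {EX : measurableType dX} {EE : measurableType dE}.
Variable N : network c T EX EE.

Lemma trunc_close (M u v : R) : `|v| <= M -> `|trunc M u - v| <= `|u - v|.
Proof.
rewrite ler_norml => /andP[v1 v2]; rewrite /trunc.
have [uM|/ltW Mu] := leP u M.
  have [//|/ltW h] := leP (- M) u; rewrite ler0_norm; last by lra.
  by rewrite ler0_norm; lra.
have h : - M <= M by lra.
rewrite (max_idPr h) ger0_norm; last by lra.
by rewrite ger0_norm; lra.
Qed.

Lemma trunc_bound (M u : R) : 0 <= M -> `|trunc M u| <= M.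
Proof.
move=> M0; rewrite ler_norml /trunc le_max lexx /= ge_max ge_min lexx orbT andbT.
lra.
Qed.

(** Truncation at [M] does not increase the distance to entries bounded by [M]. Symmetrization adds
    the error at the mirrored position, centring adds [e], and the entry set to 0 in each row costs
    at most [M c ^+ 2]. *)
Lemma Theta_hat_close n m (f : 'I_m -> 'I_n) (Gh : 'I_2 -> 'M[R]_(m, n)) (l : 'I_2) (e : R) :
  injective f -> (Theta N n l)^T = Theta N n l ->
  (forall i j, `|Theta N n l i j| <= M c) ->
  `|mean_offdiag f Gh - tau N n| <= e ->
  frob (Theta_hat (c := c) f Gh l - rowsub f (Theta N n l)) ^+ 2 <=
    3 * frob (Gh l - rowsub f (Gamma N n l)) ^+ 2 + (m * n)%:R * (3 * e ^+ 2) +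
    m%:R * M c ^+ 2.
Proof.
move=> finj sT hT he.
have M0 := M_gt0 hc.
have e0 : 0 <= e by apply: le_trans he.
pose D := Gh l - rowsub f (Gamma N n l).
pose t := if l == l0 then mean_offdiag f Gh else 0.
pose t0 := if l == l0 then tau N n else 0.
have ht : `|t - t0| <= e.
  by rewrite /t /t0; case: ifP => // _; rewrite subrr normr0.
have GE i j : Gamma N n l i j = t0 + Theta N n l i j.
  rewrite /Gamma /t0; case: eqP => [->|l0']; first by rewrite !mxE.
  have -> : l = l1 by case: l l0' {D t t0 ht sT hT} => -[|[|//]] ? h; [case: h|]; exact: val_inj.
  by rewrite add0r.
have sTE i j : Theta N n l i j = Theta N n l j i by rewrite -[in LHS]sT mxE.
(* Squared error at the mirrored position, when node [j] also labels a row. As [f] is injective,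
   each entry is mirrored at most once, so the sum stays below [frob D ^+ 2]. *)
pose F k j : R := if [pick k' | f k' == j] is Some k' then D k' (f k) ^+ 2 else 0.
have F0 k j : 0 <= F k j by rewrite /F; case: pickP => // k' _; exact: sqr_ge0.
have ent k j : (Theta_hat (c := c) f Gh l k j - Theta N n l (f k) j) ^+ 2 <=
    2 * D k j ^+ 2 + F k j + 3 * e ^+ 2 + (j == f k)%:R * M c ^+ 2.
  have te2 : (t0 - t) ^+ 2 <= e ^+ 2.
    by rewrite -real_normK ?num_real // distrC lerXn2r ?nnegrE.
  rewrite mxE; case: (j =P f k) => [ej|_].
    rewrite sub0r sqrrN mul1r.
    have : Theta N n l (f k) j ^+ 2 <= M c ^+ 2.
      by rewrite -real_normK ?num_real // lerXn2r ?nnegrE ?(ltW M0).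
    by have := F0 k j; have := sqr_ge0 (D k j); have := sqr_ge0 e; lra.
  rewrite mul0r addr0 -/t /F; case: pickP => [k' /eqP fk'|_].
    apply: le_trans (_ : _ <= (2^-1 * (D k j + D k' (f k)) + (t0 - t)) ^+ 2) _.
      rewrite -real_normK ?num_real // -[leRHS]real_normK ?num_real // lerXn2r ?nnegrE //.
      apply: le_trans (trunc_close _ (hT (f k) j)) _; rewrite le_eqVlt; apply/orP; left.
      by apply/eqP; congr (`|_|); rewrite /D !mxE !GE fk' (sTE j); field.
    move: te2; set a := D k j; set b := D k' (f k); set u := t0 - t.
    have := sqr_ge0 (a - b); have := sqr_ge0 (a + b - u); have := sqr_ge0 (a + b - 4 * u).
    by clear; nra.
  apply: le_trans (_ : _ <= (D k j + (t0 - t)) ^+ 2) _.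
    rewrite -real_normK ?num_real // -[leRHS]real_normK ?num_real // lerXn2r ?nnegrE //.
    apply: le_trans (trunc_close _ (hT (f k) j)) _; rewrite le_eqVlt; apply/orP; left.
    by apply/eqP; congr (`|_|); rewrite /D !mxE !GE; ring.
  move: te2; set a := D k j; set u := t0 - t.
  by have := sqr_ge0 (a - u); have := sqr_ge0 e; clear; nra.
have sumF : \sum_k \sum_j F k j <= frob D ^+ 2.
  apply: (@le_trans _ _ (\sum_k \sum_k' D k' (f k) ^+ 2)).
    apply: ler_sum => k _.
    apply: (@le_trans _ _ (\sum_j \sum_k' (f k' == j)%:R * D k' (f k) ^+ 2)).
      apply: ler_sum => j _; rewrite /F; case: pickP => [k' fk'|_].
        rewrite (bigD1 k') //= fk' mul1r lerDl; apply: sumr_ge0 => q _.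
        by rewrite mulr_ge0 ?sqr_ge0.
      by apply: sumr_ge0 => q _; rewrite mulr_ge0 ?sqr_ge0.
    rewrite exchange_big; apply: ler_sum => k' _ /=.
    rewrite -mulr_suml (bigD1 (f k')) //= eqxx big1 ?addr0 ?mul1r //.
    by move=> j /negbTE; rewrite eq_sym => ->.
  rewrite exchange_big frob_sqr; apply: ler_sum => k' _.
  rewrite -(big_imset (fun j => D k' j ^+ 2) (h := f) (A := predT)) /=; last by move=> ? ? _ _; exact: finj.
  rewrite [leRHS](bigID (mem (f @: predT))) /=.
  under [X in _ <= X + _]eq_bigr do rewrite -expr2.
  rewrite lerDl; apply: sumr_ge0 => j _; by rewrite -expr2 sqr_ge0.
have subE (A : 'M[R]_(m, n)) k j :
    (A - rowsub f (Theta N n l)) k j = A k j - Theta N n l (f k) j by rewrite !mxE.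
have E : frob (Theta_hat (c := c) f Gh l - rowsub f (Theta N n l)) ^+ 2 <=
   \sum_k \sum_j (2 * D k j ^+ 2 + F k j + 3 * e ^+ 2 + (j == f k)%:R * M c ^+ 2).
  rewrite frob_sqr; apply: ler_sum => k _; apply: ler_sum => j _.
  by rewrite -expr2 subE; exact: ent.
apply: le_trans E _.
have -> : \sum_k \sum_j (2 * D k j ^+ 2 + F k j + 3 * e ^+ 2 + (j == f k)%:R * M c ^+ 2) =
  2 * frob D ^+ 2 + \sum_k \sum_j F k j + (m * n)%:R * (3 * e ^+ 2) + m%:R * M c ^+ 2.
  under eq_bigr => k _ do rewrite !big_split /=.
  rewrite !big_split /=; congr (_ + _ + _ + _).
  - rewrite frob_sqr mulr_sumr; apply: eq_bigr => k _; rewrite mulr_sumr.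
    by apply: eq_bigr => j _; rewrite expr2.
  - by rewrite !sumr_const !card_ord -mulrnA [RHS]mulr_natl mulnC.
  - have -> : m%:R * M c ^+ 2 = \sum_(k < m) M c ^+ 2 by rewrite sumr_const card_ord mulr_natl.
    apply: eq_bigr => k _; rewrite -mulr_suml (bigD1 (f k)) //= eqxx big1 ?addr0 ?mul1r //.
    by move=> j /negbTE ->.
by move: sumF; rewrite -/D; clear; lra.
Qed.

End ThetaHat.

(** * Noise and conditioning of the two regressions *)

Section NoiseInstances.
Context {R : realType} {c : constants R}.
Hypothesis hc : constants_ok c.
Context {dT : nat -> measure_display} {T : forall n, measurableType (dT n)}.
Variable P : forall n, probability (T n) R.
Context {dX dE : measure_display}.
Context {EX : measurableType dX} {EE : measurableType dE}.
Variable N : network c T EX EE.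
Hypotheses (hD : DGP P N) (hS : random_split P N).

Local Notation GT n S D := (g_sigma_algebraType (@split_pi R c dT T dX dE EX EE N n S D)).
Local Notation step2E n := (@step2_events R c dT T dX dE EX EE N n).

(** The shocks that the Step 2 data can reveal when I1 = S. The pairs inside the complement of [S]
    are left untouched. *)
Definition touching n (S : {set 'I_n}) : pred ('I_n * 'I_n) :=
  fun p => pairs_of p && ((p.1 \in S) || (p.2 \in S)).

Lemma measurable_Y n (S : {set 'I_n}) (i j : 'I_n) : i != j -> i \in S ->
  measurable_fun setT ((fun w => Y N w i j) : GT n S (touching S) -> R).
Proof.
move=> ij iS; have pp := opair_pairs ij.
have pS : touching S (opair i j).
  by rewrite /touching pp /= /opair; case: ifP => _ /=; rewrite iS ?orbT.
have -> : (fun w => Y N w i j) = (fun w => if (eps N (opair i j).1 (opair i j).2 w <=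
    link_index N w (opair i j).1 (opair i j).2)%R then 1 else 0).
  apply/funext => w; rewrite /Y /opair; case: ltnP => h /=.
    by rewrite /edge /link_index; case: ifP.
  rewrite ltn_neqAle eq_sym val_eqE ij h /= /edge /link_index.
  by case: ifP.
apply: measurable_fun_ifT => //; apply: measurable_fun_ler.
  move=> _ B mB; rewrite setTI; apply: sub_sigma_algebra.
  exact: split_pi_eps.
by apply: (measurable_link_index hD); move: pp; rewrite /pairs_of; case: eqP => // ->; rewrite ltnn.
Qed.

(** Every generator concerns some [i] in I1; inside {I1 = S} it is either empty or an event on the
    covariates and on shocks touching [S]. The sets whose trace has this property form a
    sigma-algebra. *)
Lemma step2_trace n (S : {set 'I_n}) (A : set (T n)) : <<s step2E n >> A ->
  <<s split_pi N S (touching S) >> (A `&` [set w | I1 N w = S]).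
Proof.
set IS := [set w | I1 N w = S]; set G := split_pi N S (touching S).
have mIS : <<s G >> IS by apply: sub_sigma_algebra; exact: split_pi_I1.
have m0 : <<s G >> set0 by exact: (@measurable0 _ (g_sigma_algebraType G)).
have mI (U V : set (T n)) : <<s G >> U -> <<s G >> V -> <<s G >> (U `&` V).
  exact: (@measurableI _ (g_sigma_algebraType G)).
pose H : set (set (T n)) := [set A | <<s G >> (A `&` IS)].
suff : <<s step2E n >> `<=` H by apply.
apply: smallest_sub.
  split.
  - by rewrite /H /= set0I.
  - move=> B HB; rewrite /H /=.
    rewrite (_ : _ `&` IS = IS `\` (B `&` IS)); last first.
      by apply/seteqP; split => w /=; tauto.
    exact: (@measurableD _ (g_sigma_algebraType G)).
  - move=> F HF; rewrite /H /= setI_bigcupl.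
    exact: (@bigcupT_measurable _ (g_sigma_algebraType G)).
have key (i : 'I_n) (C : set (T n)) : (i \in S -> <<s G >> C) ->
    <<s G >> ([set w | i \in I1 N w /\ C w] `&` IS).
  move=> hC; have [iS|iS] := boolP (i \in S).
    rewrite (_ : _ `&` _ = C `&` IS); first by apply: mI => //; exact: hC.
    by apply/seteqP; split => w /= [h1 h2]; rewrite ?h2; tauto.
  rewrite (_ : _ `&` _ = set0) //; apply/seteqP; split => w //= [[h1 _] h2].
  by rewrite h2 in h1; rewrite h1 in iS.
move=> _ [[[i ->]|[i [j [B [ij mB ->]]]]]|[i [j [B [ij mB ->]]]]]; rewrite /H /=.
- have := key i setT (fun _ => @measurableT _ (g_sigma_algebraType G)).
  congr <<s G >>; apply/seteqP; split => w /=; tauto.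
- apply: (key i [set w | B (Y N w i j)]) => iS.
  by have := measurable_Y ij iS measurableT mB; rewrite setTI.
- apply: (key i [set w | B (W1 N w i j)]) => iS.
  by have := (measurable_W1 hD (S := S) (D := touching S) ij) measurableT _ mB; rewrite setTI.
Qed.

(** Outside {I1 = S} the statistic may depend on other shocks; the value 0 there removes this
    dependence. *)
Lemma measurable_step2 n (S : {set 'I_n}) (g : T n -> R) :
  (forall B, measurable B -> <<s step2E n >> [set w | B (g w)]) ->
  measurable_fun setT ((fun w => if I1 N w == S then g w else 0) : GT n S (touching S) -> R).
Proof.
move=> hg _ B mB; rewrite setTI.
have mIS : <<s split_pi N S (touching S) >> [set w | I1 N w = S].
  by apply: sub_sigma_algebra; exact: split_pi_I1.
rewrite (_ : _ @^-1` B = ([set w | B (g w)] `&` [set w | I1 N w = S]) `|`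
    ([set w | B 0] `\` [set w | I1 N w = S])); last first.
  apply/seteqP; split => w /=; case: eqP; tauto.
apply: (@measurableU _ (GT n S (touching S))); first exact: step2_trace (hg _ mB).
apply: (@measurableD _ (GT n S (touching S))) => //.
have [B0|B0] := pselect (B 0).
  rewrite (_ : [set w | B 0] = setT); first exact: (@measurableT _ (GT n S (touching S))).
  by apply/seteqP; split => w //=.
rewrite (_ : [set w | B 0] = set0); first exact: (@measurable0 _ (GT n S (touching S))).
by apply/seteqP; split => w //=.
Qed.

(** The Chernoff bound wants its bounds at every outcome, while these hold only almost surely or on
    the favorable event. As a measurable cutoff in the weights, the condition costs nothing
    there. *)
Definition admissible n (w : T n) (i j : 'I_n) : bool :=
  (`|W1 N w i j| <= M_W c) && (Lambda_n N w i j <= c_high c * zeta N n).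

Lemma measurable_admissible n S D i j : i != j ->
  measurable_fun setT ((fun w => admissible w i j) : GT n S D -> bool).
Proof.
move=> ij; apply: measurable_and.
  by apply: measurable_fun_ler => //; apply: measurableT_comp => //; exact: (measurable_W1 hD).
apply: measurable_fun_ler => //.
rewrite (_ : (fun w => _) = (fun w => Lambda (link_index N w i j))); last first.
  by apply/funext => w; exact: Lambda_nE.
apply: (measurableT_comp (continuous_measurable_fun continuous_Lambda)).
exact: (measurable_link_index hD).
Qed.

Lemma measurable_W n S D l i j : i != j ->
  measurable_fun setT ((fun w => W N w l i j) : GT n S D -> R).
Proof.
move=> ij; rewrite /W; case: (l == l0); last exact: (measurable_W1 hD).
have -> : (fun w : GT n S D => (const_mx 1 : 'M[R]_n) i j) = (fun=> 1).
  by apply/funext => w; rewrite mxE.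
exact: measurable_cst.
Qed.

(** [noise_wpa1] with [touching S] as the known shocks: for [i] and [j] outside [S] the pair is not
    among them, although the weight comes from Step 2. The hypotheses inside the event state that
    the cutoffs are inactive. *)
Lemma noise_first_step (E : estimators N) (b cF : R) : 0 < b -> cF <= 2^-1 ->
  LR N -> TUNE P N cF -> estimators_ok P E ->
  wpa1 P (fun n w => forall i, i \in I2 N w ->
    (forall j, j != i -> admissible w i j) -> (forall l j k, `|Vh1 E w l j k| <= b) ->
    forall l (k : 'I_(K c l)),
    `|\sum_(j in I2 N w | j != i)
        (Vh1 E w l j k * W N w l i j) * (Y N w i j - Lambda_n N w i j)| <=
    (b * (1 + M_W c)) * (2 * c_high c + 2) * (n%:R * zeta N n * Num.sqrt (log_rate N n))).
Proof.
move=> b0 cF2 hLR hT hE.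
have MW0 := M_W_gt0 hc.
have ch0 : 0 <= c_high c by have /andP[h1 h2] := Lambda_range hc; rewrite (le_trans (ltW h1)).
pose I : finType := {l : 'I_2 & 'I_(K c l)}.
pose g n (S : {set 'I_n}) (k : I) j w := if I1 N w == S then Vh1 E w (tag k) j (tagged k) else 0.
pose a n (S : {set 'I_n}) i (k : I) j w :=
  if (`|g n S k j w| <= b) && admissible w i j then g n S k j w * W N w (tag k) i j else 0.
have := @noise_wpa1 R c dT T P dX dE EX EE N hD hS I (b * (1 + M_W c)) (c_high c) a
  (fun n S => touching S) (fun n S i => i \notin S) _ ch0 (zeta_gt0 hT) (Defs.Theta_sym hLR).
have Wb n (w : T n) i j l : admissible w i j -> `|W N w l i j| <= 1 + M_W c.
  move=> /andP[hW _]; rewrite /W; case: ifP => _; first by rewrite mxE normr1 lerDl ltW.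
  by apply: le_trans hW _; rewrite lerDr.
move=> nz; apply: wpa1_mono (nz _ _ _ _ _ _ _) _.
- by rewrite mulr_gt0 // addr_gt0.
- near=> n; have h : Num.sqrt (log_rate N n) <= cF by near: n; exact: (zeta_rate hT).
  exact: le_trans cF2.
- by move=> n S p /andP[].
- move=> n S i j iS jS ji; rewrite /touching negb_and negb_or; apply/orP; right.
  by rewrite /opair; case: ifP => _ /=; rewrite iS jS.
- move=> n S i k j iS jS ji.
  have ij : i != j by rewrite eq_sym.
  have mg : measurable_fun setT ((fun w => g n S k j w) : GT n S (touching S) -> R).
    by apply: measurable_step2 => B mB; exact: (step2_meas hE).
  apply: measurable_fun_ifT => //.
    apply: measurable_and; last exact: measurable_admissible.
    by apply: measurable_fun_ler => //; exact: measurableT_comp.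
  by apply: measurable_funM => //; exact: measurable_W.
- move=> n S i k j w; rewrite /a; case: ifP => [/andP[h1 h2]|_].
    by rewrite normrM ler_pM // Wb.
  by rewrite normr0 mulr_ge0 ?(ltW b0) // addr_ge0 // ltW.
- by move=> n S i k j w; rewrite /a; case: ifP => [/andP[_ /andP[]]//|]; rewrite eqxx.
apply: nearW => n w h i iI2 hadm hVh l k.
have iN : i \notin I1 N w by move: iI2; rewrite /I2 finset.in_setC.
have := h i (Tagged (fun l => 'I_(K c l)) k) iN.
congr (`|_| <= _); apply: eq_bigr => j /andP[_ ji]; congr (_ * _).
by rewrite /a /g eqxx /= hVh (hadm _ ji).
Unshelve. all: by end_near. Qed.

(** The weights are deterministic up to covariates, so no shock is known in advance and every node
    is allowed. The index [None] stands for the unweighted sum, which later controls the sum of |Y -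
    Lambda|. *)
Lemma noise_second_step (cF : R) : cF <= 2^-1 -> LR N -> TUNE P N cF ->
  wpa1 P (fun n w => forall j,
    (forall i, i != j -> admissible w j i) -> (forall l i k, `|U N n l i k| <= M c) ->
    (forall l (k : 'I_(K c l)),
    `|\sum_(i in I2 N w | i != j)
        (U N n l i k * W N w l j i) * (Y N w j i - Lambda_n N w j i)| <=
    ((1 + M c) * (1 + M_W c)) * (2 * c_high c + 2) * (n%:R * zeta N n * Num.sqrt (log_rate N n))) /\
    `|\sum_(i in I2 N w | i != j) (Y N w j i - Lambda_n N w j i)| <=
    ((1 + M c) * (1 + M_W c)) * (2 * c_high c + 2) * (n%:R * zeta N n * Num.sqrt (log_rate N n))).
Proof.
move=> cF2 hLR hT.
have MW0 := M_W_gt0 hc; have M0 := M_gt0 hc.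
have ch0 : 0 <= c_high c by have /andP[h1 h2] := Lambda_range hc; rewrite (le_trans (ltW h1)).
have M1 : 0 < 1 + M c by rewrite addr_gt0.
have MW1 : 0 < 1 + M_W c by rewrite addr_gt0.
pose I : finType := option {l : 'I_2 & 'I_(K c l)}.
pose g n (k : I) i w j : R := if k is Some k' then
   (if `|U N n (tag k') i (tagged k')| <= M c then U N n (tag k') i (tagged k') else 0)
   * W N w (tag k') j i else 1.
pose a n (S : {set 'I_n}) j (k : I) i w := if admissible w j i then g n k i w j else 0.
have := @noise_wpa1 R c dT T P dX dE EX EE N hD hS I ((1 + M c) * (1 + M_W c)) (c_high c) a
  (fun n S => pred0) (fun n S => predT) _ ch0 (zeta_gt0 hT) (Defs.Theta_sym hLR).
have Wb n (w : T n) i j l : admissible w i j -> `|W N w l i j| <= 1 + M_W c.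
  move=> /andP[hW _]; rewrite /W; case: ifP => _; first by rewrite mxE normr1 lerDl ltW.
  by apply: le_trans hW _; rewrite lerDr.
move=> nz; apply: wpa1_mono (nz _ _ _ _ _ _ _) _.
- exact: mulr_gt0.
- near=> n; have h : Num.sqrt (log_rate N n) <= cF by near: n; exact: (zeta_rate hT).
  exact: le_trans cF2.
- by [].
- by [].
- move=> n S j k i _ iS ij.
  have ji : j != i by rewrite eq_sym.
  apply: measurable_fun_ifT => //; first exact: measurable_admissible.
  rewrite /g; case: k => [k|] //.
  by apply: measurable_funM => //; exact: measurable_W.
- move=> n S j k i w; rewrite /a; case: ifP => [h2|_]; last by rewrite normr0 mulr_ge0 // ltW.
  rewrite /g; case: k => [k|]; last first.
    by rewrite normr1 -[leLHS]mulr1 ler_pM // lerDl ltW.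
  rewrite normrM ler_pM // ?Wb //; case: ifP => [h|_].
    by apply: le_trans h _; rewrite lerDr.
  by rewrite normr0 ltW.
- by move=> n S j k i w; rewrite /a; case: ifP => [/andP[]//|]; rewrite eqxx.
apply: nearW => n w h j hadm hU; split.
  move=> l k; have := h j (Some (Tagged (fun l => 'I_(K c l)) k)) isT.
  congr (`|_| <= _); apply: eq_bigr => i /andP[_ ij]; congr (_ * _).
  by rewrite /a /g /= (hadm _ ij) hU.
have := h j None isT; congr (`|_| <= _); apply: eq_bigr => i /andP[_ ij].
by rewrite /a /g (hadm _ ij) mul1r.
Unshelve. all: by end_near. Qed.

End NoiseInstances.

(** * Energy of the left factors on one half of the split *)

Section Energy.
Context {R : realType} {c : constants R}.
Context {dT : nat -> measure_display} {T : forall n, measurableType (dT n)}.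
Context {dX dE : measure_display}.
Context {EX : measurableType dX} {EE : measurableType dE}.
Variable N : network c T EX EE.

Lemma gram_quad n m d (J : pred 'I_n) (b : R) (F : 'I_n -> 'rV[R]_d) :
  (0 < n)%N -> (n <= 3 * m)%N -> 0 <= b ->
  (forall a, eigenvalue (m%:R^-1 *: \sum_(i | J i) (F i)^T *m F i) a -> b <= a) ->
  forall x, n%:R * (b / 3) * frob x ^+ 2 <= \sum_(i | J i) ip x (F i) ^+ 2.
Proof.
move=> n0 n3 b0 hb x.
have m0 : 0 < m%:R :> R by rewrite ltr0n; case: m n3 {hb} => //; rewrite muln0 leqNgt n0.
apply: (@le_trans _ _ (m%:R * b * frob x ^+ 2)).
  rewrite ler_wpM2r ?sqr_ge0 // mulrA mulrAC ler_wpM2r // ler_pdivrMr //.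
  by rewrite mulrC -[3]/(3%:R) -natrM ler_nat.
have sA : (m%:R^-1 *: \sum_(i | J i) (F i)^T *m F i)^T = m%:R^-1 *: \sum_(i | J i) (F i)^T *m F i.
  rewrite linearZ /= raddf_sum /=; congr (_ *: _); apply: eq_bigr => i _.
  by rewrite trmx_mul trmxK.
have := eigenvalue_quad_ge sA hb x; rewrite -scalemxAr ipZl ler_pdivlMl // -mulrA => /le_trans; apply.
rewrite ipC mulmx_sumr ip_sumr; apply: ler_sum => i _.
have E : x *m (F i)^T = (ip x (F i))%:M.
  apply/matrixP => a b'; rewrite !ord1 !mxE /ip big_ord1 mulr1n.
  by apply: eq_bigr => k _; rewrite mxE.
by rewrite mulmxA E mul_scalar_mx ipZr expr2.
Qed.

Definition energy n (b : R) (S : {set 'I_n}) : Prop :=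
  forall l (q : 'rV[R]_(K c l)), b * n%:R * frob q ^+ 2 <= \sum_(i in S) ip q (row i (U N n l)) ^+ 2.

(** The Gram condition at one arbitrary node [j] suffices: test vectors supported on a single layer
    isolate [U_l], and the covariate weight costs at most [1 + M_W c ^+ 2]. *)
Lemma energy_I2 n (w : T n) : (0 < n)%N -> (n <= 3 * #|I2 N w|)%N -> 0 <= c_phi c ->
  0 <= M_W c ->
  (forall i j, `|W1 N w i j| <= M_W c) ->
  (forall j a, eigenvalue (Psi2 N w j) a -> c_phi c <= a) ->
  energy (c_phi c / (3 * (1 + M_W c ^+ 2))) (I2 N w).
Proof.
move=> n0 n3 c0 MW0 hW h l q; pose j := Ordinal n0.
have B0 : 0 < 1 + M_W c ^+ 2 by rewrite ltr_pwDl // sqr_ge0.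
have -> : c_phi c / (3 * (1 + M_W c ^+ 2)) * n%:R * frob q ^+ 2 =
  (n%:R * (c_phi c / 3) * frob q ^+ 2) / (1 + M_W c ^+ 2).
  by field; rewrite lt0r_neq0.
rewrite ler_pdivrMr // mulr_suml.
have key (F : 'I_n -> R) (D : 'rV[R]_(K c l0 + K c l1)) : frob D ^+ 2 = frob q ^+ 2 ->
   (forall i, ip D (psi N w i j) ^+ 2 <= F i * (1 + M_W c ^+ 2)) ->
   (forall i, 0 <= F i) ->
   n%:R * (c_phi c / 3) * frob q ^+ 2 <= \sum_(i in I2 N w) F i * (1 + M_W c ^+ 2).
  move=> fD hF F0; rewrite -fD; apply: le_trans (gram_quad n0 n3 c0 (h j) D) _.
  rewrite [leRHS](bigID (fun i => i != j)) /=; apply: ler_wpDr.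
    by apply: sumr_ge0 => i _; rewrite mulr_ge0 // ltW.
  by apply: ler_sum => i _.
have [lE|lE] : l = l0 \/ l = l1 by case: l {q key} => -[|[|//]] ?; [left|right]; exact: val_inj.
  subst l; apply: (key _ (row_mx q 0)).
  - by rewrite frob_row_mx frob0 expr0n addr0.
  - move=> i; rewrite /psi ip_row_mx ip0l addr0 ler_peMr ?sqr_ge0 //.
    by rewrite lerDl sqr_ge0.
  - by move=> i; exact: sqr_ge0.
subst l; apply: (key _ (row_mx 0 q)).
- by rewrite frob_row_mx frob0 expr0n add0r.
- move=> i; rewrite /psi ip_row_mx ip0l add0r ipZr exprMn mulrC ler_wpM2l ?sqr_ge0 //.
  apply: (@le_trans _ _ (M_W c ^+ 2)); last by rewrite lerDr.
  by rewrite -real_normK ?num_real // lerXn2r ?nnegrE.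
- by move=> i; exact: sqr_ge0.
Qed.

(** Nested halves differ by at most one row in the unfavorable direction; that row carries at most
    [M c ^+ 2 * frob q ^+ 2], less than half of the energy for large [n]. *)
Lemma energy_near_subset n (b : R) (S S' : {set 'I_n}) : 0 <= b ->
  (#|S'| <= #|S|.+1)%N -> (S \subset S') || (S' \subset S) ->
  (forall l i, frob (row i (U N n l)) <= M c) -> M c ^+ 2 <= b / 2 * n%:R ->
  energy b S' -> energy (b / 2) S.
Proof.
move=> b0 cS sub hU hM h l q; have := h l q; have [sS|sS] := boolP (S' \subset S).
  move=> hq; apply: (@le_trans _ _ (b * n%:R * frob q ^+ 2)).
    rewrite ler_wpM2r ?sqr_ge0 // ler_wpM2r // ler_piMr //; lra.
  apply: le_trans hq _; rewrite [leRHS](big_setID S') /=.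
  rewrite (finset.setIidPr sS) lerDl; apply: sumr_ge0 => i _; exact: sqr_ge0.
have {sub} SS : S \subset S' by move: sub; rewrite (negPf sS) orbF.
rewrite (big_setID S) /= (finset.setIidPr SS).
have : \sum_(i in S' :\: S) ip q (row i (U N n l)) ^+ 2 <= M c ^+ 2 * frob q ^+ 2.
  apply: (@le_trans _ _ (\sum_(i in S' :\: S) M c ^+ 2 * frob q ^+ 2)).
    apply: ler_sum => i _; apply: le_trans (ip_sqr_le _ _) _.
    rewrite -!frob_sqr mulrC ler_wpM2r ?sqr_ge0 // lerXn2r ?nnegrE ?frob_ge0 //.
    exact: le_trans (frob_ge0 _) (hU l i).
  rewrite sumr_const -[leLHS]mulr_natl; apply: ler_piMl.
    by rewrite mulr_ge0 // sqr_ge0.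
  have -> : 1 = 1%:R :> R by [].
  rewrite ler_nat cardsD (finset.setIidPr SS); clear -cS; lia.
have := ler_wpM2r (sqr_ge0 (frob q)) hM; clear; lra.
Qed.

End Energy.

(** * Rates on the favorable event *)

Section Rates.
Context {R : realType} {c : constants R}.
Hypothesis hc : constants_ok c.
Context {dT : nat -> measure_display} {T : forall n, measurableType (dT n)}.
Context {dX dE : measure_display}.
Context {EX : measurableType dX} {EE : measurableType dE}.
Variable N : network c T EX EE.

(** Since zeta_n is at most [(c_low c)^-1] and [ln n] at least 1, terms of order 1/n, which come
    from diagonals, are absorbed by the rate. *)
Lemma inv_n_le n (w : T n) r : (0 < n)%N -> 1 <= ln n%:R :> R -> regular N w r ->
  r <= 1 ->
  n%:R^-1 <= log_rate N n / c_low c /\ n%:R^-1 <= Num.sqrt (log_rate N n) / c_low c.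
Proof.
move=> n0 L1 [z0 zl _ _ _ hr] r1.
have /andP[cl0 _] := Lambda_range hc.
have nR : 0 < n%:R :> R by rewrite ltr0n.
have h : n%:R^-1 <= log_rate N n / c_low c.
  rewrite ler_pdivlMr // /log_rate.
  have -> : ln n%:R / (n%:R * zeta N n) = n%:R^-1 * (ln n%:R / zeta N n) :> R.
    by field; rewrite !lt0r_neq0.
  rewrite ler_wpM2l ?invr_ge0 ?ler0n // ler_pdivlMr //.
  exact: le_trans L1.
split => //; apply: le_trans h _; rewrite ler_wpM2r ?invr_ge0 ?(ltW cl0) //.
have lr0 : 0 <= log_rate N n.
  rewrite divr_ge0 ?mulr_ge0 ?ler0n ?(ltW z0) //; exact: le_trans L1.
rewrite -[leLHS](sqr_sqrtr lr0) expr2 ler_piMl ?sqrtr_ge0 //.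
exact: le_trans r1.
Qed.

Lemma off_sum_Theta n m (f : 'I_m -> 'I_n) (w : T n) r : (1 < n)%N -> (0 < m)%N ->
  1 <= ln n%:R :> R -> regular N w r -> r <= 1 ->
  `|\sum_k \sum_j Theta N n l0 (f k) j| <= m%:R * n%:R * Num.sqrt (log_rate N n) ->
  `|(npairs n m)^-1 * off_sum f (fun k j => Theta N n l0 (f k) j)| <=
    (2 + 2 * M c / c_low c) * Num.sqrt (log_rate N n).
Proof.
move=> n1 m0 L1 reg r1 h; set s := Num.sqrt _ in h *.
have n0 : (0 < n)%N by exact: ltnW.
have [_ inv] := inv_n_le n0 L1 reg r1; rewrite -/s in inv.
have M0 := M_gt0 hc; have hT := reg_Theta reg.
have nR : 0 < n%:R :> R by rewrite ltr0n.
have mR : 0 < m%:R :> R by rewrite ltr0n.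
have n1R : 0 < n.-1%:R :> R by rewrite ltr0n -subn1 subn_gt0.
have nn : n%:R <= 2 * n.-1%:R :> R.
  by rewrite -natrM ler_nat; case: n n1 {w reg h s inv hT n0 nR n1R f L1} => // n; lia.
have s0 : 0 <= s by exact: sqrtr_ge0.
have -> : off_sum f (fun k j => Theta N n l0 (f k) j) =
    \sum_k \sum_j Theta N n l0 (f k) j - \sum_k Theta N n l0 (f k) (f k).
  rewrite /off_sum -sumrB; apply: eq_bigr => k _.
  by rewrite [X in _ = X - _](bigD1 (f k)) //= addrAC subrr add0r.
have NP0 : 0 < npairs n m :> R by rewrite /npairs mulr_gt0.
rewrite normrM ger0_norm ?invr_ge0 ?(ltW NP0) // ler_pdivrMl //.
apply: le_trans (ler_normB _ _) _.
have h2 : `|\sum_k Theta N n l0 (f k) (f k)| <= m%:R * M c.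
  apply: le_trans (ler_norm_sum _ _ _) _.
  apply: le_trans (_ : _ <= \sum_(k < m) M c) _; first by apply: ler_sum => k _.
  by rewrite sumr_const card_ord mulr_natl.
apply: le_trans (lerD h h2) _.
have -> : npairs n m * ((2 + 2 * M c / c_low c) * s) =
  m%:R * (2 * n.-1%:R) * s + m%:R * M c * (2 * n.-1%:R * (s / c_low c)).
  by rewrite /npairs; field; rewrite lt0r_neq0 //; have /andP[] := Lambda_range hc.
apply: lerD; first by rewrite ler_wpM2r // ler_wpM2l // ltW.
rewrite ler_peMr ?mulr_ge0 ?(ltW mR) ?(ltW M0) //.
apply: (@le_trans _ _ (n%:R * n%:R^-1)); first by rewrite mulfV // lt0r_neq0.
by rewrite ler_pM ?invr_ge0 // ltW.
Qed.

Definition e_tau (C1 : R) : R := 3 * Num.sqrt C1 + (2 + 2 * M c / c_low c).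

Lemma tau_rate C1 n m (f : 'I_m -> 'I_n) (w : T n) r (G : 'I_2 -> 'M[R]_(m, n)) :
  0 <= C1 -> (1 < n)%N -> (n <= 4 * m)%N -> 1 <= ln n%:R :> R -> regular N w r -> r <= 1 ->
  `|\sum_k \sum_j Theta N n l0 (f k) j| <= m%:R * n%:R * Num.sqrt (log_rate N n) ->
  \sum_(l < 2) frob (G l - rowsub f (Gamma N n l)) ^+ 2 <= C1 * (n%:R ^+ 2 * log_rate N n) ->
  `|mean_offdiag f G - tau N n| <= e_tau C1 * Num.sqrt (log_rate N n).
Proof.
move=> C10 n1 n4 L1 reg r1 hT hG.
have m0 := rows_gt0 n1 n4.
apply: le_trans (mean_close N f G n1 n4) _.
rewrite [leRHS]mulrDl; apply: lerD; last exact: (off_sum_Theta n1 m0 L1 reg r1 hT).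
have nR : 0 < n%:R :> R by rewrite ltr0n (ltnW n1).
have lr0 : 0 <= log_rate N n.
  rewrite divr_ge0 ?mulr_ge0 ?ler0n ?(ltW (reg_zeta reg)) //; exact: le_trans L1.
have fle : frob (G l0 - rowsub f (Gamma N n l0)) <= n%:R * (Num.sqrt C1 * Num.sqrt (log_rate N n)).
  rewrite -(@ler_pXn2r _ 2) ?nnegrE ?frob_ge0 ?mulr_ge0 ?sqrtr_ge0 ?ler0n //.
  rewrite !exprMn (sqr_sqrtr C10) (sqr_sqrtr lr0) [leRHS]mulrCA; apply: le_trans hG.
  by rewrite sum_I2 lerDl sqr_ge0.
apply: (@le_trans _ _ (3 / n%:R * (n%:R * (Num.sqrt C1 * Num.sqrt (log_rate N n))))).
  by rewrite ler_wpM2l // divr_ge0 // ltW.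
by rewrite le_eqVlt; apply/orP; left; apply/eqP; field; exact: lt0r_neq0.
Qed.

(** The three terms stem from the nuclear norm estimate, the estimate of tau_n and the diagonal set
    to 0. *)
Definition e_Theta (C1 : R) : R :=
  Num.sqrt (3 * C1 + 3 * e_tau C1 ^+ 2 + M c ^+ 2 / c_low c).

Lemma Theta_hat_rate C1 n m (f : 'I_m -> 'I_n) (w : T n) r (G : 'I_2 -> 'M[R]_(m, n)) l :
  0 <= C1 -> (1 < n)%N -> (m <= n)%N -> 1 <= ln n%:R :> R -> regular N w r -> r <= 1 ->
  injective f -> (Theta N n l)^T = Theta N n l ->
  `|mean_offdiag f G - tau N n| <= e_tau C1 * Num.sqrt (log_rate N n) ->
  \sum_(l < 2) frob (G l - rowsub f (Gamma N n l)) ^+ 2 <= C1 * (n%:R ^+ 2 * log_rate N n) ->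
  frob (Theta_hat (c := c) f G l - rowsub f (Theta N n l)) <=
    n%:R * (e_Theta C1 * Num.sqrt (log_rate N n)).
Proof.
move=> C10 n1 mn L1 reg r1 fi sT ht hG.
have n0 : (0 < n)%N by exact: ltnW.
have nR : 0 < n%:R :> R by rewrite ltr0n.
have [inv _] := inv_n_le n0 L1 reg r1.
have /andP[cl0 _] := Lambda_range hc.
have lr0 : 0 <= log_rate N n.
  rewrite divr_ge0 ?mulr_ge0 ?ler0n ?(ltW (reg_zeta reg)) //; exact: le_trans L1.
have E0 : 0 <= 3 * C1 + 3 * e_tau C1 ^+ 2 + M c ^+ 2 / c_low c.
  apply: addr_ge0; last exact: divr_ge0 (sqr_ge0 _) (ltW cl0).
  by apply: addr_ge0; rewrite mulr_ge0 // sqr_ge0.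
rewrite -(@ler_pXn2r _ 2) ?nnegrE ?frob_ge0 //; last first.
  by rewrite mulr_ge0 ?ler0n // mulr_ge0 ?sqrtr_ge0.
rewrite !exprMn (sqr_sqrtr E0) (sqr_sqrtr lr0).
have := Theta_hat_close hc fi sT (fun i j => reg_Theta reg l i j) ht => /le_trans; apply.
have h1 : frob (G l - rowsub f (Gamma N n l)) ^+ 2 <= C1 * (n%:R ^+ 2 * log_rate N n).
  apply: le_trans hG; rewrite (bigD1 l) //= lerDl; apply: sumr_ge0 => k _; exact: sqr_ge0.
have -> : n%:R ^+ 2 * ((3 * C1 + 3 * e_tau C1 ^+ 2 + M c ^+ 2 / c_low c) * log_rate N n) =
  3 * (C1 * (n%:R ^+ 2 * log_rate N n)) + n%:R ^+ 2 * (3 * (e_tau C1 ^+ 2 * log_rate N n)) +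
  n%:R * M c ^+ 2 * (n%:R * (log_rate N n / c_low c)) by ring.
apply: lerD; first apply: lerD.
- by rewrite ler_wpM2l.
- rewrite exprMn (sqr_sqrtr lr0) natrM; apply: ler_wpM2r.
    by apply: mulr_ge0 => //; apply: mulr_ge0 => //; exact: sqr_ge0.
  by rewrite expr2 ler_wpM2r // ler_nat.
- apply: (@le_trans _ _ (n%:R * M c ^+ 2)); first by rewrite ler_wpM2r ?sqr_ge0 // ler_nat.
  apply: ler_peMr; first by rewrite mulr_ge0 ?sqr_ge0.
  by apply: le_trans (ler_wpM2l (ltW nR) inv); rewrite mulfV // lt0r_neq0.
Qed.

End Rates.

Section WeightedNoise.
Context {R : realType} {c : constants R}.

Lemma ip_rV d (x y : 'rV[R]_d) : ip x y = \sum_k x 0 k * y 0 k.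
Proof. by rewrite /ip big_ord1. Qed.

(** The noise bounds concern coordinates of the unrotated regressors, because nothing is known about
    the measurability of [O]. The rotation is moved onto [D], where it preserves norms, and the
    coordinates are summed. *)
Lemma weighted_noise n (J : pred 'I_n) (r v : 'I_n -> R)
    (z : 'I_n -> forall l : 'I_2, 'rV[R]_(K c l)) (O : forall l, 'M[R]_(K c l)) B
    (D : 'rV[R]_(K c l0 + K c l1)) :
  (forall l, (O l)^T *m O l = 1%:M) -> 0 <= B ->
  (forall k, `|\sum_(j | J j) z j l0 0 k * r j| <= B) ->
  (forall k, `|\sum_(j | J j) (z j l1 0 k * v j) * r j| <= B) ->
  \sum_(j | J j) r j * ip D (row_mx (z j l0 *m O l0) (v j *: (z j l1 *m O l1))) <=
    (K c l0 + K c l1)%:R * B * frob D.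
Proof.
move=> oO B0 h0 h1.
pose D0 := lsubmx D *m (O l0)^T; pose D1 := rsubmx D *m (O l1)^T.
have fD0 : frob D0 <= frob D.
  rewrite frob_orthr ?trmxK //; rewrite -{2}[D]hsubmxK -(@ler_pXn2r _ 2) ?nnegrE ?frob_ge0 //.
  by rewrite frob_row_mx lerDl sqr_ge0.
have fD1 : frob D1 <= frob D.
  rewrite frob_orthr ?trmxK //; rewrite -{2}[D]hsubmxK -(@ler_pXn2r _ 2) ?nnegrE ?frob_ge0 //.
  by rewrite frob_row_mx lerDr sqr_ge0.
have -> : \sum_(j | J j) r j * ip D (row_mx (z j l0 *m O l0) (v j *: (z j l1 *m O l1))) =
   \sum_k D0 0 k * (\sum_(j | J j) z j l0 0 k * r j) +
   \sum_k D1 0 k * (\sum_(j | J j) (z j l1 0 k * v j) * r j).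
  under [X in _ = X + _]eq_bigr => k _ do rewrite mulr_sumr.
  under [X in _ = _ + X]eq_bigr => k _ do rewrite mulr_sumr.
  rewrite [X in _ = X + _]exchange_big [X in _ = _ + X]exchange_big /= -big_split /=.
  apply: eq_bigr => j _; rewrite -{1}[D]hsubmxK ip_row_mx ipZr.
  have e l (x : 'rV[R]_(K c l)) : ip x (z j l *m O l) = \sum_k (x *m (O l)^T) 0 k * z j l 0 k.
    by rewrite ipC ip_mulmxr ipC ip_rV.
  rewrite !e mulrDr mulrCA !mulr_sumr; congr (_ + _); apply: eq_bigr => k _; rewrite /D0 /D1; ring.
have key d (x : 'rV[R]_d) (F : 'I_d -> R) : frob x <= frob D -> (forall k, `|F k| <= B) ->
    \sum_k x 0 k * F k <= d%:R * (B * frob D).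
  move=> hx hF; apply: le_trans (_ : _ <= \sum_(k < d) B * frob D) _; last first.
    by rewrite sumr_const card_ord mulr_natl.
  apply: ler_sum => k _; apply: le_trans (ler_norm _) _; rewrite normrM mulrC.
  by rewrite ler_pM // (le_trans (normr_le_frob _ _ _)).
by rewrite natrD -mulrA mulrDl lerD // key.
Qed.

End WeightedNoise.

Section Stage.
Context {R : realType} {c : constants R}.
Context {dT : nat -> measure_display} {T : forall n, measurableType (dT n)}.
Context {dX dE : measure_display}.
Context {EX : measurableType dX} {EE : measurableType dE}.
Variable N : network c T EX EE.

(** The favorable event at a fixed [n] and outcome, as far as it is common to both regressions. *)
Record sample_ok n (w : T n) (r : R) : Prop := SampleOk {
  so_reg : regular N w r;
  so_n : (1 < n)%N;
  so_ln : 1 <= ln n%:R :> R;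
  so_sym : forall l, (Theta N n l)^T = Theta N n l;
  so_svd : forall l, n%:R^-1 *: Theta N n l = calU N n l *m Sigma N n l *m (calV N n l)^T;
  so_calV : forall l, (calV N n l)^T *m calV N n l = 1%:M;
  so_rows : forall l i, frob (row i (U N n l)) <= M c /\ frob (row i (V N n l)) <= M c;
  so_I1 : (n <= 4 * #|I1 N w|)%N;
  so_I2 : (n <= 3 * #|I2 N w|)%N;
  so_Lambda : forall i j, i != j -> Lambda_n N w i j <= c_high c * zeta N n;
  so_Psi : forall j a, eigenvalue (Psi2 N w j) a -> c_phi c <= a;
  so_Phi : forall i a, i \in I2 N w -> eigenvalue (Phi2 N w i) a -> c_phi c <= a }.

Lemma Theta_UV n (w : T n) r l : sample_ok w r ->
  Theta N n l = Num.sqrt n%:R *: (U N n l *m (calV N n l)^T).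
Proof.
move=> so; have n0 : (n%:R : R) != 0 by rewrite pnatr_eq0 -lt0n ltnW // (so_n so).
rewrite /U -scalemxAl scalerA -expr2 sqr_sqrtr ?ler0n // -(so_svd so).
by rewrite scalerA mulfV // scale1r.
Qed.

Lemma Theta_ip n (w : T n) r l i j : sample_ok w r ->
  Theta N n l i j = ip (row i (U N n l)) (row j (V N n l)).
Proof.
move=> so; rewrite (Theta_UV l so) ip_rV mxE mxE mulr_sumr.
by apply: eq_bigr => k _; rewrite /V !mxE; ring.
Qed.

Lemma link_step3 n (w : T n) r i j : sample_ok w r ->
  link_index N w i j = step3_index (ln (zeta N n)) (W1 N w i j)
    (fun l => row i (U N n l)) (fun l => row j (V N n l)).
Proof.
move=> so; rewrite /link_index /step3_index -!(Theta_ip _ _ _ so) /tau.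
ring.
Qed.

Lemma step3_loglikE n (w : T n) t i j (mu a : forall l, 'rV[R]_(K c l)) :
  step3_loglik N w t i j mu a =
  loglik (Y N w i j) (Lambda (step3_index t (W1 N w i j) mu a)).
Proof. by rewrite /step3_loglik sum_I2 /step3_index !ip_rV /W /= mxE mulr1. Qed.

Lemma sum_rows_of n (S : {set 'I_n}) (F : 'I_n -> R) :
  \sum_(k < #|S|) F (rows_of k) = \sum_(i in S) F i.
Proof. by rewrite [RHS]big_enum_val. Qed.

Lemma energy_frob n (S : {set 'I_n}) b l (q : 'cV[R]_(K c l)) : energy N b S ->
  b * n%:R * frob q ^+ 2 <= frob (rowsub (@rows_of n S) (U N n l) *m q) ^+ 2.
Proof.
move=> h; rewrite -(frob_tr q); apply: le_trans (h l _) _.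
rewrite -sum_rows_of frob_sqr [leRHS]/ip; apply: ler_sum => k _; rewrite big_ord1 -expr2.
rewrite le_eqVlt; apply/orP; left; apply/eqP; congr (_ ^+ 2).
by rewrite ip_rV mxE; apply: eq_bigr => j _; rewrite !mxE mulrC.
Qed.

Lemma rows_of_inj n (S : {set 'I_n}) : injective (@rows_of n S).
Proof. exact: enum_val_inj. Qed.

Lemma Vhat_bound n (w : T n) r l (A : 'M[R]_(#|I1 N w|, n)) (X Vh : 'M[R]_(n, K c l)) O b a e :
  sample_ok w r -> 0 < b -> 0 < M c ->
  energy N b (I1 N w) -> top_right_sv (n%:R^-1 *: A) X -> Vh = Num.sqrt n%:R *: X ->
  (forall k j, `|A k j| <= M c) -> O^T *m O = 1%:M ->
  frob (V N n l - Vh *m O) <= a * Num.sqrt n%:R ->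
  frob (A - rowsub (@rows_of n (I1 N w)) (Theta N n l)) <= n%:R * e ->
  M c * a + e <= Num.sqrt b / 2 ->
  forall j k, `|Vh j k| <= 2 * M c / Num.sqrt b.
Proof.
move=> so b0 M0 hE hX -> hA oO hV hT hae j k; rewrite mxE.
have n0 : (0 < n)%N by exact: ltnW (so_n so).
have sn0 : 0 < Num.sqrt n%:R :> R by rewrite sqrtr_gt0 ltr0n.
apply: (@sv_row_bound _ _ _ _ A (rowsub (@rows_of n (I1 N w)) (Theta N n l)) X (calV N n l)
  (rowsub (@rows_of n (I1 N w)) (U N n l)) O (M c) b a e) => //; try exact: ltW.
- by rewrite -[leqRHS](card_ord n) max_card.
- by rewrite -(reg_rank (so_reg so)) rank_leq_row.
- exact: so_calV so l.
- rewrite {1}(Theta_UV l so); apply/matrixP => k' j'; rewrite !mxE; congr (_ * _).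
  by apply: eq_bigr => p _; rewrite !mxE.
- by move=> i p; rewrite mxE (reg_Theta (so_reg so)).
- rewrite -(ler_pM2l sn0) [leRHS]mulrC -[X in X * _](ger0_norm (ltW sn0)) -frobZ.
  by rewrite scalerBr scalemxAl.
- by move=> q; exact: energy_frob.
Qed.

End Stage.

Section SampleRate.
Context {R : realType} {c : constants R}.
Context {dT : nat -> measure_display} {T : forall n, measurableType (dT n)}.
Context {dX dE : measure_display}.
Context {EX : measurableType dX} {EE : measurableType dE}.
Variable N : network c T EX EE.

Lemma sqrt_log_rate_gt0 n (w : T n) r : sample_ok N w r -> 0 < Num.sqrt (log_rate N n).
Proof.
move=> so; have n0 : (0 < n)%N by exact: ltnW (so_n so).
rewrite sqrtr_gt0 divr_gt0 ?mulr_gt0 ?ltr0n ?(reg_zeta (so_reg so)) //.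
exact: lt_le_trans (so_ln so).
Qed.

Lemma eta_bounds n (w : T n) r : sample_ok N w r -> r <= 1 ->
  [/\ 0 < eta N n, Num.sqrt (log_rate N n) <= eta N n &
      eta N n <= 2 * Num.sqrt (log_rate N n)].
Proof.
move=> so r1; have s0 := sqrt_log_rate_gt0 so.
have hs := le_trans (reg_rate (so_reg so)) r1.
have lr : log_rate N n = Num.sqrt (log_rate N n) ^+ 2.
  by rewrite sqr_sqrtr // ltW // -sqrtr_gt0.
have h : Num.sqrt (log_rate N n) <= eta N n by rewrite /eta lerDl lr sqr_ge0.
split => //; first exact: lt_le_trans h.
by rewrite /eta [X in _ + X]lr mulr_natl mulr2n lerD2l expr2 ler_piMl ?(ltW s0).
Qed.

End SampleRate.

(** Instance of [step3_rate] with regressors [v_j]: the Gram matrix is [Phi2], mean-square closeness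
    is the Frobenius alignment bound, and entries bounded by [b] give rows of norm at most
    [k0 * b]. *)
Lemma first_regression {R : realType} (c : constants R) (e0 e1 b B : R) :
  constants_ok c -> 0 <= e0 -> 0 < e1 -> 0 < b -> 0 <= B ->
  exists C h0, [/\ 0 < C, 0 < h0 &
  forall (dT : nat -> measure_display) (T : forall n, measurableType (dT n))
    (dX dE : measure_display) (EX : measurableType dX) (EE : measurableType dE)
    (N : network c T EX EE) n (w : T n) (r t : R) (Vh : forall l, 'M[R]_(n, K c l))
    (O : forall l, 'M[R]_(K c l)) i (mu : forall l, 'rV[R]_(K c l)),
  sample_ok N w r -> r <= 1 -> eta N n <= h0 -> (forall l, (O l)^T *m O l = 1%:M) ->
  `|t - tau N n| <= e0 * eta N n ->
  (forall l, frob (V N n l - Vh l *m O l) <= e1 * Num.sqrt n%:R * eta N n) ->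
  (forall l j k, `|Vh l j k| <= b) -> i \in I2 N w ->
  (forall l k, `|\sum_(j in I2 N w | j != i)
        (Vh l j k * W N w l i j) * (Y N w i j - Lambda_n N w i j)| <=
     B * (n%:R * zeta N n * eta N n)) ->
  maximizes (fun mu => \sum_(j in I2 N w | j != i)
         step3_loglik N w t i j mu (fun l => row j (Vh l))) mu ->
  forall l, frob (mu l *m O l - row i (U N n l)) <= C * eta N n].
Proof.
move=> hc e00 e10 b0 B0; pose k0 : R := (K c l0 + K c l1)%:R.
have k00 : 1 <= k0 by rewrite ler1n addn_gt0 (K_gt0 hc).
have kp : 0 <= k0 by exact: le_trans k00.
have /andP[cp0 _] := phi_range hc.
have [C [h0 [C0 h00 hC]]] := @step3_rate R c hc e0 e1 (k0 * B) (k0 * b) (c_phi c / 3)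
  e00 e10 (mulr_ge0 kp B0) (mulr_gt0 (lt_le_trans ltr01 k00) b0) (divr_gt0 cp0 (ltr0n _ 3)).
exists C, h0; split => // dT T dX dE EX EE N n w r t Vh O i mu so r1 eh oO ht hV hb iI2 hn hm.
have [eta0 _ _] := eta_bounds so r1.
have n0 : (0 < n)%N by exact: ltnW (so_n so).
have reg := so_reg so.
have z0 := reg_zeta reg.
have rowO l : (O l) *m (O l)^T = 1%:M by apply: mulmx1C.
apply: (hC n (fun j => (j \in I2 N w) && (j != i)) (fun j => Y N w i j) (fun j => W1 N w i j)
  (zeta N n) (eta N n) t (fun j l => row j (Vh l)) (fun j l => row j (V N n l)) O
  (fun l => row i (U N n l)) mu) => //.
- exact: reg_zeta_le reg.
- exact: reg_W reg i.
- by move=> l; have [] := so_rows so l i.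
- by move=> j l; have [] := so_rows so l j.
- move=> j l _; rewrite frob_orthr //.
  have Kl : (K c l)%:R <= k0 ^+ 2.
    apply: (@le_trans _ _ k0); last by rewrite expr2 ler_peMl.
    rewrite ler_nat; have [->|->] : l = l0 \/ l = l1
      by case: l => -[|[|//]] ?; [left|right]; exact: val_inj.
    - exact: leq_addr.
    - exact: leq_addl.
  rewrite -(@ler_pXn2r _ 2) ?nnegrE ?frob_ge0 //; last by rewrite mulr_ge0 // ltW.
  apply: le_trans (frob_le_const (ltW b0) (_ : forall a k, `|row j (Vh l) a k| <= b)) _.
    by move=> a k; rewrite mxE.
  by rewrite mul1n exprMn ler_wpM2r ?sqr_ge0.
- move=> l.
  apply: (@le_trans _ _ (frob (V N n l - Vh l *m O l) ^+ 2)); last first.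
    apply: (@le_trans _ _ ((e1 * Num.sqrt n%:R * eta N n) ^+ 2)).
      rewrite lerXn2r ?nnegrE ?frob_ge0 //; exact: le_trans (frob_ge0 _) (hV l).
    have -> : (e1 * Num.sqrt n%:R * eta N n) ^+ 2 = Num.sqrt n%:R ^+ 2 * (e1 * eta N n) ^+ 2 by ring.
    by rewrite sqr_sqrtr.
  rewrite -frobN opprB frob_sum_row [leRHS](bigID (fun j => (j \in I2 N w) && (j != i))) /=.
  apply: ler_wpDr; first by apply: sumr_ge0 => j _; exact: sqr_ge0.
  by apply: ler_sum => j _; rewrite linearB /= row_mul.
- move=> D; exact: (gram_quad n0 (so_I2 so) (ltW cp0) (fun a => so_Phi so iI2 (a := a)) D).
- move=> D.
  have -> : k0 * B * (n%:R * zeta N n * eta N n) * frob D =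
     k0 * (B * (n%:R * zeta N n * eta N n)) * frob D by ring.
  under eq_bigr => j _ do rewrite -(link_step3 i j so) -Lambda_nE.
  apply: (@weighted_noise _ _ _ (fun j => (j \in I2 N w) && (j != i))
    (fun j => Y N w i j - Lambda_n N w i j) (fun j => W1 N w i j)
    (fun j l => row j (Vh l)) O) => //.
  + by rewrite !mulr_ge0 ?ler0n // ltW.
  + move=> k; have := hn l0 k; congr (`|_| <= _); apply: eq_bigr => j _.
    by rewrite /W /= !mxE mulr1.
  + move=> k; have := hn l1 k; congr (`|_| <= _); apply: eq_bigr => j _.
    by rewrite /W /= !mxE.
- move: hm; congr maximizes; apply/funext => mu'; apply: eq_bigr => j _.
  by rewrite step3_loglikE.
Qed.

Lemma frob_row_mx_le {R : realType} d d' (x : 'rV[R]_d) (y : 'rV[R]_d') v e w :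
  0 <= w -> frob x <= e -> frob y <= e -> `|v| <= w -> frob (row_mx x (v *: y)) <= e * (1 + w).
Proof.
move=> w0 hx hy hv; have e0 := le_trans (frob_ge0 _) hx.
rewrite -(@ler_pXn2r _ 2) ?nnegrE ?frob_ge0 //; last by rewrite mulr_ge0 // addr_ge0.
rewrite frob_row_mx frobZ.
apply: (@le_trans _ _ (e ^+ 2 + (w * e) ^+ 2)).
  apply: lerD; rewrite lerXn2r ?nnegrE ?frob_ge0 ?mulr_ge0 ?frob_ge0 //.
  by rewrite ler_pM ?frob_ge0.
have -> : (e * (1 + w)) ^+ 2 = e ^+ 2 + (w * e) ^+ 2 + 2 * w * e ^+ 2 by ring.
by rewrite lerDl !mulr_ge0 // sqr_ge0.
Qed.

(** Instance of [step3_rate] with the roles of the two factors exchanged and [Psi2] as Gram matrix.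
    Here the regressors are close row by row, which also bounds their norms by [M c + e1]. *)
Lemma second_regression {R : realType} (c : constants R) (e0 e1 B : R) :
  constants_ok c -> 0 <= e0 -> 0 < e1 -> 0 <= B ->
  exists C h0, [/\ 0 < C, 0 < h0 &
  forall (dT : nat -> measure_display) (T : forall n, measurableType (dT n))
    (dX dE : measure_display) (EX : measurableType dX) (EE : measurableType dE)
    (N : network c T EX EE) n (w : T n) (r t : R) (Uh : forall l, 'M[R]_(n, K c l))
    (O : forall l, 'M[R]_(K c l)) j (mu : forall l, 'rV[R]_(K c l)),
  sample_ok N w r -> r <= 2^-1 -> eta N n <= h0 -> (forall l, (O l)^T *m O l = 1%:M) ->
  `|t - tau N n| <= e0 * eta N n ->
  (forall l i, i \in I2 N w -> frob (row i (Uh l) *m O l - row i (U N n l)) <= e1 * eta N n) ->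
  (forall l k, `|\sum_(i in I2 N w | i != j)
        (U N n l i k * W N w l i j) * (Y N w i j - Lambda_n N w i j)| <=
     B * (n%:R * zeta N n * eta N n)) ->
  `|\sum_(i in I2 N w | i != j) (Y N w i j - Lambda_n N w i j)| <= B * (n%:R * zeta N n * eta N n) ->
  maximizes (fun mu => \sum_(i in I2 N w | i != j)
         step3_loglik N w t i j mu (fun l => row i (Uh l))) mu ->
  forall l, frob (mu l *m O l - row j (V N n l)) <= C * eta N n].
Proof.
move=> hc e00 e10 B0; pose k0 : R := (K c l0 + K c l1)%:R.
have kp : 0 <= k0 by exact: ler0n.
have MW0 := M_W_gt0 hc; have M0 := M_gt0 hc.
have /andP[cl0 clh] := Lambda_range hc.
have ch0 := lt_le_trans cl0 clh.
have /andP[cp0 _] := phi_range hc.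
(* Score at the true [u_i], plus the effect of replacing them: row error [e1 * (1 + M_W c)] times
   the bound on the sum of |Y - Lambda|. *)
pose e2 := k0 * B + (B + 2 * c_high c) * (e1 * (1 + M_W c)).
have e20 : 0 <= e2.
  by rewrite addr_ge0 ?mulr_ge0 ?addr_ge0 ?mulr_ge0 // ltW.
have [C [h0 [C0 h00 hC]]] := @step3_rate R c hc e0 e1 e2 (M c + e1) (c_phi c / 3)
  e00 e10 e20 (addr_gt0 M0 e10) (divr_gt0 cp0 (ltr0n _ 3)).
exists C, h0; split => // dT T dX dE EX EE N n w r t Uh O j mu so r1 eh oO ht hU hn hd hm.
have r1' : r <= 1 by apply: le_trans r1 _; rewrite invf_le1 ?ler1n.
have [eta0 _ eta2] := eta_bounds so r1'.
have eta1 : eta N n <= 1.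
  apply: le_trans eta2 _; rewrite -ler_pdivlMl // mulr1; exact: le_trans (reg_rate (so_reg so)) r1.
have n0 : (0 < n)%N by exact: ltnW (so_n so).
have reg := so_reg so.
have z0 := reg_zeta reg.
have sTheta l a b : Theta N n l a b = Theta N n l b a by rewrite -{1}(so_sym so l) mxE.
have nR : 0 < n%:R :> R by rewrite ltr0n.
have nz0 : 0 <= n%:R * zeta N n by rewrite mulr_ge0 // ltW.
apply: (hC n (fun i => (i \in I2 N w) && (i != j)) (fun i => Y N w i j) (fun i => W1 N w i j)
  (zeta N n) (eta N n) t (fun i l => row i (Uh l)) (fun i l => row i (U N n l)) O
  (fun l => row j (V N n l)) mu) => //.
- exact: reg_zeta_le reg.
- by move=> i; exact: reg_W reg i j.
- by move=> l; have [] := so_rows so l j.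
- by move=> i l; have [] := so_rows so l i.
- move=> i l /andP[iI2 _]; rewrite -[_ *m _](subrK (row i (U N n l))) addrC.
  apply: le_trans (frobD _ _) _; apply: lerD; first by have [] := so_rows so l i.
  by apply: le_trans (hU l i iI2) _; rewrite ler_piMr // ltW.
- move=> l; apply: (@le_trans _ _ (\sum_(i < n) (e1 * eta N n) ^+ 2)); last first.
    by rewrite sumr_const card_ord mulr_natl.
  rewrite [leRHS](bigID (fun i => (i \in I2 N w) && (i != j))) /=.
  apply: ler_wpDr; first by apply: sumr_ge0 => i _; exact: sqr_ge0.
  apply: ler_sum => i /andP[iI2 _]; rewrite lerXn2r ?nnegrE ?frob_ge0 ?mulr_ge0 ?(ltW e10) ?(ltW eta0) //.
  exact: hU.
- move=> D; exact: (gram_quad n0 (so_I2 so) (ltW cp0) (so_Psi so (j := j)) D).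
- move=> D.
  have LE i : i != j -> Lambda (step3_index (ln (zeta N n)) (W1 N w i j)
      (fun l => row j (V N n l)) (fun l => row i (U N n l))) = Lambda_n N w i j.
    move=> ij; rewrite Lambda_nE (link_step3 i j so); congr Lambda.
    by rewrite /step3_index; congr (_ + (_ + _ * _)); rewrite ipC.
  have E : \sum_(i | (i \in I2 N w) && (i != j))
      (Y N w i j - Lambda (step3_index (ln (zeta N n)) (W1 N w i j)
         (fun l => row j (V N n l)) (fun l => row i (U N n l)))) *
      ip D (row_mx (row i (Uh l0) *m O l0) (W1 N w i j *: (row i (Uh l1) *m O l1))) =
    \sum_(i | (i \in I2 N w) && (i != j)) (Y N w i j - Lambda_n N w i j) *
      ip D (row_mx (row i (U N n l0) *m 1%:M) (W1 N w i j *: (row i (U N n l1) *m 1%:M))) +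
    \sum_(i | (i \in I2 N w) && (i != j)) (Y N w i j - Lambda_n N w i j) *
      ip D (row_mx (row i (Uh l0) *m O l0 - row i (U N n l0))
          (W1 N w i j *: (row i (Uh l1) *m O l1 - row i (U N n l1)))).
    rewrite -big_split /=; apply: eq_bigr => i /andP[_ ij]; rewrite LE // -mulrDr -ipDr.
    rewrite add_row_mx !mulmx1 -scalerDr; congr (_ * ip D (row_mx _ (_ *: _))).
      by rewrite addrC subrK.
    by rewrite addrC subrK.
  rewrite E.
  have -> : e2 * (n%:R * zeta N n * eta N n) * frob D =
     k0 * (B * (n%:R * zeta N n * eta N n)) * frob D +
     (B * (n%:R * zeta N n) + 2 * (c_high c * zeta N n * n%:R)) * (e1 * eta N n * (1 + M_W c) * frob D).
    by rewrite /e2; ring.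
  apply: lerD.
    apply: (@weighted_noise _ _ _ (fun i => (i \in I2 N w) && (i != j))
      (fun i => Y N w i j - Lambda_n N w i j) (fun i => W1 N w i j) (fun i l => row i (U N n l)) (fun l => 1%:M)).
    + by move=> l; rewrite trmx1 mulmx1.
    + by rewrite !mulr_ge0 ?ler0n // ltW.
    + move=> k; have := hn l0 k; congr (`|_| <= _); apply: eq_bigr => i _.
      by rewrite /W /= !mxE mulr1.
    + move=> k; have := hn l1 k; congr (`|_| <= _); apply: eq_bigr => i _.
      by rewrite /W /= !mxE.
  have Y01 i : 0 <= Y N w i j.
    by rewrite /Y /edge; case: ifP => _; rewrite ?ler0n //; case: ifP => _; rewrite ?ler0n.
  have L0 i : 0 <= Lambda_n N w i j by rewrite /Lambda_n ltW // Lambda_gt0.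
  (* As [Y] and [Lambda] are nonnegative, |Y - Lambda| is at most (Y - Lambda) + 2 Lambda; the
     centred sum is then controlled without its absolute values. *)
  apply: (@le_trans _ _ (\sum_(i in I2 N w | i != j)
     ((Y N w i j - Lambda_n N w i j) + 2 * (c_high c * zeta N n)) * (e1 * eta N n * (1 + M_W c) * frob D))).
    apply: ler_sum => i /andP[iI2 ij]; apply: le_trans (ler_norm _) _; rewrite normrM ler_pM //.
      have := so_Lambda so ij; have := Y01 i; have := L0 i.
      rewrite ler_norml; clear; lra.
    apply: le_trans (normr_ip _ _) _; rewrite mulrC ler_wpM2r ?frob_ge0 //.
    by apply: frob_row_mx_le; rewrite ?(ltW MW0) ?hU //; exact: reg_W reg i j.
  rewrite -mulr_suml; apply: ler_wpM2r.
    apply: mulr_ge0; last exact: frob_ge0.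
    exact: (mulr_ge0 (mulr_ge0 (ltW e10) (ltW eta0)) (addr_ge0 ler01 (ltW MW0))).
  rewrite big_split /= lerD //.
    apply: le_trans (ler_norm _) _; apply: le_trans hd _.
    by rewrite ler_wpM2l // ler_piMr.
  rewrite sumr_const -[leLHS]mulr_natr -mulrA ler_wpM2l // ler_wpM2l //.
    by rewrite mulr_ge0 // ltW.
  by rewrite ler_nat -[leqRHS](card_ord n) max_card.
- move: hm; congr maximizes; apply/funext => mu'; apply: eq_bigr => i _.
  by rewrite step3_loglikE.
Qed.

(** * The favorable event and the final assembly *)

Section Events.
Context {R : realType} {c : constants R}.
Hypothesis hc : constants_ok c.
Context {dT : nat -> measure_display} {T : forall n, measurableType (dT n)}.
Variable P : forall n, probability (T n) R.
Context {dX dE : measure_display}.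
Context {EX : measurableType dX} {EE : measurableType dE}.
Variable N : network c T EX EE.
Hypotheses (hD : DGP P N) (hS : random_split P N).

Lemma split_sizes n (w : T n) : (1 < n)%N ->
  (n <= 4 * #|I1 N w|)%N /\ (n <= 3 * #|I2 N w|)%N.
Proof.
move=> n1; have [k [/andP[k1 k2] cI _ _ _]] := hS n.
have := cardsC (I1 N w); rewrite card_ord -/(I2 N w) (cI w) => E.
by split; lia.
Qed.

Lemma W1_wpa1 : wpa1 P (fun n w => forall i j, `|W1 N w i j| <= M_W c).
Proof. by apply: wpa1_ae; apply: nearW => n; exact: (W1_bound hD). Qed.

(** The eigenvalue condition bounds the energy only on I2; the split transfer carries it to I1, and
    the final [/ 2] pays for the row by which the halves may differ. *)
Lemma energy_wpa1 : LR N -> EIG_split P N ->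
  wpa1 P (fun n w => energy N (c_phi c / (3 * (1 + M_W c ^+ 2)) / 2) (I1 N w)).
Proof.
move=> hLR hE; set b := c_phi c / _.
have /andP[cp0 _] := phi_range hc.
have MW0 := M_W_gt0 hc.
have b0 : 0 < b by rewrite divr_gt0 // mulr_gt0 // ltr_pwDl // sqr_ge0.
have b2 : 0 < b / 2 by exact: divr_gt0.
apply: (wpa1_split_transfer hS (Q := fun n S => energy N b S)
  (Q' := fun n S => energy N (b / 2) S)).
  near=> n => S S' _ _ cS sub; apply: energy_near_subset (ltW b0) cS sub _ _.
    have hr : forall l (i : 'I_n), enorm (row i (U N n l))^T <= M c /\ enorm (row i (V N n l))^T <= M c.
      by near: n; exact: row_bound hLR.
    by move=> l i; have [+ _] := hr l i; rewrite enormE frob_tr.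
  rewrite -ler_pdivrMl //.
  near: n; exact: nbhs_infty_ger.
have ev := wpa1_and W1_wpa1 hE.
apply: (wpa1_mono ev); near=> n => w [hW [hP _]].
have n1 : (1 < n)%N by near: n; exact: nbhs_infty_gt.
have [_ h3] := split_sizes w n1.
apply: energy_I2 => //; try exact: ltW.
  exact: ltnW.
by move=> j a /hP /andP[].
Unshelve. all: by end_near. Qed.

Lemma Y_sym n (w : T n) i j : Y N w i j = Y N w j i.
Proof. by rewrite /Y; case: ltngtP. Qed.

Lemma Lambda_n_sym n (w : T n) i j : (forall l, (Theta N n l)^T = Theta N n l) ->
  Lambda_n N w i j = Lambda_n N w j i.
Proof.
move=> sT; have e l : Theta N n l i j = Theta N n l j i by rewrite -{1}(sT l) mxE.
by rewrite !Lambda_nE /link_index (W1_sym hD) (e l0) (e l1).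
Qed.

Lemma W_sym n (w : T n) l i j : W N w l i j = W N w l j i.
Proof. by rewrite /W; case: ifP => _; [rewrite !mxE | exact: (W1_sym hD)]. Qed.

End Events.

Lemma Theta_hat_le {R : realType} (c : constants R) n m (f : 'I_m -> 'I_n)
    (G : 'I_2 -> 'M[R]_(m, n)) l k j : 0 <= M c -> `|Theta_hat (c := c) f G l k j| <= M c.
Proof.
move=> M0; rewrite mxE; case: ifP => _; first by rewrite normr0.
by case: pickP => [k' _|_]; exact: trunc_bound.
Qed.

Theorem theorem4p2 (R : realType) (c : constants R) (hc : constants_ok c) :
  (* the smallness threshold for c_F depends only on the other constants *)
  exists2 cF0 : R, 0 < cF0 &
  forall c_F : R, 0 < c_F -> c_F <= cF0 -> c_F <= 4^-1 ->
  forall (dT : nat -> measure_display) (T : forall n, measurableType (dT n))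
    (P : forall n, probability (T n) R)
    (dX dE : measure_display)
    (EX : measurableType dX) (EE : measurableType dE)
    (N : network c T EX EE) (E : estimators N),
  DGP P N -> random_split P N -> LR N -> RSC P N -> TUNE P N c_F ->
  EIG_split P N -> estimators_ok P E ->
  exists C1 C0v : R, forall l : 'I_2,
    wpa1 P (fun n w =>
      (forall i, i \in I2 N w ->
         enorm ((Oh1 E w l)^T *m (row i (Uh1 E w l))^T - (row i (U N n l))^T)
         <= C1 * eta N n) /\
      (forall j,
         enorm ((Oh1 E w l)^T *m (row j (Vd E w l))^T - (row j (V N n l))^T)
         <= C0v * eta N n)).
Proof.
have M0 := M_gt0 hc; have MW0 := M_W_gt0 hc.
have /andP[cp0 _] := phi_range hc.
have /andP[cl0 clh] := Lambda_range hc.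
have ch0 := lt_le_trans cl0 clh.
have [C1 [cF1 [n0 [C10 cF10 n01 hstep]]]] := step1_rate hc.
pose bI := c_phi c / (3 * (1 + M_W c ^+ 2)) / 2.
have bI0 : 0 < bI by rewrite divr_gt0 // divr_gt0 // mulr_gt0 // ltr_pwDl // sqr_ge0.
have sbI0 : 0 < Num.sqrt bI by rewrite sqrtr_gt0.
pose bv := 2 * M c / Num.sqrt bI.
have bv0 : 0 < bv by rewrite divr_gt0 // mulr_gt0.
(* The absolute value provides a sign without inspecting [C_F2]; the later [A + 1] makes the
   constant strictly positive. *)
pose A := `|136 * C_F2 c|.
have A0 : 0 <= A by exact: normr_ge0.
pose et := e_tau (c := c) C1.
have et0 : 0 <= et.
  apply: addr_ge0; first by rewrite mulr_ge0 ?sqrtr_ge0.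
  by rewrite addr_ge0 // divr_ge0 ?mulr_ge0 // ltW.
pose ET := e_Theta (c := c) C1.
have ET0 : 0 <= ET by exact: sqrtr_ge0.
have ch2 : 0 <= 2 * c_high c + 2 by rewrite addr_ge0 // mulr_ge0 // ltW.
pose B1 := bv * (1 + M_W c) * (2 * c_high c + 2).
have MW1 : 0 <= 1 + M_W c := addr_ge0 ler01 (ltW MW0).
have B10 : 0 <= B1 := mulr_ge0 (mulr_ge0 (ltW bv0) MW1) ch2.
have [Cu [hu [Cu0 hu0 hreg1]]] :=
  @first_regression R c et (A + 1) bv B1 hc et0 (ltr_wpDl A0 ltr01) bv0 B10.
pose B2 := (1 + M c) * (1 + M_W c) * (2 * c_high c + 2).
have B20 : 0 <= B2 := mulr_ge0 (mulr_ge0 (addr_ge0 ler01 (ltW M0)) MW1) ch2.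
have [Cv [hv [Cv0 hv0 hreg2]]] := @second_regression R c et Cu B2 hc et0 Cu0 B20.
pose D2 := 2 * M c * A + ET + 1.
have D20 : 0 < D2.
  apply: ltr_wpDl => //; apply: addr_ge0 => //.
  exact: (mulr_ge0 (mulr_ge0 (ler0n _ 2) (ltW M0)) A0).
(* Solves [D2 * cF2 = Num.sqrt bI / 2], the smallness needed for the entrywise bound [bv] on hat
   V. *)
pose cF2 := Num.sqrt bI / (2 * D2).
have cF20 : 0 < cF2 by rewrite divr_gt0 // mulr_gt0.
(* The halves of [hu] and [hv] account for [eta] being at most twice the square root of [log_rate],
   hence at most [2 * cF]. *)
exists (Num.min (Num.min cF1 cF2) (Num.min (hu / 2) (hv / 2))).
  by rewrite !lt_min cF10 cF20 !divr_gt0.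
move=> cF cFp; rewrite !le_min => /andP[/andP[cFa cFb] /andP[cFc cFd]] cF4.
move=> dT T P dX dE EX EE N E hD hS hLR hRSC hT hEIG hE.
have cF2i : cF <= 2^-1 by apply: le_trans cF4 _; rewrite lef_pV2 ?posrE // ler_nat.
have cF1i : cF <= 1 by apply: le_trans cF2i _; rewrite invf_le1 ?ler1n.
exists Cu, Cv => l.
have as0 : 0 < a_star c.
  have h := C_lambda_gt hc; have h2 := mulr_gt0 (C_Upsilon_gt0 hc) MW0.
  rewrite /a_star divr_gt0 ?subr_gt0 // addr_gt0 //; exact: lt_trans h.
have [rsc1 rsc2 _] := hRSC _ as0.
have hLam : wpa1 P (fun n w => forall i j : 'I_n, i != j ->
    c_low c * zeta N n <= Lambda_n N w i j <= c_high c * zeta N n).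
  exact: wpa1_ae (Lambda_n_range hT).
have hAl : wpa1 P (fun n w => forall l, frob (V N n l - Vh1 E w l *m Oh1 E w l)
    <= 136 * C_F2 c * Num.sqrt n%:R * eta N n).
  exact: (wpa1_forall_fin (Oh1_align hE)).
have ev := wpa1_and (wpa1_and (wpa1_and rsc1 rsc2) (wpa1_and (Upsilon_full hT) (Upsilon_split hT)))
  (wpa1_and (wpa1_and (Theta0_split hT ltr01) hEIG) (wpa1_and hLam hAl)).
have ev2 := wpa1_and (wpa1_and (energy_wpa1 hc hD hS hLR hEIG) (W1_wpa1 hD))
  (wpa1_and (noise_first_step hc hD hS bv0 cF2i hLR hT hE)
            (noise_second_step hc hD hS cF2i hLR hT)).
have [nL [nL1 hL]] := ln_nat_large (1 : R).
apply: wpa1_mono (wpa1_and ev ev2) _; near=> n => w.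
move=> [[[[r1 r2] [u1 u2]] [[th0 [hPsi hPhi]] [lam al]]] [[en hW] [ns1 ns2]]].
have nn0 : (n0 <= n)%N by near: n; exact: nbhs_infty_ge.
have nn1 : (1 < n)%N by exact: leq_trans nn0.
have nnL : (nL <= n)%N by near: n; exact: nbhs_infty_ge.
have L1 := hL n nnL.
have sT : forall l, (Theta N n l)^T = Theta N n l by near: n; exact: Defs.Theta_sym hLR.
have [I14 I23] := split_sizes hS w nn1.
have reg : regular N w cF.
  split => //.
  - exact: zeta_gt0 hT n.
  (* Read off from a single pair of nodes, since [Lambda] is below 1. *)
  - have i0 : (0 < n)%N by exact: ltnW.
    have /andP[h _] := lam (Ordinal i0) (Ordinal nn1) isT.
    by apply: le_trans h _; rewrite /Lambda_n ltW // Lambda_lt1.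
  - by near: n; exact: Theta_bound hLR.
  - by near: n; exact: Theta_rank hLR.
  - by near: n; exact: zeta_rate hT.
have so : sample_ok N w cF.
  split => //.
  - by near: n; exact: Theta_svd hLR.
  - by near: n; exact: calV_orth hLR.
  - have hr : forall l (i : 'I_n), enorm (row i (U N n l))^T <= M c /\ enorm (row i (V N n l))^T <= M c.
      by near: n; exact: row_bound hLR.
    by move=> l' i; have := hr l' i; rewrite !enormE !frob_tr.
  - by move=> i j /lam /andP[].
  - by move=> j a /hPsi /andP[].
  - by move=> i a iI /(hPhi i a iI) /andP[].
have [eta0 s_eta eta2] := eta_bounds so cF1i.
set s := Num.sqrt (log_rate N n) in s_eta eta2 th0 ns1 ns2.
have s0 : 0 < s := sqrt_log_rate_gt0 so.
have scF : s <= cF := reg_rate reg.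
have nR : 0 < n%:R :> R by rewrite ltr0n ltnW.
have z0 := reg_zeta reg.
have mn : (#|I1 N w| <= n)%N by rewrite -[leqRHS](card_ord n) max_card.
have F1 := hstep _ _ _ _ _ _ N n n id w cF _ _ nn0 (leqnn n) (leq_pmull n (isT : 0 < 4)%N)
  cFa cF4 reg r1 u1 (step1_full hE w).
have F2 := hstep _ _ _ _ _ _ N n _ (@rows_of n (I1 N w)) w cF _ _ nn0 mn I14
  cFa cF4 reg r2 u2 (step2_split hE w).
have T1 : `|tau_hat E w - tau N n| <= et * s.
  apply: (tau_rate hc (ltW C10) nn1 _ L1 reg cF1i _ F1); first exact: leq_pmull.
  have c0 : \sum_i \sum_j Theta N n l0 i j = 0 by near: n; exact: Theta0_center hLR.
  by rewrite c0 normr0 !mulr_ge0 // ltW.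
have T2 : `|mean_offdiag (@rows_of n (I1 N w)) (Gh1 E w) - tau N n| <= et * s.
  apply: (tau_rate hc (ltW C10) nn1 I14 L1 reg cF1i _ F2).
  rewrite (sum_rows_of _ (fun i => \sum_j Theta N n l0 i j)).
  have mR : 0 < #|I1 N w|%:R :> R by rewrite ltr0n; exact: rows_gt0 nn1 I14.
  move: th0; rewrite mul1r normrM ger0_norm ?invr_ge0 ?mulr_ge0 //.
  by rewrite ler_pdivrMl ?mulr_gt0.
have TH l' := Theta_hat_rate hc (ltW C10) nn1 mn L1 reg cF1i (@rows_of_inj n (I1 N w)) (sT l') T2 F2.
have hVb l' j k : `|Vh1 E w l' j k| <= bv.
  have [X [hX VX]] := step2_sv hE w l'.
  apply: (Vhat_bound (a := 136 * C_F2 c * eta N n) so bI0 M0 en hX VX _ (Oh1_orth hE w l') _ (TH l')).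
  - by move=> k' j'; apply: Theta_hat_le; exact: ltW.
  - by apply: le_trans (al l') _; rewrite mulrAC.
  - apply: (@le_trans _ _ ((2 * M c * A + ET + 1) * s)).
      have -> : (2 * M c * A + ET + 1) * s = M c * (A * (2 * s)) + ET * s + s by ring.
      apply: ler_wpDr (ltW s0) _; apply: lerD => //; apply: ler_wpM2l (ltW M0) _ _ _.
      apply: le_trans (ler_wpM2r (ltW eta0) (ler_norm _)) _.
      exact: ler_wpM2l A0 _ _ eta2.
    apply: (@le_trans _ _ ((2 * M c * A + ET + 1) * cF2)).
      exact: ler_wpM2l (ltW D20) _ _ (le_trans scF cFb).
    rewrite -/D2 le_eqVlt; apply/orP; left; apply/eqP; rewrite /cF2; field.
    exact: lt0r_neq0.
have adm i j : j != i -> admissible N w i j.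
  by move=> ji; rewrite /admissible hW /=; apply: (so_Lambda so); rewrite eq_sym.
have hn1 i l' k : i \in I2 N w -> `|\sum_(j in I2 N w | j != i)
        (Vh1 E w l' j k * W N w l' i j) * (Y N w i j - Lambda_n N w i j)| <=
     B1 * (n%:R * zeta N n * eta N n).
  move=> iI; apply: le_trans (ns1 i iI (adm i) hVb l' k) _.
  by rewrite /B1 ler_wpM2l // ler_wpM2l // mulr_ge0 // ltW.
have etau : `|tau_hat E w - tau N n| <= et * eta N n.
  by apply: le_trans T1 _; rewrite ler_wpM2l.
have RU i : i \in I2 N w -> forall l', frob (row i (Uh1 E w l') *m Oh1 E w l' - row i (U N n l')) <= Cu * eta N n.
  move=> iI; apply: (hreg1 _ _ _ _ _ _ N n w cF (tau_hat E w) (Vh1 E w) (Oh1 E w) i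
     (fun l' => row i (Uh1 E w l')) so cF1i _ (Oh1_orth hE w) etau _ hVb iI _ (step3_u hE iI)).
  - apply: le_trans eta2 _; rewrite -ler_pdivlMl // mulrC; exact: le_trans scF cFc.
  - move=> l'; apply: le_trans (al l') _; rewrite ler_wpM2r ?(ltW eta0) // ler_wpM2r ?sqrtr_ge0 //.
    by apply: le_trans (ler_norm _) _; rewrite lerDl.
  - by move=> l' k; exact: hn1.
have hUb l' i k : `|U N n l' i k| <= M c.
  have [h _] := so_rows so l' i; apply: le_trans h.
  by have := normr_le_frob (row i (U N n l')) 0 k; rewrite mxE.
have nz : B2 * (n%:R * zeta N n * s) <= B2 * (n%:R * zeta N n * eta N n).
  by rewrite ler_wpM2l // ler_wpM2l // mulr_ge0 // ltW.
have RV j : forall l', frob (row j (Vd E w l') *m Oh1 E w l' - row j (V N n l')) <= Cv * eta N n.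
  have [ns3 ns4] := ns2 j (fun i => adm j i) hUb.
  apply: (hreg2 _ _ _ _ _ _ N n w cF (tau_hat E w) (Uh1 E w) (Oh1 E w) j
     (fun l' => row j (Vd E w l')) so cF2i _ (Oh1_orth hE w) etau _ _ _ (step3_v hE (w := w) (j := j))).
  - apply: le_trans eta2 _; rewrite -ler_pdivlMl // mulrC; exact: le_trans scF cFd.
  - by move=> l' i iI; exact: RU.
  - move=> l' k; apply: le_trans nz; have := ns3 l' k; congr (`|_| <= _); apply: eq_bigr => i _.
    by rewrite (W_sym hD) Y_sym (Lambda_n_sym hD).
  - apply: le_trans nz; move: ns4; congr (`|_| <= _); apply: eq_bigr => i _.
    by rewrite Y_sym (Lambda_n_sym hD).
split=> [i iI|j]; rewrite -trmx_mul -linearB /= enormE frob_tr; [exact: RU | exact: RV].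
Unshelve. all: by end_near. Qed.
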